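(* There is an algorithm that, given a connected graph $G=(V,E)$ with maximum degree $\Delta$ and a set $W\subseteq V$ such that the induced subgraph $\langle W\rangle$ is connected, computes the equivalence relation $\mathfrak d_{|S_v}(W)^*$ (i.e. its equivalence classes on $E$) in $O(|E|\Delta)$ time and $O(|E|+\Delta^2)$ space.
   Context: All graphs are finite, simple, undirected; $N(x)$ is the open neighborhood of $x$. For distinct edges $e=vu$, $f=vw$ sharing the vertex $v$, a square spanned by $e$ and $f$ is a 4-cycle $vuxw$ with $x\ne v$ adjacent to both $u$ and $w$; $x$ is its top vertex. The square is chordless if it is an induced 4-cycle ($uw\notin E$, $vx\notin E$); its opposite edge pairs are $\{vu,wx\}$ and $\{vw,ux\}$. The edges $e,f$ span a unique square if $|N(u)\cap N(w)|=2$. The relation $\delta_G$ on $E(G)$: $(e,f)\in\delta_G$ iff (i) $e,f$ are distinct adjacent edges and it is not the case that they span a unique square and that square is chordless; or (ii) $e,f$ are opposite edges of a chordless square; or (iii) $e=f$. For $v\in V(G)$, $E_v$ is the set of edges incident to $v$, and $\mathfrak d_v=((E_v\times E)\cup(E\times E_v))\cap\delta_G$; $\mathfrak d_v^*$ is its transitive closure. $F_v$ is the set of edges $g\notin E_v$ such that $g$ is an edge of a chordless square spanned by some $e,e'\in E_v$ with $(e,e')\notin\mathfrak d_v^*$. The partial star product $S_v$ is the subgraph with edge set $E_v\cup F_v$. The local coloring is $\mathfrak d_{|S_v}=\{(e,f)\in\mathfrak d_v^*: e,f\in E(S_v)\}$, and for $W\subseteq V$, $\mathfrak d_{|S_v}(W)=\bigcup_{v\in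 W}\mathfrak d_{|S_v}$; $\mathfrak d_{|S_v}(W)^*$ is its transitive closure (the global coloring). Complexity is measured in the standard RAM model with $G$ given by an edge list/adjacency list. *)

(* Defs.v *)
From Stdlib Require Import Arith Lia List Relations.
Import ListNotations.

Definition Edge := (nat * nat)%type.

Definition wf_graph (n : nat) (es : list Edge) : Prop :=
  NoDup es /\ forall a b, In (a, b) es -> a < b < n.

Definition adj (es : list Edge) (u v : nat) : Prop :=
  In (u, v) es \/ In (v, u) es.

Definition ed (a b : nat) : Edge := (Nat.min a b, Nat.max a b).

Definition incident (v : nat) (e : Edge) : Prop := fst e = v \/ snd e = v.

Definition other (e : Edge) (v : nat) : nat :=
  if Nat.eqb (fst e) v then snd e else fst e.

Definition conn_in (es : list Edge) (P : nat -> Prop) : nat -> nat -> Prop :=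
  clos_refl_trans nat (fun a b => P a /\ P b /\ adj es a b).

Definition connected_graph (n : nat) (es : list Edge) : Prop :=
  0 < n /\ forall u v, u < n -> v < n -> conn_in es (fun x => x < n) u v.

Definition inW (n : nat) (W : nat -> bool) (v : nat) : Prop := v < n /\ W v = true.

Definition induced_connected (n : nat) (es : list Edge) (W : nat -> bool) : Prop :=
  (exists w, inW n W w) /\
  forall u v, inW n W u -> inW n W v -> conn_in es (inW n W) u v.

Definition deg (es : list Edge) (v : nat) : nat :=
  length (filter (fun e => orb (Nat.eqb (fst e) v) (Nat.eqb (snd e) v)) es).

Definition maxdeg (n : nat) (es : list Edge) : nat :=
  fold_left Nat.max (map (deg es) (seq 0 n)) 0.

Definition chordless_sq (es : list Edge) (a b c d : nat) : Prop :=
  NoDup [a; b; c; d] /\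
  adj es a b /\ adj es b c /\ adj es c d /\ adj es d a /\
  ~ adj es a c /\ ~ adj es b d.

(* e = vu, f = vw span a unique square (|N(u) ∩ N(w)| = 2, the two common
   neighbours being v and the top vertex x) and that square is chordless. *)
Definition unique_chordless_square (es : list Edge) (v u w : nat) : Prop :=
  exists x, x <> v /\ adj es u x /\ adj es w x /\
    (forall y, adj es u y -> adj es w y -> y = v \/ y = x) /\
    ~ adj es u w /\ ~ adj es v x.

Definition opposite_chordless (es : list Edge) (e f : Edge) : Prop :=
  exists a b c d, chordless_sq es a b c d /\ e = ed a b /\ f = ed c d.

Definition delta (es : list Edge) (e f : Edge) : Prop :=
  In e es /\ In f es /\
  ( (e <> f /\ exists v, incident v e /\ incident v f /\
        ~ unique_chordless_square es v (other e v) (other f v))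
    \/ opposite_chordless es e f
    \/ e = f ).

Definition dv (es : list Edge) (v : nat) (e f : Edge) : Prop :=
  delta es e f /\ (incident v e \/ incident v f).

Definition dvstar (es : list Edge) (v : nat) : relation Edge :=
  clos_trans Edge (dv es v).

Definition Fv (es : list Edge) (v : nat) (g : Edge) : Prop :=
  In g es /\ ~ incident v g /\
  exists u x w, chordless_sq es v u x w /\
    ~ dvstar es v (ed v u) (ed v w) /\
    (g = ed u x \/ g = ed x w).

Definition inSv (es : list Edge) (v : nat) (e : Edge) : Prop :=
  In e es /\ (incident v e \/ Fv es v e).

Definition dS (es : list Edge) (v : nat) (e f : Edge) : Prop :=
  dvstar es v e f /\ inSv es v e /\ inSv es v f.

Definition dSW (n : nat) (es : list Edge) (W : nat -> bool) (e f : Edge) : Prop :=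
  exists v, inW n W v /\ dS es v e f.

Definition global_coloring (n : nat) (es : list Edge) (W : nat -> bool) : relation Edge :=
  clos_trans Edge (dSW n es W).

(* Word RAM.  Registers are indexed by nat; unit cost per instruction;
   indirect addressing; the word size is polynomially bounded in the input
   size (checked on every written value). *)
Inductive instr : Type :=
| IConst (r k : nat)
| IAdd (r a b : nat)
| ISub (r a b : nat)
| ILoad (r a : nat)
| IStore (a b : nat)
| IJz (a t : nat)
| IHalt.

Definition program := list instr.
Definition mem := nat -> nat.
Definition config := (nat * mem)%type.

Definition upd (m : mem) (r x : nat) : mem :=
  fun a => if Nat.eqb a r then x else m a.

Definition halted (P : program) (c : config) : Prop :=
  nth_error P (fst c) = Some IHalt \/ nth_error P (fst c) = None.

Definition step (P : program) (c : config) : config :=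
  let (pc, m) := c in
  match nth_error P pc with
  | Some (IConst r k) => (S pc, upd m r k)
  | Some (IAdd r a b) => (S pc, upd m r (m a + m b))
  | Some (ISub r a b) => (S pc, upd m r (m a - m b))
  | Some (ILoad r a) => (S pc, upd m r (m (m a)))
  | Some (IStore a b) => (S pc, upd m (m a) (m b))
  | Some (IJz a t) => (if Nat.eqb (m a) 0 then t else S pc, m)
  | Some IHalt => (pc, m)
  | None => (pc, m)
  end.

Definition accessed (P : program) (c : config) : list nat :=
  let (pc, m) := c in
  match nth_error P pc with
  | Some (IConst r _) => [r]
  | Some (IAdd r a b) => [r; a; b]
  | Some (ISub r a b) => [r; a; b]
  | Some (ILoad r a) => [r; a; m a]
  | Some (IStore a b) => [a; b; m a]
  | Some (IJz a _) => [a]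
  | _ => []
  end.

Definition written (P : program) (c : config) : nat :=
  let (pc, m) := c in
  match nth_error P pc with
  | Some (IConst _ k) => k
  | Some (IAdd _ a b) => m a + m b
  | Some (ISub _ a b) => m a - m b
  | Some (ILoad _ a) => m (m a)
  | Some (IStore _ b) => m b
  | _ => 0
  end.

Definition run (P : program) (c : config) (k : nat) : config :=
  Nat.iter k (step P) c.

(* Input encoding: R[0] = n, R[1] = |E|, R[2+2i], R[3+2i] = endpoints of the
   i-th edge, R[2+2|E|+v] = [v \in W] for v < n, all other registers 0. *)
Definition encode (n : nat) (es : list Edge) (W : nat -> bool) : mem :=
  fun a =>
    let m := length es in
    if Nat.eqb a 0 then n
    else if Nat.eqb a 1 then m
    else if Nat.ltb a (2 + 2 * m) then
      let j := a - 2 in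
      let e := nth (Nat.div j 2) es (0, 0) in
      if Nat.even j then fst e else snd e
    else if Nat.ltb a (2 + 2 * m + n) then
      (if W (a - (2 + 2 * m)) then 1 else 0)
    else 0.

(* Output convention: at halting, R[i] (i < |E|) is a label of the i-th edge;
   label 0 means "not related to anything"; edges i, j are related by the
   computed relation iff they carry the same nonzero label. *)
Definition output_represents (m : mem) (es : list Edge) (Rel : relation Edge) : Prop :=
  forall i j, i < length es -> j < length es ->
    ((m i = m j /\ m i <> 0) <-> Rel (nth i es (0, 0)) (nth j es (0, 0))).

(* Main.v *)
(** For [x <> v] let [common x] be the set of neighbours of [v] adjacent to [x].  On the
    edges at [v], the relation [dvstar] is generated by three families of pairs [vu, vw]:
    [u] adjacent to [w]; both [u] and [w] in [common x] for some [x] not adjacent to [v] with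
    at least three elements in [common x]; and pairs for which the number of [x] not adjacent
    to [v] with [common x = {u, w}] differs from one.  An edge of [S_v] off [v] is [ux] with
    [x] not adjacent to [v] and [common x = {u, w}], [vu] and [vw] unrelated, and it has the
    colour of [vw].  All this is read off the walks of length two from [v], so one vertex
    costs O(deg(v) Delta), and the sum over [W] is O(|E| Delta).

    If [p] in [W] is adjacent to [v], every local colour at [v] occurs on an edge at [p].
    Visiting [W] in an order in which each vertex but the first follows a neighbour,
    no new global colour appears after the first vertex; hence at most Delta merges of two
    colours occur, and each may rescan the whole edge array.

    The algorithm is a program of a small while-language with arrays whose semantics checks
    array indices and counts ticks.  Its expressions change a value only by constants, so
    register contents grow by O(1) per tick and the bound on the word size follows from the
    bound on the running time. *)
Require Import Defs.
From Stdlib Require Import Arith Lia List Relations Bool.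
Import ListNotations.

(** * A while-language and its compilation to the RAM *)

(** The closure [dvstar] also runs over edges not at v, so a chain between two edges at v may leave
    $E_v$ and return. A pair in [dv] always contains an edge at v, so an excursion uses one outside
    edge only. Completeness of the generators thus reduces to this: two edges at v that are
    [delta]-related to the same outside edge are joined by generators.

    Testing each pair vu, vw by intersecting N(u) and N(w) would cost deg(v)^2 Delta. It suffices to
    count the tops x with [common x] equal to {u, w}: a further top either is adjacent to v, and
    then u and w are both joined to it, or has at least three common neighbours with v, and then all
    of these are joined. A counted top is met on just two walks, so counting costs no more than
    listing the walks.

    Classes and colours are merged by plain relabelling. The scan is charged to the label that
    disappears, through a potential counting the labels in use; this avoids the extra factor of a
    union-find structure. Arrays indexed by vertices are never cleared as a whole between two
    vertices of W: only the cells within reach of the current vertex are reset, so invariants on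
    them speak of those cells alone. *)

Inductive var := vN | vM | vP | vA | vC | vX | vY | vI | vJ | vT | vR | vH
  | vTl | vV | vD | vQ | vO | vE | vK | vA1 | vB1 | vNC | vU.
(* Adjacency lists: [aHD u] is the first arc at [u], [aNX] the next arc, [aTO] and [aEI] the
   head and the edge of an arc; arcs are numbered from 1 and 0 ends a list.
   At the current vertex v with neighbours [aNB] (edges [aNE]), for x within distance two:
   [aPS x] is the position of x among the neighbours plus one, 0 if x is not adjacent to v,
   and deg(v)+1 for x = v; [aKX], [aF1], [aFL] are the number and the first and last position
   of the neighbours adjacent to x.  [aLB] is the local class of a position, [aCT] counts
   squares, [aGC] is the global colour of a local class and [aCOL] that of an edge.
   [aLOW] is raw memory: it holds the input at the start and the output at the end. *)
Inductive arr := aIN | aHD | aNX | aTO | aEI | aW | aSEEN | aQ | aNB | aNE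
  | aKX | aPS | aF1 | aFL | aLB | aCT | aGC | aCOL | aLOW.
Scheme Equality for var.
Scheme Equality for arr.

Definition vreg (x : var) : nat :=
  match x with
  | vN => 0 | vM => 1 | vP => 2 | vA => 3 | vC => 4 | vX => 5 | vY => 6
  | vI => 7 | vJ => 8 | vT => 9 | vR => 10 | vH => 11 | vTl => 12 | vV => 13
  | vD => 14 | vQ => 15 | vO => 16 | vE => 17 | vK => 18 | vA1 => 19
  | vB1 => 20 | vNC => 21 | vU => 22
  end.

Definition aidx (j : arr) : nat :=
  match j with
  | aIN => 0 | aHD => 1 | aNX => 2 | aTO => 3 | aEI => 4 | aW => 5
  | aSEEN => 6 | aQ => 7 | aNB => 8 | aNE => 9 | aKX => 10 | aPS => 11
  | aF1 => 12 | aFL => 13 | aLB => 14 | aCT => 15 | aGC => 16 | aCOL => 17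
  | aLOW => 18
  end.

(** Registers 0 to 22 hold the variables and 23 to 26 the scratch values and the array base, so
    memory is free from [KR] on. The stride [NA] is a power of two above the number of arrays: the
    RAM cannot multiply, and an index is scaled by five doublings. *)
Notation rT1 := 23.
Notation rT2 := 24.
Notation rH := 25.
Notation rBase := 26.
Notation KR := 27.
Notation NA := 32.

Inductive expr :=
| Va (x : var) | Ct (k : nat) | Rd (j : arr) (e : expr)
| Pl (e : expr) (k : nat) | Mi (e : expr) (k : nat).

Inductive cond := Eq (e1 e2 : expr) | Lt (e1 e2 : expr).

Inductive cmd :=
| Skip
| Assign (x : var) (e : expr)
| Store (j : arr) (e1 e2 : expr)
| Seq (c1 c2 : cmd)
| If (b : cond) (c1 c2 : cmd)
| While (b : cond) (c : cmd).

Record st := mkst { sv : var -> nat; sa : arr -> nat -> nat }.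

Definition setv (s : st) (x : var) (a : nat) : st :=
  mkst (fun y => if var_beq y x then a else sv s y) (sa s).

Definition seta (s : st) (j : arr) (i a : nat) : st :=
  mkst (sv s) (fun j' => if arr_beq j' j then upd (sa s j) i a else sa s j').

Fixpoint ev (e : expr) (s : st) : nat :=
  match e with
  | Va x => sv s x
  | Ct k => k
  | Rd j e => sa s j (ev e s)
  | Pl e k => ev e s + k
  | Mi e k => ev e s - k
  end.

Definition evb (b : cond) (s : st) : bool :=
  match b with
  | Eq e1 e2 => ev e1 s =? ev e2 s
  | Lt e1 e2 => ev e1 s <? ev e2 s
  end.

Lemma var_beq_refl x : var_beq x x = true.
Proof. destruct x; reflexivity. Qed.

Lemma arr_beq_refl x : arr_beq x x = true.
Proof. destruct x; reflexivity. Qed.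

Lemma var_beq_true x y : var_beq x y = true -> x = y.
Proof. apply internal_var_dec_bl. Qed.

Lemma arr_beq_true x y : arr_beq x y = true -> x = y.
Proof. apply internal_arr_dec_bl. Qed.

Section Semantics.

Context (IB B0 : nat).

(** [IB] bounds array indices and [B0] is the address where the arrays start; [aLOW] is the raw
    memory between the registers and the arrays. *)
Definition valid (j : arr) (i : nat) : Prop :=
  match j with aLOW => KR <= i < B0 | _ => i <= IB end.

Fixpoint eok (e : expr) (s : st) : Prop :=
  match e with
  | Va _ | Ct _ => True
  | Rd j e => eok e s /\ valid j (ev e s)
  | Pl e _ | Mi e _ => eok e s
  end.

Definition bok (b : cond) (s : st) : Prop :=
  match b with Eq e1 e2 | Lt e1 e2 => eok e1 s /\ eok e2 s end.

(* [exec c s t s']: [c] runs safely from [s] to [s'] in [t] ticks, one tick per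
   assignment, store or test. *)
Inductive exec : cmd -> st -> nat -> st -> Prop :=
| ex_skip s : exec Skip s 0 s
| ex_assign x e s : eok e s -> exec (Assign x e) s 1 (setv s x (ev e s))
| ex_store j e1 e2 s : eok e1 s -> eok e2 s -> valid j (ev e1 s) ->
    exec (Store j e1 e2) s 1 (seta s j (ev e1 s) (ev e2 s))
| ex_seq c1 c2 s t1 s1 t2 s2 : exec c1 s t1 s1 -> exec c2 s1 t2 s2 ->
    exec (Seq c1 c2) s (t1 + t2) s2
| ex_if b c1 c2 s t s' : bok b s -> exec (if evb b s then c1 else c2) s t s' ->
    exec (If b c1 c2) s (S t) s'
| ex_while_end b c s : bok b s -> evb b s = false -> exec (While b c) s 1 s
| ex_while_step b c s t1 s1 t2 s2 : bok b s -> evb b s = true ->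
    exec c s t1 s1 -> exec (While b c) s1 t2 s2 ->
    exec (While b c) s (S (t1 + t2)) s2.

Definition wp (c : cmd) (Q : nat -> st -> Prop) (s : st) : Prop :=
  exists t s', exec c s t s' /\ Q t s'.

(* Arrays are interleaved, so all of them may grow without a static size. *)
Definition adr (j : arr) (i : nat) : nat :=
  match j with aLOW => i | _ => B0 + NA * i + aidx j end.

Definition Amax : nat := B0 + NA * (IB + 1).

Definition sim (s : st) (m : mem) : Prop :=
  (forall x, m (vreg x) = sv s x) /\
  (forall j i, valid j i -> m (adr j i) = sa s j i) /\
  m rBase = B0.

(** Values are bounded over the whole memory at once, so that a load needs no separate argument
    about the cell it reads. *)
Definition bnd (m : mem) (U : nat) : Prop := forall a, m a <= U.

Definition iacc (i : instr) (m : mem) : list nat :=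
  match i with
  | IConst r _ => [r]
  | IAdd r a b => [r; a; b]
  | ISub r a b => [r; a; b]
  | ILoad r a => [r; a; m a]
  | IStore a b => [a; b; m a]
  | _ => []
  end.

Definition iwr (i : instr) (m : mem) : nat :=
  match i with
  | IConst _ k => k
  | IAdd _ a b => m a + m b
  | ISub _ a b => m a - m b
  | ILoad _ a => m (m a)
  | IStore _ b => m b
  | _ => 0
  end.

Definition isem (i : instr) (m : mem) : mem :=
  match i with
  | IConst r k => upd m r k
  | IAdd r a b => upd m r (m a + m b)
  | ISub r a b => upd m r (m a - m b)
  | ILoad r a => upd m r (m (m a))
  | IStore a b => upd m (m a) (m b)
  | _ => m
  end.

Definition straight (i : instr) : Prop :=
  match i with IJz _ _ | IHalt => False | _ => True end.

Fixpoint sem_list (l : list instr) (m : mem) : mem :=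
  match l with [] => m | i :: l => sem_list l (isem i m) end.

Fixpoint safe_list (L U : nat) (l : list instr) (m : mem) : Prop :=
  match l with
  | [] => True
  | i :: l => straight i /\ (forall a, In a (iacc i m) -> a < L) /\ iwr i m <= U /\
      safe_list L U l (isem i m)
  end.

Lemma sem_list_app l1 l2 m : sem_list (l1 ++ l2) m = sem_list l2 (sem_list l1 m).
Proof. revert m; induction l1; intros; simpl; auto. Qed.

Lemma safe_list_app L U l1 l2 m :
  safe_list L U l1 m -> safe_list L U l2 (sem_list l1 m) -> safe_list L U (l1 ++ l2) m.
Proof.
  revert m; induction l1; intros m H1 H2; simpl in *; auto.
  intuition.
Qed.

Lemma safe_list_mono L U U' l m : U <= U' -> safe_list L U l m -> safe_list L U' l m.
Proof.
  intros HU; revert m; induction l; intros m H; simpl in *; auto.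
  intuition. lia.
Qed.

Definition reach (P : program) (L U T : nat) (c c' : config) : Prop :=
  run P c T = c' /\
  forall i, i < T -> (forall a, In a (accessed P (run P c i)) -> a < L) /\
                     written P (run P c i) <= U.

Lemma reach_refl P L U c : reach P L U 0 c c.
Proof. split; [reflexivity | lia]. Qed.

Lemma run_add P c a b : run P c (a + b) = run P (run P c a) b.
Proof. unfold run. rewrite Nat.add_comm. apply Nat.iter_add. Qed.

Lemma reach_trans P L U T1 T2 c1 c2 c3 :
  reach P L U T1 c1 c2 -> reach P L U T2 c2 c3 -> reach P L U (T1 + T2) c1 c3.
Proof.
  intros [R1 S1] [R2 S2]. split.
  - rewrite run_add, R1. exact R2.
  - intros i Hi. destruct (Nat.lt_ge_cases i T1) as [h|h]; auto.
    replace i with (T1 + (i - T1)) by lia. rewrite run_add, R1. apply S2. lia.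
Qed.

Lemma reach_mono P L U L' U' T c c' : L <= L' -> U <= U' ->
  reach P L U T c c' -> reach P L' U' T c c'.
Proof.
  intros HL HU [R S]. split; auto. intros i Hi. destruct (S i Hi) as [A B].
  split; [|lia]. intros a Ha. specialize (A a Ha). lia.
Qed.

Lemma reach_one P L U c c' : step P c = c' ->
  (forall a, In a (accessed P c) -> a < L) -> written P c <= U ->
  reach P L U 1 c c'.
Proof.
  intros H1 H2 H3. split; [exact H1|]. intros i Hi. replace i with 0 by lia. auto.
Qed.

Definition code_at (P : program) (pc : nat) (l : list instr) : Prop :=
  forall i x, nth_error l i = Some x -> nth_error P (pc + i) = Some x.

Lemma code_at_app P pc l1 l2 : code_at P pc (l1 ++ l2) ->
  code_at P pc l1 /\ code_at P (pc + length l1) l2.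
Proof.
  intros H; split; intros i x Hi.
  - apply H. rewrite nth_error_app1; auto.
    apply nth_error_Some. congruence.
  - rewrite <- Nat.add_assoc. apply H. rewrite nth_error_app2 by lia.
    rewrite <- Hi. f_equal. lia.
Qed.

Lemma code_at_cons P pc i l : code_at P pc (i :: l) ->
  nth_error P pc = Some i /\ code_at P (S pc) l.
Proof.
  intros H; split.
  - rewrite <- (Nat.add_0_r pc). apply H. reflexivity.
  - intros k x Hk. replace (S pc + k) with (pc + S k) by lia. apply H. exact Hk.
Qed.

Lemma reach_straight P L U l pc m : code_at P pc l -> safe_list L U l m ->
  reach P L U (length l) (pc, m) (pc + length l, sem_list l m).
Proof.
  revert pc m; induction l as [|i l IH]; intros pc m HC HS.
  - simpl. rewrite Nat.add_0_r. apply reach_refl.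
  - apply code_at_cons in HC as [Hi HC].
    destruct HS as (Hst & Hacc & Hw & HS).
    change (length (i :: l)) with (1 + length l).
    eapply reach_trans with (c2 := (S pc, isem i m)).
    + apply reach_one; simpl; rewrite Hi; destruct i; try contradiction; auto.
    + replace (pc + (1 + length l)) with (S pc + length l) by lia.
      apply IH; auto.
Qed.

Definition compA (t : nat) (j : arr) : list instr :=
  match j with
  | aLOW => []
  | _ => [IAdd t t t; IAdd t t t; IAdd t t t; IAdd t t t; IAdd t t t;
       IConst rH (aidx j); IAdd t t rH; IAdd t t rBase]
  end.

Fixpoint compE (t : nat) (e : expr) : list instr :=
  match e with
  | Va x => [IConst t 0; IAdd t (vreg x) t]
  | Ct k => [IConst t k]
  | Rd j e => compE t e ++ compA t j ++ [ILoad t t]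
  | Pl e k => compE t e ++ [IConst rH k; IAdd t t rH]
  | Mi e k => compE t e ++ [IConst rH k; ISub t t rH]
  end.

(** The outcome is in [rH], nonzero iff the condition holds. For equality, one of the two truncated
    differences is positive exactly when the values differ, and 1 minus their sum negates this. *)
Definition compB (b : cond) : list instr :=
  match b with
  | Eq e1 e2 => compE rT1 e1 ++ compE rT2 e2 ++
      [ISub rH rT1 rT2; ISub rT2 rT2 rT1; IAdd rH rH rT2; IConst rT1 1; ISub rH rT1 rH]
  | Lt e1 e2 => compE rT1 e1 ++ compE rT2 e2 ++ [ISub rH rT2 rT1]
  end.

Fixpoint csize (c : cmd) : nat :=
  match c with
  | Skip => 0
  | Assign x e => length (compE rT1 e) + 2
  | Store j e1 e2 => length (compE rT1 e1) + length (compE rT2 e2) + length (compA rT1 j) + 1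
  | Seq c1 c2 => csize c1 + csize c2
  | If b c1 c2 => length (compB b) + 1 + csize c1 + 2 + csize c2
  | While b c => length (compB b) + 1 + csize c + 2
  end.

(** Jump targets are absolute, hence the code address [pc] as a parameter and a size known
    beforehand. Zeroing [rH] and testing it serves as the unconditional jump. *)
Fixpoint comp (pc : nat) (c : cmd) : list instr :=
  match c with
  | Skip => []
  | Assign x e => compE rT1 e ++ [IConst (vreg x) 0; IAdd (vreg x) rT1 (vreg x)]
  | Store j e1 e2 => compE rT1 e1 ++ compE rT2 e2 ++ compA rT1 j ++ [IStore rT1 rT2]
  | Seq c1 c2 => comp pc c1 ++ comp (pc + csize c1) c2
  | If b c1 c2 =>
      let p1 := pc + length (compB b) + 1 in
      let p2 := p1 + csize c1 + 2 in
      compB b ++ [IJz rH p2] ++ comp p1 c1 ++ [IConst rH 0; IJz rH (p2 + csize c2)]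
      ++ comp p2 c2
  | While b c =>
      let p1 := pc + length (compB b) + 1 in
      compB b ++ [IJz rH (p1 + csize c + 2)] ++ comp p1 c ++ [IConst rH 0; IJz rH pc]
  end.

Lemma comp_length c pc : length (comp pc c) = csize c.
Proof.
  revert pc; induction c; intros; cbn [comp csize]; repeat rewrite length_app;
    cbn [length]; rewrite ?IHc, ?IHc1, ?IHc2; lia.
Qed.

(** [kE], [kB] and [kC] bound how much one tick can raise the largest value in memory. A subtracted
    constant counts too, since it is itself written to a register. *)
Fixpoint kE (e : expr) : nat :=
  match e with
  | Va _ => 0 | Ct k => k | Rd _ e => kE e | Pl e k => kE e + k | Mi e k => kE e + k
  end.

Definition kB (b : cond) : nat :=
  match b with Eq e1 e2 | Lt e1 e2 => kE e1 + kE e2 + 1 end.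

Fixpoint kC (c : cmd) : nat :=
  match c with
  | Skip => 0
  | Assign _ e => kE e
  | Store _ e1 e2 => kE e1 + kE e2
  | Seq c1 c2 => Nat.max (kC c1) (kC c2)
  | If b c1 c2 => Nat.max (kB b) (Nat.max (kC c1) (kC c2))
  | While b c => Nat.max (kB b) (kC c)
  end.

(** The number of RAM steps that one tick may cost. Besides the test, the 3 covers the conditional
    jump and the two instructions of the jump that closes a branch or a loop body. *)
Fixpoint cC (c : cmd) : nat :=
  match c with
  | Skip => 0
  | Assign _ e => length (compE rT1 e) + 2
  | Store j e1 e2 => length (compE rT1 e1) + length (compE rT2 e2) + length (compA rT1 j) + 1
  | Seq c1 c2 => Nat.max (cC c1) (cC c2)
  | If b c1 c2 => Nat.max (length (compB b) + 3) (Nat.max (cC c1) (cC c2))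
  | While b c => Nat.max (length (compB b) + 3) (cC c)
  end.

Lemma upd_same m r x : upd m r x r = x.
Proof. unfold upd. now rewrite Nat.eqb_refl. Qed.

Lemma upd_other m r x a : a <> r -> upd m r x a = m a.
Proof. intros H. unfold upd. apply Nat.eqb_neq in H. now rewrite H. Qed.

Lemma vreg_lt x : vreg x < 23.
Proof. destruct x; simpl; lia. Qed.

Lemma vreg_inj x y : vreg x = vreg y -> x = y.
Proof. destruct x; destruct y; simpl; intros H; try reflexivity; discriminate. Qed.

Lemma aidx_lt j : aidx j < NA.
Proof. destruct j; simpl; lia. Qed.

Lemma aidx_inj j j' : aidx j = aidx j' -> j = j'.
Proof. destruct j; destruct j'; simpl; intros H; try reflexivity; discriminate. Qed.

Lemma bnd_upd m U r x : bnd m U -> x <= U -> bnd (upd m r x) U.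
Proof. intros H Hx a. unfold upd. destruct (a =? r); auto. Qed.

Lemma bnd_mono m U U' : U <= U' -> bnd m U -> bnd m U'.
Proof. intros H B a. specialize (B a). lia. Qed.

Lemma reach_jz P L U pc m r t : nth_error P pc = Some (IJz r t) -> r < L ->
  reach P L U 1 (pc, m) (if m r =? 0 then t else S pc, m).
Proof.
  intros H HL. apply reach_one; simpl; rewrite H; auto; [|simpl; lia].
  simpl. intros a [<-|[]]; auto.
Qed.

Context (HB0 : KR <= B0).

Lemma adr_ge j i : valid j i -> KR <= adr j i.
Proof. destruct j; simpl; intros; lia. Qed.

Lemma adr_lt j i : valid j i -> adr j i < Amax.
Proof. unfold Amax; destruct j; simpl; intros; lia. Qed.

Lemma adr_inj j i j' i' : valid j i -> valid j' i' -> adr j i = adr j' i' ->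
  j = j' /\ i = i'.
Proof.
  intros V V' H. assert (J : aidx j = aidx j').
  { destruct j; destruct j'; simpl in *; lia. }
  apply aidx_inj in J. subst j'. split; auto. destruct j; simpl in *; lia.
Qed.

Definition agree_off (t : nat) (m m' : mem) : Prop :=
  forall a, a <> t -> a <> rH -> m' a = m a.

Ltac inlist := simpl; intros ? ?HIn;
  repeat (destruct HIn as [HIn|HIn]; [subst; try lia|]); try contradiction.

Lemma compA_ok t j x m U : t = rT1 \/ t = rT2 -> m t = x -> m rBase = B0 -> valid j x ->
  bnd m U -> Amax <= U ->
  safe_list (S Amax) U (compA t j) m /\
  let m' := sem_list (compA t j) m in
  m' t = adr j x /\ agree_off t m m' /\ bnd m' U.
Proof.
  intros Ht Hx Hbase Hv Hb HU.
  assert (Hbig : KR < S Amax) by (unfold Amax; lia).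
  assert (Hlt := adr_lt _ _ Hv).
  destruct (arr_eq_dec j aLOW) as [->|Hj].
  - simpl. repeat split; auto.
  - assert (C : compA t j = [IAdd t t t; IAdd t t t; IAdd t t t; IAdd t t t; IAdd t t t;
      IConst rH (aidx j); IAdd t t rH; IAdd t t rBase]) by (destruct j; try reflexivity; congruence).
    assert (Ea : adr j x = B0 + NA * x + aidx j) by (destruct j; try reflexivity; congruence).
    assert (Q : aidx j < NA) by apply aidx_lt.
    rewrite C. remember (aidx j) as ja.
    cbn [sem_list safe_list isem iwr iacc straight].
    repeat (rewrite ?upd_same, ?(upd_other _ _ _ t), ?(upd_other _ _ _ rH),
      ?(upd_other _ _ _ rBase) by lia).
    rewrite Hx, Hbase.
    repeat split; try (inlist; lia); try lia.
    + intros a G1 G2. rewrite !upd_other; auto.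
    + repeat apply bnd_upd; auto; lia.
Qed.

Lemma compE_ok t e : t = rT1 \/ t = rT2 -> forall s m U,
  sim s m -> bnd m U -> Amax <= U -> eok e s ->
  safe_list (S Amax) (U + kE e) (compE t e) m /\
  let m' := sem_list (compE t e) m in
  m' t = ev e s /\ agree_off t m m' /\ bnd m' (U + kE e).
Proof.
  intros Ht s m U.
  assert (Hb : KR < S Amax) by (unfold Amax; lia).
  revert m. induction e as [x|k|j e IH|e IH k|e IH k]; intros m Hs Hbd HU Hok.
  - assert (V := vreg_lt x). destruct Hs as (Sv & _).
    assert (Bx := Hbd (vreg x)).
    simpl. rewrite upd_same, !upd_other by lia.
    repeat split; try (inlist; lia); try lia.
    + rewrite upd_same. rewrite Sv. lia.
    + intros a H1 H2. now rewrite !upd_other.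
    + repeat apply bnd_upd; rewrite ?upd_same, ?(upd_other _ _ _ t) by lia; try lia.
      eapply bnd_mono; [|eassumption]; lia.
  - simpl. repeat split; try (inlist; lia); try lia.
    + apply upd_same.
    + intros a H1 H2. now rewrite !upd_other.
    + repeat apply bnd_upd; rewrite ?upd_same, ?(upd_other _ _ _ t) by lia; try lia.
      eapply bnd_mono; [|eassumption]; lia.
  - simpl in Hok. destruct Hok as [Hok Hv].
    destruct (IH m Hs Hbd HU Hok) as (S1 & T1 & A1 & B1).
    set (m1 := sem_list (compE t e) m) in *.
    assert (Hbase : m1 rBase = B0) by (rewrite A1 by lia; apply Hs).
    assert (Hadr : m1 (adr j (ev e s)) = sa s j (ev e s)).
    { assert (G := adr_ge _ _ Hv). rewrite A1 by lia. apply Hs. auto. }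
    assert (Hlt := adr_lt _ _ Hv).
    assert (Hbv := B1 (adr j (ev e s))).
    destruct (compA_ok t j _ m1 (U + kE e) Ht T1 Hbase Hv B1 ltac:(lia)) as (S2 & T2 & A2 & B2).
    cbn [compE kE]. rewrite !sem_list_app. fold m1. set (m2 := sem_list (compA t j) m1) in *.
    assert (G := adr_ge _ _ Hv).
    assert (V2 : m2 (adr j (ev e s)) = sa s j (ev e s)) by (rewrite A2 by lia; auto).
    cbn [sem_list isem]. rewrite T2, V2. repeat split.
    + apply safe_list_app; auto. fold m1. apply safe_list_app; auto. fold m2.
      cbn [safe_list straight iacc iwr isem]. rewrite T2, V2.
      rewrite Hadr in Hbv. repeat split; try lia. inlist.
    + apply upd_same.
    + intros a H1 H2. rewrite upd_other, A2 by auto. auto.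
    + apply bnd_upd; auto. rewrite <- Hadr. auto.
  - simpl in Hok. destruct (IH m Hs Hbd HU Hok) as (S1 & T1 & A1 & B1).
    cbn [compE kE]. rewrite sem_list_app. set (m1 := sem_list (compE t e) m) in *.
    assert (Bt := B1 t). simpl.
    rewrite upd_same, !(upd_other _ _ _ t) by lia. repeat split.
    + apply safe_list_app; [eapply safe_list_mono; [|eassumption]; lia|].
      fold m1. simpl. rewrite upd_same, !(upd_other _ _ _ t) by lia.
      repeat split; try (inlist; lia); try lia.
    + rewrite upd_same. lia.
    + intros a H1 H2. rewrite !upd_other by auto. auto.
    + repeat apply bnd_upd; rewrite ?upd_same, ?(upd_other _ _ _ t) by lia; try lia.
      eapply bnd_mono; [|eassumption]; lia.
  - simpl in Hok. destruct (IH m Hs Hbd HU Hok) as (S1 & T1 & A1 & B1).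
    cbn [compE kE]. rewrite sem_list_app. set (m1 := sem_list (compE t e) m) in *.
    assert (Bt := B1 t). simpl.
    rewrite upd_same, !(upd_other _ _ _ t) by lia. repeat split.
    + apply safe_list_app; [eapply safe_list_mono; [|eassumption]; lia|].
      fold m1. simpl. rewrite upd_same, !(upd_other _ _ _ t) by lia.
      repeat split; try (inlist; lia); try lia.
    + rewrite upd_same. lia.
    + intros a H1 H2. rewrite !upd_other by auto. auto.
    + repeat apply bnd_upd; rewrite ?upd_same, ?(upd_other _ _ _ t) by lia; try lia.
      eapply bnd_mono; [|eassumption]; lia.
Qed.

Definition agree_all (m m' : mem) : Prop :=
  forall a, a <> rT1 -> a <> rT2 -> a <> rH -> m' a = m a.

Lemma sim_agree s m m' : sim s m -> agree_all m m' -> sim s m'.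
Proof.
  intros (A & B & C) H. repeat split.
  - intros x. assert (V := vreg_lt x). rewrite H by lia. auto.
  - intros j i Hv. assert (V := adr_ge _ _ Hv). rewrite H by lia. auto.
  - rewrite H by lia. auto.
Qed.

Lemma agree_off_all t m m' : t = rT1 \/ t = rT2 -> agree_off t m m' -> agree_all m m'.
Proof. intros Ht H a H1 H2 H3. apply H; auto. intros ->. destruct Ht; congruence. Qed.

Lemma comp2_ok e1 e2 s m U :
  sim s m -> bnd m U -> Amax <= U -> eok e1 s -> eok e2 s ->
  let l := compE rT1 e1 ++ compE rT2 e2 in
  safe_list (S Amax) (U + kE e1 + kE e2) l m /\
  let m' := sem_list l m in
  m' rT1 = ev e1 s /\ m' rT2 = ev e2 s /\ agree_all m m' /\ bnd m' (U + kE e1 + kE e2).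
Proof.
  intros Hs Hb HU O1 O2 l.
  destruct (compE_ok rT1 e1 (or_introl eq_refl) s m U Hs Hb HU O1) as (S1 & V1 & A1 & B1).
  set (m1 := sem_list (compE rT1 e1) m) in *.
  assert (Hs1 : sim s m1)
    by (eapply sim_agree; [eassumption | eapply agree_off_all; [|eassumption]; auto]).
  destruct (compE_ok rT2 e2 (or_intror eq_refl) s m1 (U + kE e1) Hs1 B1 ltac:(lia) O2)
    as (S2 & V2 & A2 & B2).
  unfold l. rewrite sem_list_app. fold m1. repeat split; auto.
  - apply safe_list_app; auto. eapply safe_list_mono; [|eassumption]; lia.
  - rewrite A2 by lia. auto.
  - intros a H1 H2 H3. rewrite A2, A1; auto.
Qed.

Lemma compB_ok b s m U :
  sim s m -> bnd m U -> Amax <= U -> bok b s ->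
  safe_list (S Amax) (U + kB b) (compB b) m /\
  let m' := sem_list (compB b) m in
  (m' rH =? 0) = negb (evb b s) /\ sim s m' /\ bnd m' (U + kB b).
Proof.
  intros Hs Hb HU Hok.
  assert (Hbig : KR < S Amax) by (unfold Amax; lia).
  destruct b as [e1 e2|e1 e2]; destruct Hok as [O1 O2];
    destruct (comp2_ok e1 e2 s m U Hs Hb HU O1 O2) as (S1 & V1 & V2 & A1 & B1);
    set (l := compE rT1 e1 ++ compE rT2 e2) in *;
    set (m1 := sem_list l m) in *.
  - assert (E : compB (Eq e1 e2) = l ++
      [ISub rH rT1 rT2; ISub rT2 rT2 rT1; IAdd rH rH rT2; IConst rT1 1; ISub rH rT1 rH])
      by (unfold l; simpl; rewrite <- app_assoc; reflexivity).
    rewrite E, sem_list_app. fold m1.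
    assert (Bt1 := B1 rT1). assert (Bt2 := B1 rT2). rewrite V1 in Bt1. rewrite V2 in Bt2.
    cbn [kB evb].
    split; [|split; [|split]].
    + apply safe_list_app; [eapply safe_list_mono; [|eassumption]; lia|]. fold m1.
      cbn [sem_list safe_list isem iwr iacc straight].
      repeat (rewrite ?upd_same, ?(upd_other _ _ _ rT1), ?(upd_other _ _ _ rT2),
          ?(upd_other _ _ _ rH) by lia).
      rewrite V1, V2. repeat split; try (inlist; lia); lia.
    + cbn [sem_list isem].
      repeat (rewrite ?upd_same, ?(upd_other _ _ _ rT1), ?(upd_other _ _ _ rT2),
          ?(upd_other _ _ _ rH) by lia).
      rewrite V1, V2.
      destruct (Nat.eqb_spec (ev e1 s) (ev e2 s)); cbn [negb];
        [apply Nat.eqb_neq | apply Nat.eqb_eq]; lia.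
    + eapply sim_agree; [exact Hs|]. intros a H1 H2 H3.
      cbn [sem_list isem]. rewrite !upd_other by auto. auto.
    + cbn [sem_list isem]. assert (bnd m1 (U + (kE e1 + kE e2 + 1)))
        by (eapply bnd_mono; [|eassumption]; lia).
      repeat (rewrite ?upd_same, ?(upd_other _ _ _ rT1), ?(upd_other _ _ _ rT2),
          ?(upd_other _ _ _ rH) by lia).
      rewrite V1, V2. repeat apply bnd_upd; auto; lia.
  - assert (E : compB (Lt e1 e2) = l ++ [ISub rH rT2 rT1])
      by (unfold l; simpl; rewrite <- app_assoc; reflexivity).
    rewrite E, sem_list_app. fold m1.
    assert (Bt1 := B1 rT1). assert (Bt2 := B1 rT2). rewrite V1 in Bt1. rewrite V2 in Bt2.
    cbn [kB evb].
    split; [|split; [|split]].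
    + apply safe_list_app; [eapply safe_list_mono; [|eassumption]; lia|]. fold m1.
      cbn [sem_list safe_list isem iwr iacc straight].
      rewrite V1, V2. repeat split; try (inlist; lia); lia.
    + cbn [sem_list isem]. rewrite upd_same, V1, V2.
      destruct (Nat.ltb_spec (ev e1 s) (ev e2 s)); cbn [negb];
        [apply Nat.eqb_neq | apply Nat.eqb_eq]; lia.
    + eapply sim_agree; [exact Hs|]. intros a H1 H2 H3.
      cbn [sem_list isem]. rewrite !upd_other by auto. auto.
    + cbn [sem_list isem]. assert (bnd m1 (U + (kE e1 + kE e2 + 1)))
        by (eapply bnd_mono; [|eassumption]; lia).
      rewrite V1, V2. repeat apply bnd_upd; auto; lia.
Qed.

Lemma sim_setv s m x a : sim s m -> sim (setv s x a) (upd m (vreg x) a).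
Proof.
  intros (A & B & C). assert (Vx := vreg_lt x). repeat split.
  - intros y. simpl. destruct (var_beq y x) eqn:E.
    + apply var_beq_true in E. subst. apply upd_same.
    + rewrite upd_other; auto. intros H. apply vreg_inj in H. subst.
      rewrite var_beq_refl in E. discriminate.
  - intros j i Hv. assert (V := adr_ge _ _ Hv). rewrite upd_other by lia. simpl. auto.
  - rewrite upd_other by lia. auto.
Qed.

Lemma sim_seta s m j i a : valid j i -> sim s m -> sim (seta s j i a) (upd m (adr j i) a).
Proof.
  intros Hv (A & B & C). assert (V := adr_ge _ _ Hv). repeat split.
  - intros y. assert (Vy := vreg_lt y). rewrite upd_other by lia. simpl. auto.
  - intros j' i' Hv'. simpl. destruct (arr_beq j' j) eqn:E.
    + apply arr_beq_true in E. subst j'. destruct (Nat.eq_dec i' i) as [->|Hn].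
      * now rewrite !upd_same.
      * rewrite !upd_other; auto. intros H. apply adr_inj in H; tauto.
    + rewrite upd_other; auto. intros H. apply adr_inj in H; auto. destruct H as [-> _].
      rewrite arr_beq_refl in E. discriminate.
  - rewrite upd_other by lia. auto.
Qed.

Lemma reach_jmp P U pc m t s : code_at P pc [IConst rH 0; IJz rH t] -> sim s m -> bnd m U ->
  exists m', reach P (S Amax) U 2 (pc, m) (t, m') /\ sim s m' /\ bnd m' U.
Proof.
  intros HC Hs Hb. apply code_at_cons in HC as [H1 HC]. apply code_at_cons in HC as [H2 _].
  assert (Hbig : KR < S Amax) by (unfold Amax; lia).
  exists (upd m rH 0). split; [|split].
  - change 2 with (1 + 1). eapply reach_trans with (c2 := (S pc, upd m rH 0)).
    + apply reach_one; simpl; rewrite H1; auto; [|simpl; lia]. simpl. intros a [<-|[]]; lia.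
    + assert (R := reach_jz P (S Amax) U (S pc) (upd m rH 0) rH t H2 ltac:(lia)).
      rewrite upd_same in R. exact R.
  - eapply sim_agree; eauto. intros a A1 A2 A3. apply upd_other; auto.
  - apply bnd_upd; auto; lia.
Qed.

(** The value bound rises by [kP] per tick, so the second half of a sequence starts from a larger
    bound than the first. For this reason [U] is quantified inside the induction, and [reach_mono]
    lifts the pieces to the final bound. *)
Theorem comp_correct P kP CC c s t s' : exec c s t s' ->
  kC c <= kP -> cC c <= CC ->
  forall pc m U, code_at P pc (comp pc c) -> sim s m -> bnd m U -> Amax <= U ->
  exists T m', reach P (S Amax) (U + kP * t) T (pc, m) (pc + csize c, m') /\
    T <= CC * t /\ sim s' m' /\ bnd m' (U + kP * t).
Proof.
  assert (Hbig : KR < S Amax) by (unfold Amax; lia).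
  induction 1 as [s|x e s Hok|j e1 e2 s O1 O2 Hv|c1 c2 s t1 s1 t2 s2 E1 IH1 E2 IH2
    |b c1 c2 s t s' Hok E1 IH1|b c s Hok Hf|b c s t1 s1 t2 s2 Hok Ht E1 IH1 E2 IH2];
    intros Hk Hc pc m U HC Hs Hb HU.
  - exists 0, m. simpl. rewrite Nat.add_0_r. split; [apply reach_refl|].
    split; [lia|]. split; auto. eapply bnd_mono; [|eassumption]; lia.
  - simpl in Hk, Hc.
    destruct (compE_ok rT1 e (or_introl eq_refl) s m U Hs Hb HU Hok) as (S1 & V1 & A1 & B1).
    simpl comp in HC.
    set (l := [IConst (vreg x) 0; IAdd (vreg x) rT1 (vreg x)]) in *.
    set (m1 := sem_list (compE rT1 e) m) in *.
    assert (Vx := vreg_lt x).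
    assert (Bt := B1 rT1). rewrite V1 in Bt.
    assert (SS : safe_list (S Amax) (U + kP * 1) (compE rT1 e ++ l) m).
    { apply safe_list_app; [eapply safe_list_mono; [|eassumption]; lia|]. fold m1.
      unfold l. cbn [sem_list safe_list isem iwr iacc straight].
      rewrite upd_same, upd_other, V1 by lia.
      repeat split; try (inlist; lia); lia. }
    assert (R := reach_straight _ _ _ _ _ _ HC SS).
    eexists _, _. split; [|split; [|split]].
    + replace (csize (Assign x e)) with (length (compE rT1 e ++ l))
        by (rewrite length_app; reflexivity). exact R.
    + rewrite length_app. simpl. lia.
    + rewrite sem_list_app. fold m1. unfold l. cbn [sem_list isem].
      rewrite upd_same, upd_other, V1 by lia.
      assert (S2 : sim s m1) by (eapply sim_agree; [eassumption|
        eapply agree_off_all; [|eassumption]; auto]).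
      assert (S3 := sim_setv _ _ x (ev e s) S2).
      (* The register is zeroed and then written, since a move is an addition to zero; the second
         update hides the first. *)
      destruct S3 as (a1 & a2 & a3). rewrite Nat.add_0_r. repeat split; intros.
      * rewrite <- a1. unfold upd. destruct (_ =? _); auto.
      * rewrite <- a2 by auto. unfold upd. destruct (_ =? _); auto.
      * rewrite <- a3. unfold upd. destruct (_ =? _); auto.
    + rewrite sem_list_app. fold m1. unfold l. cbn [sem_list isem].
      rewrite upd_same, upd_other, V1 by lia.
      repeat apply bnd_upd; try lia. eapply bnd_mono; [|eassumption]; lia.
  - simpl in Hk, Hc.
    destruct (comp2_ok e1 e2 s m U Hs Hb HU O1 O2) as (S1 & V1 & V2 & A1 & B1).
    simpl comp in HC. rewrite app_assoc in HC.
    set (l := compE rT1 e1 ++ compE rT2 e2) in *.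
    set (m1 := sem_list l m) in *.
    assert (Bt := B1 rT2). rewrite V2 in Bt.
    assert (Hadr := adr_lt _ _ Hv). assert (Hge := adr_ge _ _ Hv).
    assert (Hbase : m1 rBase = B0) by (rewrite A1 by lia; apply Hs).
    destruct (compA_ok rT1 j _ m1 _ (or_introl eq_refl) V1 Hbase Hv B1 ltac:(lia))
      as (S2 & W1 & A2 & B2).
    assert (W2 : sem_list (compA rT1 j) m1 rT2 = ev e2 s) by (rewrite A2 by lia; auto).
    set (m2 := sem_list (compA rT1 j) m1) in *.
    assert (SS : safe_list (S Amax) (U + kP * 1) (l ++ compA rT1 j ++ [IStore rT1 rT2]) m).
    { apply safe_list_app; [eapply safe_list_mono; [|eassumption]; lia|]. fold m1.
      apply safe_list_app; [eapply safe_list_mono; [|eassumption]; lia|]. fold m2.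
      simpl. rewrite W1, W2. repeat split; try (inlist; lia); lia. }
    assert (R := reach_straight _ _ _ _ _ _ HC SS).
    eexists _, _. split; [|split; [|split]].
    + replace (csize (Store j e1 e2)) with (length (l ++ compA rT1 j ++ [IStore rT1 rT2]))
        by (unfold l; rewrite !length_app; simpl; lia). exact R.
    + unfold l. rewrite !length_app. simpl. lia.
    + rewrite !sem_list_app. fold m1 m2. simpl. rewrite W1, W2.
      apply sim_seta; auto.
      eapply sim_agree; [|eapply agree_off_all; [|exact A2]; auto]. eapply sim_agree; eassumption.
    + rewrite !sem_list_app. fold m1 m2. simpl. rewrite W1, W2.
      apply bnd_upd; [|lia]. eapply bnd_mono; [|eassumption]; lia.
  - simpl in Hk, Hc, HC. apply code_at_app in HC as [C1 C2]. rewrite comp_length in C2.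
    destruct (IH1 ltac:(lia) ltac:(lia) pc m U C1 Hs Hb HU) as (T1 & m1 & R1 & L1 & S1 & B1).
    destruct (IH2 ltac:(lia) ltac:(lia) _ m1 _ C2 S1 B1 ltac:(lia))
      as (T2 & m2 & R2 & L2 & S2 & B2).
    exists (T1 + T2), m2. simpl csize. rewrite Nat.add_assoc.
    replace (U + kP * (t1 + t2)) with (U + kP * t1 + kP * t2) by lia.
    split; [|repeat split; auto; try apply S2; lia].
    eapply reach_trans; [|exact R2]. eapply reach_mono; [| |exact R1]; lia.
  - simpl in Hk, Hc. cbn [comp] in HC.
    apply code_at_app in HC as [CB HC].
    apply code_at_app in HC as [CJ HC]. apply code_at_app in HC as [C1 HC].
    apply code_at_app in HC as [CK C2]. rewrite comp_length in CK, C2.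
    destruct (compB_ok b s m U Hs Hb HU Hok) as (SB & VB & SB' & BB).
    assert (RB := reach_straight _ _ _ _ _ _ CB SB).
    set (m1 := sem_list (compB b) m) in *. set (lb := length (compB b)) in *.
    simpl length in CK, C2, C1.
    apply code_at_cons in CJ as [CJ _].
    assert (RJ := reach_jz P (S Amax) (U + kB b) _ m1 rH _ CJ ltac:(lia)).
    rewrite VB in RJ.
    destruct (evb b s); simpl negb in RJ; cbv iota in RJ.
    + destruct (IH1 ltac:(lia) ltac:(lia) (pc + lb + 1) m1 _ C1 SB' BB ltac:(lia))
        as (T1 & m2 & R1 & L1 & S1 & B1).
      destruct (reach_jmp _ _ _ _ _ _ CK S1 B1) as (m3 & R3 & S3 & B3).
      exists (lb + (1 + (T1 + 2))), m3. split; [|split; [|split]]; auto.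
      * eapply reach_trans; [eapply reach_mono; [| |exact RB]; lia|].
        eapply reach_trans; [eapply reach_mono; [| |exact RJ]; lia|].
        replace (S (pc + lb)) with (pc + lb + 1) by lia.
        eapply reach_trans; [eapply reach_mono; [| |exact R1]; lia|].
        cbn [csize]. fold lb.
        replace (pc + (lb + 1 + csize c1 + 2 + csize c2)) with
          (pc + lb + 1 + csize c1 + 2 + csize c2) by lia.
        eapply reach_mono; [| |exact R3]; lia.
      * assert (lb + 3 <= CC) by lia. nia.
      * eapply bnd_mono; [|exact B3]. lia.
    + replace (pc + lb + 1 + csize c1 + 2) with (pc + lb + 1 + csize c1 + 2) in C2 by lia.
      destruct (IH1 ltac:(lia) ltac:(lia) (pc + lb + 1 + csize c1 + 2) m1 _ C2 SB' BB ltac:(lia))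
        as (T1 & m2 & R1 & L1 & S1 & B1).
      exists (lb + (1 + T1)), m2. split; [|split; [|split]]; auto.
      * eapply reach_trans; [eapply reach_mono; [| |exact RB]; lia|].
        eapply reach_trans; [eapply reach_mono; [| |exact RJ]; lia|].
        cbn [csize]. fold lb.
        replace (pc + (lb + 1 + csize c1 + 2 + csize c2)) with
          (pc + lb + 1 + csize c1 + 2 + csize c2) by lia.
        eapply reach_mono; [| |exact R1]; lia.
      * assert (lb + 3 <= CC) by lia. nia.
      * eapply bnd_mono; [|exact B1]. lia.
  - simpl in Hk, Hc. cbn [comp] in HC.
    apply code_at_app in HC as [CB HC].
    apply code_at_app in HC as [CJ HC].
    destruct (compB_ok b s m U Hs Hb HU Hok) as (SB & VB & SB' & BB).
    assert (RB := reach_straight _ _ _ _ _ _ CB SB).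
    set (m1 := sem_list (compB b) m) in *. set (lb := length (compB b)) in *.
    apply code_at_cons in CJ as [CJ _].
    assert (RJ := reach_jz P (S Amax) (U + kB b) _ m1 rH _ CJ ltac:(lia)).
    rewrite VB, Hf in RJ. simpl negb in RJ; cbv iota in RJ.
    exists (lb + 1), m1. split; [|split; [|split]]; auto; try lia.
    + eapply reach_trans; [eapply reach_mono; [| |exact RB]; lia|].
      cbn [csize]. fold lb.
      replace (pc + (lb + 1 + csize c + 2)) with (pc + lb + 1 + csize c + 2) by lia.
      eapply reach_mono; [| |exact RJ]; lia.
    + eapply bnd_mono; [|exact BB]. lia.
  - assert (HC0 := HC). simpl in Hk, Hc. cbn [comp] in HC.
    apply code_at_app in HC as [CB HC].
    apply code_at_app in HC as [CJ HC]. apply code_at_app in HC as [C1 CK].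
    rewrite comp_length in CK.
    destruct (compB_ok b s m U Hs Hb HU Hok) as (SB & VB & SB' & BB).
    assert (RB := reach_straight _ _ _ _ _ _ CB SB).
    set (m1 := sem_list (compB b) m) in *. set (lb := length (compB b)) in *.
    simpl length in CK, C1.
    apply code_at_cons in CJ as [CJ _].
    assert (RJ := reach_jz P (S Amax) (U + kB b) _ m1 rH _ CJ ltac:(lia)).
    rewrite VB, Ht in RJ. simpl negb in RJ; cbv iota in RJ.
    destruct (IH1 ltac:(lia) ltac:(lia) (pc + lb + 1) m1 _ C1 SB' BB ltac:(lia))
      as (T1 & m2 & R1 & L1 & S1 & B1).
    destruct (reach_jmp _ _ _ _ _ _ CK S1 B1) as (m3 & R3 & S3 & B3).
    destruct (IH2 ltac:(simpl; lia) ltac:(simpl; lia) pc m3 _ HC0 S3 B3 ltac:(lia))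
      as (T2 & m4 & R4 & L4 & S4 & B4).
    assert (kP * S (t1 + t2) = kP + kP * t1 + kP * t2) by lia.
    exists (lb + (1 + (T1 + (2 + T2)))), m4. split; [|split; [|split]]; auto.
    + eapply reach_trans; [eapply reach_mono; [| |exact RB]; lia|].
      eapply reach_trans; [eapply reach_mono; [| |exact RJ]; lia|].
      replace (S (pc + lb)) with (pc + lb + 1) by lia.
      eapply reach_trans; [eapply reach_mono; [| |exact R1]; lia|].
      eapply reach_trans; [eapply reach_mono; [| |exact R3]; lia|].
      eapply reach_mono; [| |exact R4]; lia.
    + assert (lb + 3 <= CC) by lia. nia.
    + eapply bnd_mono; [|exact B4]. lia.
Qed.

End Semantics.

(** * Moving the input out of the registers and the output back *)

Definition save_regs (k : nat) : list instr :=
  flat_map (fun r => [IAdd 2 2 3; IStore 2 r]) (seq 4 k).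

Definition load_regs (k : nat) : list instr :=
  flat_map (fun r => [IConst r (NA * r); IAdd r r 0; ILoad r r]) (seq 1 k).

(* The input occupies the low registers.  With [P = n + 4m], a cell past the input,
   the words in R[2..26] are moved to the array [aIN] based at [P + KR]; R[2] is
   parked in the cell [P] while R[2..4] serve as scratch. *)
Definition pro1 : list instr :=
  [IAdd 0 0 1; IAdd 0 0 1; IAdd 0 0 1; IAdd 0 0 1; IStore 0 2;
   IConst 2 (KR + 3 * NA); IAdd 2 0 2; IStore 2 3; IConst 3 NA].
Definition pro2 : list instr :=
  [ILoad 4 0; IConst 3 (KR + 2 * NA); IAdd 3 0 3; IStore 3 4;
   IConst rBase KR; IAdd rBase 0 rBase; IConst 2 0; IAdd 2 0 2;
   ISub 0 0 1; ISub 0 0 1; ISub 0 0 1; ISub 0 0 1].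
Definition prologue : list instr := pro1 ++ save_regs 23 ++ pro2.
(** Register 0 holds the address of the output array while registers 1 to 26 are loaded from it,
    each serving as its own address scratch; [rBase] may be overwritten because it has been added to
    register 0 before. Register 0 is loaded last. *)
Definition epilogue : list instr :=
  [IConst 0 (aidx aCOL); IAdd 0 0 rBase] ++ load_regs 26 ++ [ILoad 0 0].

(** An input without edges halts at once. There is nothing to label, and [n + 4m] would be too small
    an address to park a word at. *)
Definition ram (c : cmd) : program :=
  let pc := S (length prologue) in
  [IJz 1 (pc + csize c + length epilogue)] ++ prologue ++ comp pc c ++ epilogue.

Lemma ram_start c : nth_error (ram c) 0 = Some (IJz 1 (length (ram c))).
Proof.
  unfold ram. cbn [app nth_error length]. do 2 f_equal.
  rewrite !length_app, comp_length. lia.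
Qed.

Lemma save_regs_ok b L U k m : KR <= b -> k <= 23 -> m 3 = NA -> m 2 = b + NA * 3 ->
  bnd m U -> b + NA * 27 <= U -> U < L ->
  let m' := sem_list (save_regs k) m in
  safe_list L U (save_regs k) m /\ bnd m' U /\ m' 2 = b + NA * (3 + k) /\
  (forall r, 4 <= r < 4 + k -> m' (b + NA * r) = m r) /\
  (forall a, a <> 2 -> (forall r, 4 <= r < 4 + k -> a <> b + NA * r) -> m' a = m a).
Proof.
  intros Hb Hk H3 H2 HB HU HL. induction k as [|k IH].
  - simpl. repeat split; auto; try lia.
  - destruct (IH ltac:(lia)) as (S1 & B1 & P1 & V1 & F1). clear IH.
    unfold save_regs. rewrite seq_S, flat_map_app, sem_list_app.
    fold (save_regs k). set (m1 := sem_list (save_regs k) m) in *.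
    assert (H31 : m1 3 = NA) by (rewrite F1; auto; lia).
    assert (Hr : m1 (4 + k) = m (4 + k)) by (apply F1; lia).
    assert (Bk := HB (4 + k)).
    cbn [flat_map app sem_list isem]. rewrite upd_same, P1, H31.
    rewrite (upd_other _ _ _ (4 + k)) by lia. rewrite Hr.
    replace (b + NA * (3 + k) + NA) with (b + NA * (4 + k)) by lia.
    split; [|split; [|split; [|split]]].
    + apply safe_list_app; auto. fold m1.
      cbn [safe_list straight iacc iwr isem]. rewrite upd_same, P1, H31.
      rewrite (upd_other _ _ _ (4 + k)) by lia. rewrite Hr.
      repeat split; try lia; simpl; intros a; intuition lia.
    + repeat apply bnd_upd; auto; lia.
    + rewrite upd_other, upd_same by lia. lia.
    + intros r Hr'. destruct (Nat.eq_dec r (4 + k)) as [->|Hn].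
      * rewrite upd_same. reflexivity.
      * rewrite !upd_other by lia. apply V1. lia.
    + intros a Ha1 Ha2. rewrite !upd_other; auto; [|apply Ha2; lia].
      apply F1; auto. intros r Hr'. apply Ha2. lia.
Qed.

Lemma load_regs_ok L U k m : KR <= m 0 -> k <= 26 ->
  bnd m U -> m 0 + NA * 27 <= U -> m 0 + NA * 27 < L ->
  let m' := sem_list (load_regs k) m in
  safe_list L U (load_regs k) m /\
  (forall r, 1 <= r < 1 + k -> m' r = m (m 0 + NA * r)) /\
  (forall a, (forall r, 1 <= r < 1 + k -> a <> r) -> m' a = m a).
Proof.
  intros Hb Hk HB HU HL. induction k as [|k IH].
  - simpl. repeat split; auto; try lia.
  - destruct (IH ltac:(lia)) as (S1 & V1 & F1). clear IH.
    unfold load_regs. rewrite seq_S, flat_map_app, sem_list_app.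
    fold (load_regs k). set (m1 := sem_list (load_regs k) m) in *.
    assert (H0 : m1 0 = m 0) by (apply F1; lia).
    assert (Hr : m1 (m 0 + NA * (1 + k)) = m (m 0 + NA * (1 + k))) by (apply F1; lia).
    assert (Bk := HB (m 0 + NA * (1 + k))).
    cbn [flat_map app sem_list isem].
    rewrite ?upd_same, (upd_other _ _ _ 0), H0 by lia.
    replace (NA * (1 + k) + m 0) with (m 0 + NA * (1 + k)) by lia.
    rewrite (upd_other _ _ _ (m 0 + NA * (1 + k))) by lia.
    rewrite (upd_other _ _ _ (m 0 + NA * (1 + k))) by lia. rewrite Hr.
    split; [|split].
    + apply safe_list_app; auto. fold m1.
      cbn [safe_list straight iacc iwr isem].
      rewrite ?upd_same, (upd_other _ _ _ 0), H0 by lia.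
      replace (NA * (1 + k) + m 0) with (m 0 + NA * (1 + k)) by lia.
      rewrite (upd_other _ _ _ (m 0 + NA * (1 + k))) by lia.
      rewrite (upd_other _ _ _ (m 0 + NA * (1 + k))) by lia. rewrite Hr.
      repeat split; try lia; cbn [In]; intros a; intuition lia.
    + intros r Hr'. destruct (Nat.eq_dec r (1 + k)) as [->|Hn].
      * rewrite upd_same. reflexivity.
      * rewrite !upd_other by lia. apply V1. lia.
    + intros a Ha. rewrite !upd_other by (apply Ha; lia).
      apply F1. intros r Hr'. apply Ha. lia.
Qed.

(** The prologue has static length, so it moves only the words that sit in registers; the remaining
    input is still in raw memory. *)
Definition init_ok (n : nat) (es : list Edge) (W : nat -> bool) (s : st) : Prop :=
  let m := length es in
  let P := n + 4 * m in
  sv s vN = n /\ sv s vM = m /\ sv s vP = P /\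
  (forall a, 2 <= a < KR -> a < P -> sa s aIN a = encode n es W a) /\
  (forall a, KR <= a < P -> sa s aLOW a = encode n es W a) /\
  (forall j i, j <> aIN -> j <> aLOW -> sa s j i = 0).

(** The effect of the prologue is computed only up to pointwise equality of memories, which
    semantics and safety respect. *)
Lemma sem_list_ext l x y : (forall a, x a = y a) -> forall a, sem_list l x a = sem_list l y a.
Proof.
  revert x y; induction l as [|i l IH]; intros x y Hxy a; simpl; auto. apply IH. intros a'.
  destruct i; simpl; unfold upd; rewrite ?Hxy; auto.
Qed.

Lemma safe_list_ext L U l x y :
  (forall a, x a = y a) -> safe_list L U l y -> safe_list L U l x.
Proof.
  revert x y; induction l as [|i l IH]; intros x y Hxy Hs; simpl in *; auto.
  destruct Hs as (A1 & A2 & A3 & A4). repeat split; auto.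
  - intros a Ha. apply A2. destruct i; simpl in *; rewrite ?Hxy in Ha; auto.
  - destruct i; simpl in *; rewrite ?Hxy; auto.
  - eapply IH; [|exact A4]. intros a. destruct i; simpl; unfold upd; rewrite ?Hxy; auto.
Qed.

Lemma pro2_ok L U m P x mm n : m 0 = P -> m 1 = mm -> m P = x -> 5 <= P ->
  P = n + 4 * mm -> x <= U -> P + 500 <= U -> U < L ->
  (forall a, sem_list pro2 m a =
    upd (upd (upd (upd (upd (upd m 4 x) 3 (P + KR + 2 * NA)) (P + KR + 2 * NA) x)
      rBase (P + KR)) 2 P) 0 n a) /\
  safe_list L U pro2 m.
Proof.
  intros H0 H1 HP HP5 Hn Hx HU HL. unfold pro2.
  set (m1 := upd m 4 x).
  assert (A0 : m1 0 = P) by (unfold m1; rewrite upd_other; lia).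
  assert (A1 : m1 1 = mm) by (unfold m1; rewrite upd_other; lia).
  assert (A4 : m1 4 = x) by apply upd_same.
  set (m2 := upd (upd m1 3 (KR + 2 * NA)) 3 (P + (KR + 2 * NA))).
  assert (B0 : m2 0 = P) by (unfold m2; rewrite !upd_other; lia).
  assert (B1 : m2 1 = mm) by (unfold m2; rewrite !upd_other; lia).
  assert (B4 : m2 4 = x) by (unfold m2; rewrite !upd_other; lia).
  assert (B3 : m2 3 = P + (KR + 2 * NA)) by apply upd_same.
  set (m3 := upd m2 (P + (KR + 2 * NA)) x).
  assert (C0 : m3 0 = P) by (unfold m3; rewrite upd_other; lia).
  assert (C1 : m3 1 = mm) by (unfold m3; rewrite upd_other; lia).
  set (m4 := upd (upd m3 rBase KR) rBase (P + KR)).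
  assert (D0 : m4 0 = P) by (unfold m4; rewrite !upd_other; lia).
  assert (D1 : m4 1 = mm) by (unfold m4; rewrite !upd_other; lia).
  set (m5 := upd (upd m4 2 0) 2 P).
  assert (E0 : m5 0 = P) by (unfold m5; rewrite !upd_other; lia).
  assert (E1 : m5 1 = mm) by (unfold m5; rewrite !upd_other; lia).
  set (m6 := upd m5 0 (P - mm)).
  set (m7 := upd m6 0 (P - mm - mm)).
  set (m8 := upd m7 0 (P - mm - mm - mm)).
  assert (F1 : m6 1 = mm) by (unfold m6; rewrite upd_other; lia).
  assert (G1 : m7 1 = mm) by (unfold m7; rewrite upd_other; lia).
  assert (I1 : m8 1 = mm) by (unfold m8; rewrite upd_other; lia).
  assert (F0 : m6 0 = P - mm) by apply upd_same.
  assert (G0 : m7 0 = P - mm - mm) by apply upd_same.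
  assert (I0 : m8 0 = P - mm - mm - mm) by apply upd_same.
  cbn [sem_list safe_list isem iwr iacc straight].
  rewrite H0, HP. fold m1.
  rewrite (upd_other m1 3 _ 0), upd_same, A0 by lia. fold m2.
  rewrite B3, B4. fold m3.
  rewrite (upd_other m3 rBase _ 0), upd_same, C0 by lia. fold m4.
  rewrite (upd_other m4 2 _ 0), upd_same, D0 by lia.
  rewrite (Nat.add_0_r P). fold m5.
  rewrite E0, E1. fold m6. rewrite F0, F1. fold m7. rewrite G0, G1. fold m8. rewrite I0, I1.
  replace (P - mm - mm - mm - mm) with n by lia.
  replace (P + (KR + 2 * NA)) with (P + KR + 2 * NA) by lia.
  split.
  - intros a. unfold m8, m7, m6, m5, m4, m3, m2, m1, upd.
    replace (P + (KR + 2 * NA)) with (P + KR + 2 * NA) by lia.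
    repeat match goal with |- context [?y =? ?z] =>
      destruct (Nat.eqb_spec y z); try reflexivity; try lia end.
  - repeat split; try lia; cbn [In]; intros a; intuition lia.
Qed.

Section Prologue.

Context (n : nat) (es : list Edge) (W : nat -> bool).
Let m := length es.
(** For m at least 1 the input ends at 2 + 2m + n, which is at most [P0]; as n is at least 2, [P0]
    also lies beyond the registers 0 to 4 used as scratch. *)
Let P0 := n + 4 * m.
Let IB := P0 + KR.
Let B0 := P0 + KR.

Context (Hn : 2 <= n) (Hm : 1 <= m) (Henc : forall a, encode n es W a <= n + m + 1).

Lemma encode_zero a : 2 + 2 * m + n <= a -> encode n es W a = 0.
Proof.
  intros Ha. unfold encode. fold m.
  destruct (Nat.eqb_spec a 0); [lia|]. destruct (Nat.eqb_spec a 1); [lia|].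
  destruct (Nat.ltb_spec a (2 + 2 * m)); [lia|].
  destruct (Nat.ltb_spec a (2 + 2 * m + n)); [lia|]. reflexivity.
Qed.

Lemma prologue_ok :
  let m0 := encode n es W in
  let U := Amax IB B0 in
  let m1 := sem_list prologue m0 in
  safe_list (S U) U prologue m0 /\ bnd m1 U /\
  m1 0 = n /\ m1 1 = m /\ m1 2 = P0 /\ m1 rBase = B0 /\
  (forall a, 2 <= a < KR -> a < P0 -> m1 (B0 + NA * a) = m0 a) /\
  (forall a, KR <= a < P0 -> m1 a = m0 a) /\
  (forall a, B0 <= a -> (forall r, a <> B0 + NA * r) -> m1 a = 0).
Proof.
  intros m0 U m1.
  assert (HB : bnd m0 (n + m + 1)) by exact Henc.
  assert (E0 : m0 0 = n) by reflexivity. assert (E1 : m0 1 = m) by reflexivity.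
  assert (HU : U = B0 + NA * (IB + 1)) by reflexivity.
  assert (HP : 6 <= P0) by (unfold P0; lia).
  set (b := upd (upd (upd (upd (upd m0 0 P0) P0 (m0 2)) 2 (B0 + 3 * NA)) (B0 + 3 * NA) (m0 3)) 3 NA).
  assert (X1 : (forall a, sem_list pro1 m0 a = b a) /\ safe_list (S U) U pro1 m0).
  { unfold pro1. cbn [sem_list safe_list isem iwr iacc straight].
    repeat (rewrite ?upd_same, ?(upd_other _ 0 _ 1), ?(upd_other _ P0 _ 0), ?(upd_other _ 2 _ 0),
       ?(upd_other _ 0 _ 2) by lia).
    rewrite E0, E1. replace (n + m + m + m + m) with P0 by (unfold P0; lia).
    repeat (rewrite ?upd_same, ?(upd_other _ 0 _ 1), ?(upd_other _ P0 _ 0), ?(upd_other _ 2 _ 0),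
       ?(upd_other _ 0 _ 2) by lia).
    replace (P0 + (KR + 3 * NA)) with (B0 + 3 * NA) by (unfold B0; lia).
    assert (T := HB 2). assert (T' := HB 3).
    split.
    - intros a. unfold b, upd.
      repeat match goal with |- context [?y =? ?z] => destruct (Nat.eqb_spec y z); try reflexivity; try lia end.
    - rewrite (upd_other _ 2 _ 3), (upd_other _ 2 _ 3), (upd_other _ P0 _ 3),
        !(upd_other _ 0 _ 3) by lia.
      repeat split; try (unfold U, Amax, IB, B0, P0 in *; lia);
      cbn [In]; intros a; intuition (unfold U, Amax, IB, B0, P0 in *; lia). }
  destruct X1 as [X1 Y1].
  assert (Hbb : bnd b U).
  { assert (T := HB 2). assert (T' := HB 3). unfold b.
    do 5 (apply bnd_upd; [|unfold U, Amax, IB, B0, P0 in *; lia]).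
    eapply bnd_mono; [|exact HB]. unfold U, Amax, IB, B0, P0 in *; lia. }
  assert (b3 : b 3 = NA) by (unfold b; apply upd_same).
  assert (b2 : b 2 = B0 + NA * 3) by (unfold b; rewrite !upd_other, upd_same by lia; lia).
  destruct (save_regs_ok B0 (S U) U 23 b ltac:(unfold B0; lia) ltac:(lia) b3 b2 Hbb
    ltac:(unfold U, Amax, IB, B0, P0 in *; lia) ltac:(lia)) as (S2 & B2 & V2 & R2 & F2).
  set (m2 := sem_list (save_regs 23) b) in *.
  assert (c0 : m2 0 = P0).
  { rewrite F2 by lia. unfold b. rewrite !upd_other, upd_same by lia. reflexivity. }
  assert (c1 : m2 1 = m).
  { rewrite F2 by lia. unfold b. rewrite !upd_other by lia. exact E1. }
  assert (cP : P0 <> 2) by lia.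
  assert (T2 := HB 2).
  assert (cP' : m2 P0 = m0 2).
  { rewrite F2 by (unfold B0; lia). unfold b. rewrite !upd_other, upd_same by (unfold B0; lia).
    reflexivity. }
  set (d := upd (upd (upd (upd (upd (upd m2 4 (m0 2)) 3 (B0 + 2 * NA)) (B0 + 2 * NA) (m0 2)) rBase B0)
              2 P0) 0 n).
  destruct (pro2_ok (S U) U m2 P0 (m0 2) m n c0 c1 cP' ltac:(lia)
    ltac:(unfold P0; lia) ltac:(lia) ltac:(unfold U, Amax, IB, B0, P0 in *; lia)
    ltac:(unfold U, Amax, IB, B0, P0 in *; lia)) as [X3 Y3].
  change (P0 + KR) with B0 in X3. fold d in X3.
  assert (Em : forall a, m1 a = d a).
  { intros a. unfold m1, prologue. rewrite !sem_list_app. rewrite <- X3.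
    apply sem_list_ext. apply sem_list_ext. exact X1. }
  assert (hB : 27 + 6 <= B0) by (unfold B0; lia).
  split; [|split; [|split; [|split; [|split; [|split; [|split; [|split]]]]]]].
  - unfold prologue. apply safe_list_app; auto. eapply safe_list_ext; [exact X1|].
    apply safe_list_app; auto.
  - intros a. rewrite Em. assert (T := HB 2). revert a. change (bnd d U).
    assert (F1 : B0 + 900 <= U) by (unfold U, Amax, IB, B0, P0 in *; lia).
    assert (F3 : n + m + 1 <= U /\ P0 <= U) by (unfold U, Amax, IB, B0, P0 in *; lia).
    clearbody B0 P0 U. unfold d. do 6 (apply bnd_upd; [|lia]). exact B2.
  - rewrite Em. reflexivity.
  - rewrite Em. unfold d. rewrite !upd_other by lia. exact c1.
  - rewrite Em. unfold d. rewrite upd_other, upd_same by lia. reflexivity.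
  - rewrite Em. unfold d. rewrite !upd_other, upd_same by lia. reflexivity.
  - intros a Ha HaP. rewrite Em. unfold d.
    rewrite (upd_other _ 0), (upd_other _ 2), (upd_other _ rBase) by lia.
    destruct (Nat.eq_dec a 2) as [->|].
    { replace (B0 + NA * 2) with (B0 + 2 * NA) by lia. apply upd_same. }
    rewrite !upd_other by lia.
    destruct (Nat.eq_dec a 3) as [->|].
    { rewrite F2 by lia. unfold b. rewrite upd_other by lia.
      replace (B0 + NA * 3) with (B0 + 3 * NA) by lia. apply upd_same. }
    rewrite R2 by lia. unfold b. rewrite !upd_other by lia. reflexivity.
  - intros a Ha. rewrite Em. unfold d. rewrite !upd_other by (unfold B0; lia).
    rewrite F2 by (unfold B0; lia). unfold b. rewrite !upd_other by (unfold B0; lia). reflexivity.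
  - intros a Ha Hr. rewrite Em. unfold d.
    assert (a <> B0 + 2 * NA) by (intros ->; apply (Hr 2); lia).
    assert (a <> B0 + 3 * NA) by (intros ->; apply (Hr 3); lia).
    rewrite !upd_other by lia. rewrite F2; [|lia|intros; apply Hr].
    unfold b. rewrite !upd_other by (unfold B0 in *; lia).
    apply encode_zero. unfold B0, P0 in *; lia.
Qed.

(** The first [KR] output cells are registers in use as long as [c] runs, so they are filled from
    [aCOL] by the epilogue; the other output cells [c] has to write itself, through [aLOW]. *)
Theorem ram_correct c (Q : nat -> st -> Prop) :
  (forall s, init_ok n es W s -> wp IB B0 c Q s) ->
  exists T t s' m', Q t s' /\
    reach (ram c) (S (Amax IB B0)) (Amax IB B0 + kC c * t) T (0, encode n es W)
      (length (ram c), m') /\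
    T <= length prologue + length epilogue + 1 + cC c * t /\
    (forall i, i < KR -> m' i = sa s' aCOL i) /\
    (forall i, KR <= i < B0 -> m' i = sa s' aLOW i).
Proof.
  intros HQ.
  set (m0 := encode n es W). set (U := Amax IB B0). set (Lp := length prologue).
  assert (HU : U = B0 + NA * (IB + 1)) by reflexivity.
  assert (HIB : IB = B0) by reflexivity. assert (hB : 33 <= B0) by (unfold B0, P0; lia).
  destruct prologue_ok as (S1 & B1 & v0 & v1 & v2 & vb & vin & vlow & vz).
  fold m0 U in S1, B1, vin, vlow, v0, v1, v2, vb, vz. set (m1 := sem_list prologue m0) in *.
  set (s1 := mkst (fun x => m1 (vreg x))
    (fun j i => match j with aLOW => m1 i | aIN => m1 (adr B0 aIN i)
       | _ => if i <=? IB then m1 (adr B0 j i) else 0 end)).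
  assert (HI : init_ok n es W s1).
  { split; [exact v0|]. split; [exact v1|]. split; [exact v2|].
    split; [|split].
    - intros a H1 H2. cbn [sa s1 adr]. replace (B0 + NA * a + aidx aIN) with (B0 + NA * a)
        by (cbn [aidx]; lia). apply vin; auto.
    - intros a Ha. cbn [sa s1]. apply vlow. auto.
    - intros j i H1 H2.
      assert (Hz : m1 (adr B0 j i) = 0).
      { assert (E : adr B0 j i = B0 + NA * i + aidx j) by (destruct j; try reflexivity; congruence).
        assert (G := aidx_lt j). assert (0 < aidx j) by (destruct j; simpl; try lia; congruence).
        rewrite E. apply vz; lia. }
      unfold s1; destruct j; try congruence; cbn [sa]; rewrite Hz; destruct (i <=? IB); reflexivity. }
  destruct (HQ s1 HI) as (t & s' & Ex & HQ').
  assert (Hs1 : sim IB B0 s1 m1).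
  { split; [|split]; [intros; reflexivity| |exact vb].
    intros j i Hv. destruct j; cbn [sa s1 valid adr] in *; try reflexivity;
      destruct (Nat.leb_spec i IB); try reflexivity; lia. }
  assert (HC : code_at (ram c) 0 (ram c)) by (intros i x Hx; exact Hx).
  assert (HC0 := HC). unfold ram in HC at 2. apply code_at_app in HC as [CJ HC].
  apply code_at_app in HC as [CP HC]. apply code_at_app in HC as [CC CE].
  rewrite comp_length in CE. fold Lp in CC, CE. simpl length in CP, CC, CE.
  apply code_at_cons in CJ as [CJ _].
  assert (R0 := reach_jz _ (S U) (U + kC c * t) _ m0 _ _ CJ ltac:(lia)).
  assert (E1 : m0 1 = m) by reflexivity.
  rewrite E1 in R0. destruct (Nat.eqb_spec m 0); [lia|].
  assert (RP := reach_straight _ _ _ _ _ _ CP S1). fold Lp m1 in RP.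
  destruct (comp_correct IB B0 ltac:(lia) (ram c) (kC c) (cC c) c s1 t s' Ex ltac:(lia) ltac:(lia)
    (0 + 1 + Lp) m1 U CC Hs1 B1 (le_n _)) as (T1 & m2 & R1 & L1 & S2 & B2).
  set (U2 := U + kC c * t) in *.
  destruct S2 as (A2 & V2 & b2).
  set (m3 := sem_list [IConst 0 (aidx aCOL); IAdd 0 0 rBase] m2).
  (* 17 is [aidx aCOL]: register 0 points to cell 0 of the colour array. *)
  assert (H0 : m3 0 = B0 + 17).
  { unfold m3. cbn [sem_list isem aidx]. rewrite !upd_same, upd_other by lia.
    rewrite b2. lia. }
  assert (Hoth : forall a, a <> 0 -> m3 a = m2 a).
  { intros a Ha. unfold m3. cbn [sem_list isem]. rewrite !upd_other by auto. reflexivity. }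
  assert (HU2 : U <= U2) by (unfold U2; lia).
  assert (B3 : bnd m3 U2).
  { intros a. destruct (Nat.eq_dec a 0) as [->|]; [lia|]. rewrite Hoth by auto. apply B2. }
  assert (S3 : safe_list (S U) U2 [IConst 0 (aidx aCOL); IAdd 0 0 rBase] m2).
  { cbn [safe_list straight iacc iwr isem In aidx]. rewrite upd_same, upd_other, b2 by lia.
    repeat split; try lia; intros a; intuition lia. }
  destruct (load_regs_ok (S U) U2 26 m3 ltac:(lia) ltac:(lia) B3 ltac:(lia) ltac:(lia))
    as (S4 & V4 & F4).
  set (m4 := sem_list (load_regs 26) m3) in *.
  assert (H04 : m4 0 = B0 + 17) by (rewrite F4 by lia; exact H0).
  assert (H17 : m4 (B0 + 17) = m2 (B0 + 17)) by (rewrite F4, Hoth by lia; reflexivity).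
  assert (SE : safe_list (S U) U2 epilogue m2).
  { unfold epilogue. apply safe_list_app; [exact S3|]. fold m3.
    apply safe_list_app; [exact S4|]. fold m4.
    cbn [safe_list straight iacc iwr isem In]. rewrite H04.
    assert (Q1 := B2 (B0 + 17)). rewrite H17.
    repeat split; try lia; intros a; intuition lia. }
  assert (RE := reach_straight _ _ _ _ _ _ CE SE).
  exists (1 + (Lp + (T1 + length epilogue))), t, s', (sem_list epilogue m2).
  split; [exact HQ'|]. split; [|split; [|split]].
  - eapply reach_trans; [exact R0|].
    eapply reach_trans; [eapply reach_mono; [| |exact RP]; lia|].
    eapply reach_trans; [exact R1|].
    replace (length (ram c)) with (0 + 1 + Lp + csize c + length epilogue); [exact RE|].
    unfold ram. rewrite !length_app, comp_length. fold Lp. cbn [length]. lia.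
  - fold Lp. lia.
  - intros i Hi. unfold epilogue. rewrite !sem_list_app. fold m3 m4. cbn [sem_list isem].
    rewrite H04, H17.
    assert (Vc := V2 aCOL i ltac:(simpl; lia)). cbn [adr aidx] in Vc.
    destruct (Nat.eq_dec i 0) as [->|].
    + rewrite upd_same, <- Vc. f_equal. lia.
    + rewrite upd_other, V4, H0, Hoth by lia. rewrite <- Vc. f_equal. lia.
  - intros i Hi. unfold epilogue. rewrite !sem_list_app. fold m3 m4. cbn [sem_list isem].
    rewrite upd_other, F4, Hoth by lia. exact (V2 aLOW i ltac:(simpl; lia)).
Qed.

End Prologue.

(** * Local colourings in terms of common neighbours *)

(** Edge k stands in front of the earlier edges. This is the order in which arcs are pushed onto
    linked lists, so those lists represent [adjl] without any permutation. *)
Fixpoint adjl (edge : nat -> Edge) (k v : nat) : list (nat * nat) :=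
  match k with
  | 0 => []
  | S k =>
      if fst (edge k) =? v then (snd (edge k), k) :: adjl edge k v
      else if snd (edge k) =? v then (fst (edge k), k) :: adjl edge k v
      else adjl edge k v
  end.

Lemma map_nth_seq {X} (l : list X) d : map (fun i => nth i l d) (seq 0 (length l)) = l.
Proof.
  induction l as [|a l IH]; simpl; auto. f_equal. rewrite <- seq_shift, map_map. exact IH.
Qed.

Lemma NoDup_len3 (l : list nat) a b c :
  a <> b -> a <> c -> b <> c -> In a l -> In b l -> In c l -> 3 <= length l.
Proof.
  intros. change 3 with (length [a; b; c]). apply NoDup_incl_length.
  - repeat constructor; simpl; intuition congruence.
  - intros x [<-|[<-|[<-|[]]]]; auto.
Qed.

Lemma NoDup_len3_ex (l : list nat) a b : NoDup l -> 3 <= length l ->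
  exists c, In c l /\ c <> a /\ c <> b.
Proof.
  intros ND HL.
  destruct (Exists_dec (fun c => c <> a /\ c <> b) l) as [H|H].
  - intros x. destruct (Nat.eq_dec x a), (Nat.eq_dec x b); [right|right|right|left]; tauto.
  - apply Exists_exists in H as (c & H1 & H2 & H3). eauto.
  - exfalso. assert (HI : incl l [a; b]).
    { intros x Hx. destruct (Nat.eq_dec x a) as [->|]; [left; auto|].
      destruct (Nat.eq_dec x b) as [->|]; [right; left; auto|].
      exfalso. apply H. apply Exists_exists. eauto. }
    apply NoDup_incl_length in HI; auto. simpl in HI. lia.
Qed.

Lemma ed_sym a b : ed a b = ed b a.
Proof. unfold ed. f_equal; lia. Qed.

Lemma ed_inj a b c d : ed a b = ed c d -> (a = c /\ b = d) \/ (a = d /\ b = c).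
Proof. unfold ed. intros H. injection H as H1 H2. lia. Qed.

Lemma ed_inj_l a b c : ed a b = ed a c -> b = c.
Proof. intros H. apply ed_inj in H. lia. Qed.

Lemma incident_ed v a b : incident v (ed a b) <-> v = a \/ v = b.
Proof. unfold incident, ed; simpl. split; lia. Qed.

Lemma other_ed a b : other (ed a b) a = b.
Proof.
  unfold other, ed; simpl. destruct (Nat.eqb_spec (Nat.min a b) a); lia.
Qed.

Lemma adj_sym es u v : adj es u v -> adj es v u.
Proof. unfold adj; tauto. Qed.

Lemma chordless_sym es a b c d : chordless_sq es a b c d -> chordless_sq es c d a b.
Proof.
  intros (ND & H1 & H2 & H3 & H4 & H5 & H6).
  assert (a <> b /\ a <> c /\ a <> d /\ b <> c /\ b <> d /\ c <> d) as Hd.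
  { repeat rewrite NoDup_cons_iff in ND. simpl in ND. intuition. }
  repeat split; auto.
  - repeat constructor; simpl; intuition.
  - intros H. apply H5. apply adj_sym; auto.
  - intros H. apply H6. apply adj_sym; auto.
Qed.

Lemma ucs_sym es v u w : unique_chordless_square es v u w -> unique_chordless_square es v w u.
Proof.
  intros (x & H1 & H2 & H3 & H4 & H5 & H6). exists x. repeat split; auto.
  intros H. apply H5. apply adj_sym; auto.
Qed.

Lemma delta_sym es e f : delta es e f -> delta es f e.
Proof.
  intros (He & Hf & H). split; auto. split; auto. destruct H as [H|[H|H]].
  - left. destruct H as (Hn & v & H1 & H2 & H3). split; auto. exists v. repeat split; auto.
    intros H. apply H3. apply ucs_sym. auto.
  - right; left. destruct H as (a & b & c & d & Hs & -> & ->).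
    exists c, d, a, b. split; auto. apply chordless_sym. auto.
  - right; right; auto.
Qed.

Lemma dv_sym es v e f : dv es v e f -> dv es v f e.
Proof. intros [H1 H2]. split; [apply delta_sym; auto | tauto]. Qed.

Lemma dvstar_sym es v e f : dvstar es v e f -> dvstar es v f e.
Proof.
  induction 1 as [x y H|x y z H1 IH1 H2 IH2].
  - apply t_step, dv_sym, H.
  - eapply t_trans; eauto.
Qed.

Lemma dvstar_trans es v e f g : dvstar es v e f -> dvstar es v f g -> dvstar es v e g.
Proof. intros. eapply t_trans; eauto. Qed.

Section Graph.

Context (n : nat) (es : list Edge) (Hwf : wf_graph n es).

Definition edge (i : nat) : Edge := nth i es (0, 0).
Let m := length es.

Definition arcs (v : nat) : list (nat * nat) := adjl edge m v.
Definition nbrs (v : nat) : list nat := map fst (arcs v).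

Lemma edge_in i : i < m -> In (edge i) es.
Proof. intros H. apply nth_In. exact H. Qed.

Lemma edge_lt i : i < m -> fst (edge i) < snd (edge i) < n.
Proof.
  intros H. apply edge_in in H. destruct (edge i) as [a b]. apply (proj2 Hwf) in H. exact H.
Qed.

Lemma edge_inj i j : i < m -> j < m -> edge i = edge j -> i = j.
Proof. intros H1 H2 H. eapply NoDup_nth; eauto. apply Hwf. Qed.

Lemma edge_surj e : In e es -> exists i, i < m /\ edge i = e.
Proof. intros H. apply In_nth with (d := (0, 0)) in H. exact H. Qed.

Lemma adj_lt u v : adj es u v -> u < n /\ v < n /\ u <> v.
Proof. intros [H|H]; apply (proj2 Hwf) in H; lia. Qed.

Lemma adj_ed u v : adj es u v <-> In (ed u v) es.
Proof.
  split.
  - intros [H|H]; assert (X := proj2 Hwf _ _ H); unfold ed.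
    + rewrite Nat.min_l, Nat.max_r by lia. auto.
    + rewrite Nat.min_r, Nat.max_l by lia. auto.
  - unfold ed, adj. intros H. destruct (Nat.le_ge_cases u v) as [h|h].
    + rewrite Nat.min_l, Nat.max_r in H by lia. auto.
    + rewrite Nat.min_r, Nat.max_l in H by lia. auto.
Qed.

Lemma adj_irrefl u : ~ adj es u u.
Proof. intros H. apply adj_lt in H. lia. Qed.

Lemma in_adjl k v u e : k <= m -> In (u, e) (adjl edge k v) <-> e < k /\ edge e = ed v u.
Proof.
  induction k as [|k IH]; intros Hk; simpl.
  - split; [tauto | lia].
  - assert (X := edge_lt k ltac:(lia)). specialize (IH ltac:(lia)).
    assert (Y : edge k = ed v u <-> (fst (edge k) = v /\ snd (edge k) = u) \/
                                 (snd (edge k) = v /\ fst (edge k) = u)).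
    { destruct (edge k) as [a b]; simpl in *. unfold ed. split.
      - intros H. injection H as -> ->. lia.
      - intros [[-> ->]|[-> ->]]; f_equal; lia. }
    destruct (Nat.eqb_spec (fst (edge k)) v); [|destruct (Nat.eqb_spec (snd (edge k)) v)]; simpl;
      rewrite IH; (split; [intros H | intros [H1 H2]; destruct (Nat.eq_dec e k) as [->|]]).
    + destruct H as [H|[H1 H2]]; [|split; auto; lia]. injection H as <- <-. split; [lia|].
      apply Y. auto.
    + left. apply Y in H2. f_equal. lia.
    + right. split; auto. lia.
    + destruct H as [H|[H1 H2]]; [|split; auto; lia]. injection H as <- <-. split; [lia|].
      apply Y. auto.
    + left. apply Y in H2. f_equal. lia.
    + right. split; auto. lia.
    + destruct H. split; auto.
    + apply Y in H2. lia.
    + split; auto. lia.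
Qed.

Lemma in_arcs v u e : In (u, e) (arcs v) <-> e < m /\ edge e = ed v u.
Proof. apply in_adjl. lia. Qed.

Lemma in_nbrs v u : In u (nbrs v) <-> adj es v u.
Proof.
  unfold nbrs. rewrite in_map_iff. split.
  - intros ([u' e] & <- & H). apply in_arcs in H as [H1 H2]. apply adj_ed. simpl. rewrite <- H2.
    apply edge_in; auto.
  - intros H. apply adj_ed in H. apply edge_surj in H as (e & H1 & H2).
    exists (u, e). split; auto. apply in_arcs. auto.
Qed.

Lemma NoDup_adjl k v : k <= m -> NoDup (map fst (adjl edge k v)).
Proof.
  induction k as [|k IH]; intros Hk; simpl; [constructor|].
  specialize (IH ltac:(lia)).
  assert (X : forall u, edge k = ed v u -> ~ In u (map fst (adjl edge k v))).
  { intros u Hu Hin. apply in_map_iff in Hin as ([u' e] & Hf & Hin). simpl in Hf. subst u'.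
    apply in_adjl in Hin; [|lia]. destruct Hin as [H1 H2]. assert (e = k); [|lia].
    apply edge_inj; try lia. congruence. }
  assert (Y := edge_lt k ltac:(lia)). 
  destruct (Nat.eqb_spec (fst (edge k)) v); [|destruct (Nat.eqb_spec (snd (edge k)) v)]; simpl; auto.
  - constructor; auto. apply X. destruct (edge k); simpl in *; subst. unfold ed. f_equal; lia.
  - constructor; auto. apply X. destruct (edge k); simpl in *; subst. unfold ed. f_equal; lia.
Qed.

Lemma NoDup_nbrs v : NoDup (nbrs v).
Proof. apply NoDup_adjl. lia. Qed.

Lemma length_nbrs v : length (nbrs v) = length (arcs v).
Proof. apply length_map. Qed.

Lemma length_arcs_le v : length (arcs v) <= n.
Proof.
  rewrite <- length_nbrs, <- (length_seq n 0). apply NoDup_incl_length.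
  - apply NoDup_nbrs.
  - intros u Hu. apply in_nbrs, adj_lt in Hu. apply in_seq. lia.
Qed.

Lemma length_adjl k v : length (adjl edge k v) =
  length (filter (fun e => orb (Nat.eqb (fst e) v) (Nat.eqb (snd e) v)) (map edge (seq 0 k))).
Proof.
  set (f := fun e => _). induction k as [|k IH]; [reflexivity|].
  rewrite seq_S, map_app, filter_app, length_app. etransitivity; [|apply f_equal2; [exact IH|reflexivity]].
  simpl. unfold f. 
  destruct (fst (edge k) =? v); simpl; [lia|]. destruct (snd (edge k) =? v); simpl; lia.
Qed.

Lemma length_arcs v : length (arcs v) = deg es v.
Proof. unfold arcs. rewrite length_adjl. unfold edge, m. rewrite map_nth_seq. reflexivity. Qed.

Lemma fold_max_ge l a : a <= fold_left Nat.max l a /\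
  forall x, In x l -> x <= fold_left Nat.max l a.
Proof.
  revert a; induction l as [|y l IH]; intros a; simpl; [split; [lia|tauto]|].
  destruct (IH (Nat.max a y)) as [H1 H2]. split; [lia|]. intros x [->|H]; auto. lia.
Qed.

Lemma maxdeg_le : maxdeg n es <= m.
Proof.
  unfold maxdeg.
  assert (H : forall l a, (forall x, In x l -> x <= m) -> a <= m -> fold_left Nat.max l a <= m).
  { induction l as [|x l IH]; intros a Hl Ha; simpl; auto.
    apply IH; [intros; apply Hl; right; auto|]. assert (x <= m) by (apply Hl; left; auto). lia. }
  apply H; [|lia]. intros x Hx. apply in_map_iff in Hx as (v & <- & _). apply filter_length_le.
Qed.

Lemma length_arcs_maxdeg v : v < n -> length (arcs v) <= maxdeg n es.
Proof.
  intros H. rewrite length_arcs. apply fold_max_ge. apply in_map. apply in_seq. lia.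
Qed.

(** Stated for any duplicate-free list because it is applied to the visited vertices. The induction
    is on the edges: a further edge adds one for each endpoint in the list, and each endpoint occurs
    there at most once. *)
Lemma handshake l : NoDup l -> list_sum (map (fun v => length (arcs v)) l) <= 2 * m.
Proof.
  intros ND. unfold arcs.
  assert (C : forall a, count_occ Nat.eq_dec l a <= 1)
    by (intros a; apply NoDup_count_occ; auto).
  generalize m as k. induction k as [|k IH].
  - simpl. clear. induction l; simpl; lia.
  - enough (list_sum (map (fun v => length (adjl edge (S k) v)) l) <=
      list_sum (map (fun v => length (adjl edge k v)) l) +
      count_occ Nat.eq_dec l (fst (edge k)) + count_occ Nat.eq_dec l (snd (edge k))).
    { assert (C1 := C (fst (edge k))). assert (C2 := C (snd (edge k))). lia. }
    clear. induction l as [|v l IH]; [simpl; lia|].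
    cbn [map list_sum fold_right count_occ] in *. unfold list_sum in *. cbn [fold_right].
    assert (length (adjl edge (S k) v) <= length (adjl edge k v) +
      (if Nat.eq_dec v (fst (edge k)) then 1 else 0) + (if Nat.eq_dec v (snd (edge k)) then 1 else 0)).
    { cbn [adjl]. destruct (Nat.eqb_spec (fst (edge k)) v), (Nat.eqb_spec (snd (edge k)) v),
        (Nat.eq_dec v (fst (edge k))), (Nat.eq_dec v (snd (edge k))); simpl; lia. }
    destruct (Nat.eq_dec v (fst (edge k))), (Nat.eq_dec v (snd (edge k))); lia.
Qed.

Lemma connected_nbr v : connected_graph n es -> 2 <= n -> v < n -> exists u, adj es v u.
Proof.
  intros [_ HC] Hn Hv. set (u := if v =? 0 then 1 else 0).
  assert (Hu : u < n /\ v <> u) by (unfold u; destruct (Nat.eqb_spec v 0); lia).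
  clearbody u. assert (H := HC v u Hv (proj1 Hu)). destruct Hu as [_ Hu].
  apply clos_rt_rt1n in H. inversion H; subst; [congruence|]. exists y. tauto.
Qed.

(** This lets terms linear in n, such as reading W or the rounds of the search, be absorbed by the
    number of edges. *)
Lemma connected_size : connected_graph n es -> 2 <= n -> n <= 2 * m.
Proof.
  intros HC Hn. etransitivity; [|apply (handshake (seq 0 n)), seq_NoDup].
  assert (H : forall v, In v (seq 0 n) -> 1 <= length (arcs v)).
  { intros v Hv. apply in_seq in Hv. destruct (connected_nbr v HC Hn ltac:(lia)) as [u Hu].
    apply in_nbrs in Hu. rewrite <- length_nbrs. destruct (nbrs v); [contradiction|simpl; lia]. }
  rewrite <- (length_seq n 0) at 1. revert H. generalize (seq 0 n) as l.
  induction l as [|a l IH]; intros H; [simpl; lia|].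
  cbn [map length]. change (list_sum (length (arcs a) :: map (fun v => length (arcs v)) l))
    with (length (arcs a) + list_sum (map (fun v => length (arcs v)) l)).
  assert (1 <= length (arcs a)) by (apply H; left; auto).
  assert (length l <= list_sum (map (fun v => length (arcs v)) l))
    by (apply IH; intros; apply H; right; auto). lia.
Qed.

Section Local.

Context (v : nat).

Let d := length (arcs v).
Definition nb (i : nat) : nat := fst (nth i (arcs v) (0, 0)).
Definition ne (i : nat) : nat := snd (nth i (arcs v) (0, 0)).

Lemma ne_spec i : i < d -> ne i < m /\ edge (ne i) = ed v (nb i).
Proof.
  intros Hi. apply in_arcs. unfold nb, ne. rewrite <- surjective_pairing. apply nth_In. auto.
Qed.

Lemma nb_adj i : i < d -> adj es v (nb i).
Proof. intros Hi. destruct (ne_spec i Hi) as [H1 H2]. apply adj_ed. rewrite <- H2. apply edge_in; auto. Qed.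

Lemma nb_nth i : nb i = nth i (nbrs v) 0.
Proof. symmetry. exact (map_nth fst (arcs v) (0, 0) i). Qed.

Lemma nb_inj i j : i < d -> j < d -> nb i = nb j -> i = j.
Proof.
  intros Hi Hj. rewrite !nb_nth. apply NoDup_nth; rewrite ?length_nbrs; auto. apply NoDup_nbrs.
Qed.

Lemma nb_surj u : adj es v u -> exists i, i < d /\ nb i = u.
Proof.
  intros H. apply in_nbrs in H. apply In_nth with (d := 0) in H as (i & H1 & H2).
  rewrite length_nbrs in H1. exists i. rewrite nb_nth. auto.
Qed.

Definition adjb (a b : nat) : bool := existsb (Nat.eqb b) (nbrs a).

Lemma adjb_spec a b : adjb a b = true <-> adj es a b.
Proof.
  unfold adjb. rewrite existsb_exists, <- in_nbrs. split.
  - intros (x & H1 & H2). apply Nat.eqb_eq in H2. subst; auto.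
  - intros H. exists b. split; auto. apply Nat.eqb_refl.
Qed.

(** Positions rather than vertices, in increasing order, so that the first and the last element are
    what a scan of the walks can record. *)
Definition common (x : nat) : list nat := filter (fun i => adjb (nb i) x) (seq 0 d).

Lemma in_common x i : In i (common x) <-> i < d /\ adj es (nb i) x.
Proof.
  unfold common. rewrite filter_In, in_seq, adjb_spec. intuition lia.
Qed.

Lemma NoDup_common x : NoDup (common x).
Proof. apply NoDup_filter, seq_NoDup. Qed.

Definition far (x : nat) : bool := negb (x =? v) && negb (adjb v x).

Lemma far_spec x : far x = true <-> x <> v /\ ~ adj es v x.
Proof.
  unfold far. rewrite andb_true_iff, !negb_true_iff, Nat.eqb_neq.
  rewrite <- adjb_spec. destruct (adjb v x); intuition congruence.
Qed.

Definition is_sq (x : nat) : bool := far x && (length (common x) =? 2).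

Definition opp (i x : nat) : nat :=
  if hd 0 (common x) =? i then last (common x) 0 else hd 0 (common x).

Lemma opp_spec i x : length (common x) = 2 -> In i (common x) ->
  opp i x <> i /\ In (opp i x) (common x) /\ forall k, In k (common x) -> k = i \/ k = opp i x.
Proof.
  intros HL Hi. assert (ND := NoDup_common x). unfold opp.
  destruct (common x) as [|a [|b [|c l]]]; simpl in HL; try lia.
  simpl in *. apply NoDup_cons_iff in ND as [ND _]. simpl in ND.
  destruct (Nat.eqb_spec a i); intuition congruence.
Qed.

Lemma opp_eq i j x : length (common x) = 2 -> In i (common x) -> In j (common x) -> i <> j -> opp i x = j.
Proof.
  intros HL Hi Hj Hn. destruct (opp_spec i x HL Hi) as (_ & _ & H). destruct (H j Hj); congruence.
Qed.

(** Restricting the search to [nbrs (nb i)] matters: [opp i x] has its meaning only for i in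
    [common x]. *)
Definition cnt (i j : nat) : nat :=
  length (filter (fun x => is_sq x && (opp i x =? j)) (nbrs (nb i))).

Definition nrel (i j : nat) : Prop := dvstar es v (ed v (nb i)) (ed v (nb j)).

Definition gen1 (i j : nat) : Prop := adj es (nb i) (nb j).
Definition gen2 (i j : nat) : Prop :=
  exists x, far x = true /\ In i (common x) /\ In j (common x) /\ 3 <= length (common x).
Definition gen3 (i j : nat) : Prop := i <> j /\ cnt i j <> 1.

Lemma inEv i : i < d -> In (ed v (nb i)) es.
Proof. intros. apply adj_ed, nb_adj. auto. Qed.

Lemma nrel_refl i : i < d -> nrel i i.
Proof.
  intros. apply t_step. split.
  - split; [apply inEv; auto|]. split; [apply inEv; auto|]. auto.
  - left. apply incident_ed. auto.
Qed.

Lemma nrel_direct i j : i < d -> j < d -> i <> j ->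
  ~ unique_chordless_square es v (nb i) (nb j) -> nrel i j.
Proof.
  intros Hi Hj Hn HU. apply t_step. split.
  - split; [apply inEv; auto|]. split; [apply inEv; auto|]. left. split.
    + intros H. apply ed_inj_l in H. apply nb_inj in H; auto.
    + exists v. rewrite !other_ed, !incident_ed. auto.
  - left. apply incident_ed. auto.
Qed.

Lemma far_square i j x : i < d -> j < d -> i <> j -> far x = true ->
  adj es (nb i) x -> adj es (nb j) x -> ~ adj es (nb i) (nb j) ->
  chordless_sq es v (nb i) x (nb j).
Proof.
  intros Hi Hj Hn Hx Hix Hjx Hij. apply far_spec in Hx as [Hx1 Hx2].
  assert (Ai := nb_adj i Hi). assert (Aj := nb_adj j Hj).
  assert (nb i <> nb j) by (intros H; apply nb_inj in H; auto).
  assert (Di := adj_lt _ _ Ai). assert (Dj := adj_lt _ _ Aj).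
  assert (Dix := adj_lt _ _ Hix). assert (Djx := adj_lt _ _ Hjx).
  repeat split; auto using adj_sym.
  repeat constructor; simpl; intuition congruence.
Qed.

Lemma nrel_opposite i j x : chordless_sq es v (nb i) x (nb j) ->
  dv es v (ed v (nb i)) (ed (nb j) x).
Proof.
  intros H. assert (H' := H). destruct H' as (_ & H1 & H2 & H3 & H4 & _). split.
  - split; [apply adj_ed; auto|]. split; [apply adj_ed, adj_sym; auto|]. right; left.
    exists v, (nb i), x, (nb j). repeat split; try apply H. apply ed_sym.
  - left. apply incident_ed. auto.
Qed.

Lemma gen1_nrel i j : i < d -> j < d -> gen1 i j -> nrel i j.
Proof.
  intros Hi Hj H. apply nrel_direct; auto.
  - intros ->. apply adj_irrefl in H. auto.
  - intros (x & _ & _ & _ & _ & HU & _). apply HU. exact H.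
Qed.

(* If [v] and [x] have three common neighbours, the square spanned at [nb i] by the edges to
   [v] and [x] is not unique, so these two edges are related. *)
Lemma gen2_nrel i j : i < d -> j < d -> gen2 i j -> nrel i j.
Proof.
  intros Hi Hj (x & Hx & Oi & Oj & HL). apply in_common in Oi as [_ Oi]. 
  destruct (Nat.eq_dec i j) as [->|Hn]; [apply nrel_refl; auto|].
  apply in_common in Oj as [_ Oj].
  destruct (adjb (nb i) (nb j)) eqn:Ab; [apply gen1_nrel; auto; apply adjb_spec; auto|].
  assert (Hij : ~ adj es (nb i) (nb j)) by (rewrite <- adjb_spec; congruence).
  assert (Sq := far_square j i x Hj Hi ltac:(auto) Hx Oj Oi ltac:(auto using adj_sym)).
  apply far_spec in Hx as [Hx1 Hx2].
  apply dvstar_trans with (ed (nb i) x).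
  - apply t_step. split; [|left; apply incident_ed; auto].
    split; [apply inEv; auto|]. split; [apply adj_ed; auto|]. left. split.
    + rewrite ed_sym. intros H. apply ed_inj_l in H. congruence.
    + exists (nb i). rewrite (ed_sym v), !other_ed, !incident_ed. repeat split; auto.
      intros (y & Hy1 & Hy2 & Hy3 & Hy4 & _).
      destruct (nb_surj y Hy2) as (k & Hk & <-).
      destruct (NoDup_len3_ex (common x) i k (NoDup_common x) HL) as (z & Oz & Hz1 & Hz2).
      apply in_common in Oz as [Hz Oz].
      destruct (Hy4 (nb z) (nb_adj z Hz) (adj_sym _ _ _ Oz)) as [H|H];
        apply nb_inj in H; congruence.
  - apply t_step, dv_sym, nrel_opposite. auto.
Qed.

(** The top x of a unique chordless square is far. If v and x have a third common neighbour, [gen2]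
    applies. Otherwise [common x] is {i, j}, and any other vertex counted by [cnt i j] would be a
    second top. *)
Lemma unique_cnt i j : i < d -> j < d -> i <> j ->
  unique_chordless_square es v (nb i) (nb j) -> 
  gen2 i j \/ (cnt i j = 1 /\ exists x, is_sq x = true /\ In i (common x) /\ In j (common x)).
Proof.
  intros Hi Hj Hn (x & H1 & H2 & H3 & H4 & H5 & H6).
  assert (Fx : far x = true) by (apply far_spec; auto).
  assert (Oi : In i (common x)) by (apply in_common; auto).
  assert (Oj : In j (common x)) by (apply in_common; auto).
  destruct (le_lt_dec 3 (length (common x))) as [L|L]; [left; exists x; auto|right].
  assert (L2 : length (common x) = 2).
  { assert (length [i; j] <= length (common x)); [|simpl in *; lia]. apply NoDup_incl_length.
    - repeat constructor; simpl; intuition congruence.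
    - intros y [<-|[<-|[]]]; auto. }
  assert (Sx : is_sq x = true) by (unfold is_sq; rewrite Fx, L2; reflexivity).
  split; [|eauto].
  unfold cnt. set (l := filter _ _).
  assert (NDl : NoDup l) by (apply NoDup_filter, NoDup_nbrs).
  assert (Hl : forall y, In y l <-> y = x).
  { intros y. unfold l. rewrite filter_In, andb_true_iff, Nat.eqb_eq, in_nbrs. split.
    - intros (A1 & A2 & A3). unfold is_sq in A2. apply andb_true_iff in A2 as [A2 A4].
      apply Nat.eqb_eq in A4. apply far_spec in A2 as [A2 A5].
      assert (Oy : In i (common y)) by (apply in_common; auto).
      destruct (opp_spec i y A4 Oy) as (_ & B & _). rewrite A3 in B. apply in_common in B as [_ B].
      destruct (H4 y A1 B); congruence.
    - intros ->. split; auto. split; auto. apply opp_eq; auto. }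
  destruct l as [|a [|b l']]; simpl; auto.
  - exfalso. apply (proj2 (Hl x)). auto.
  - exfalso. assert (a = x) by (apply Hl; simpl; auto).
    assert (b = x) by (apply Hl; simpl; auto). subst.
    apply NoDup_cons_iff in NDl. simpl in NDl. tauto.
Qed.

Lemma gen3_nrel i j : i < d -> j < d -> gen3 i j -> nrel i j.
Proof.
  intros Hi Hj [Hn Hc].
  (* Whether the pair also falls under [gen2] is decided by a boolean search. If it does not, the
     pair can only fail to span a unique chordless square, by [unique_cnt]. *)
  destruct (existsb (fun x => far x && (3 <=? length (common x)) && adjb (nb i) x && adjb (nb j) x)
    (nbrs (nb i))) eqn:Ex.
  - apply existsb_exists in Ex as (x & _ & H). rewrite !andb_true_iff in H.
    destruct H as [[[H1 H2] H3] H4]. apply Nat.leb_le in H2. apply adjb_spec in H3, H4.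
    apply gen2_nrel; auto. exists x. repeat split; auto; apply in_common; auto.
  - apply nrel_direct; auto. intros U. destruct (unique_cnt i j Hi Hj Hn U) as [H|[H _]]; [|congruence].
    destruct H as (x & H1 & H2 & H3 & H4). apply in_common in H2 as [_ H2]. apply in_common in H3 as [_ H3].
    apply not_true_iff_false in Ex. apply Ex. apply existsb_exists. exists x.
    rewrite in_nbrs, !andb_true_iff, !adjb_spec, Nat.leb_le. auto.
Qed.

(** * Completeness of the generators: every equivalence [L] containing them contains [nrel] *)

Section Complete.

Context (L : nat -> nat -> Prop)
  (Lrefl : forall i, L i i) (Lsym : forall i j, L i j -> L j i)
  (Ltrans : forall i j k, L i j -> L j k -> L i k)
  (L1 : forall i j, i < d -> j < d -> gen1 i j -> L i j)
  (L2 : forall i j, i < d -> j < d -> gen2 i j -> L i j)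
  (L3 : forall i j, i < d -> j < d -> gen3 i j -> L i j).

(** If [cnt i j] is 1, some far x has [common x] equal to {i, j}, and non-uniqueness must come from
    another common neighbour y. A far y is not counted by [cnt], so [common y] has at least three
    elements and [gen2] applies; a neighbour y of v is joined to both ends by [gen1]. *)
Lemma not_unique_L i j : i < d -> j < d -> i <> j ->
  ~ unique_chordless_square es v (nb i) (nb j) -> L i j.
Proof.
  intros Hi Hj Hn HU.
  destruct (adjb (nb i) (nb j)) eqn:Ab; [apply L1; auto; apply adjb_spec; auto|].
  assert (Hij : ~ adj es (nb i) (nb j)) by (rewrite <- adjb_spec; congruence).
  destruct (Nat.eq_dec (cnt i j) 1) as [Hc|Hc]; [|apply L3; auto; split; auto].
  destruct (filter (fun x => is_sq x && (opp i x =? j)) (nbrs (nb i))) as [|x [|]] eqn:Ef;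
    unfold cnt in Hc; rewrite Ef in Hc; simpl in Hc; try lia. clear Hc.
  assert (Hx : forall y, In y (nbrs (nb i)) /\ is_sq y && (opp i y =? j) = true <-> y = x).
  { intros y. assert (T := filter_In (fun x => is_sq x && (opp i x =? j)) y (nbrs (nb i))).
    rewrite Ef in T. rewrite <- T. simpl. intuition. }
  destruct (proj2 (Hx x) eq_refl) as [A1 A2]. apply in_nbrs in A1.
  apply andb_true_iff in A2 as [A2 A3]. apply Nat.eqb_eq in A3.
  unfold is_sq in A2. apply andb_true_iff in A2 as [A2 A4]. apply Nat.eqb_eq in A4.
  assert (Ox : In i (common x)) by (apply in_common; auto).
  destruct (opp_spec i x A4 Ox) as (_ & B & _). rewrite A3 in B. apply in_common in B as [_ B].
  apply far_spec in A2 as [F1 F2].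
  destruct (existsb (fun y => adjb (nb j) y && negb (y =? v) && negb (y =? x)) (nbrs (nb i))) eqn:Ex.
  - apply existsb_exists in Ex as (y & Y1 & Y2). rewrite !andb_true_iff, !negb_true_iff in Y2.
    destruct Y2 as [[Y2 Y3] Y4]. apply in_nbrs in Y1. apply adjb_spec in Y2.
    apply Nat.eqb_neq in Y3, Y4.
    destruct (far y) eqn:Fy.
    + assert (Oi : In i (common y)) by (apply in_common; auto).
      assert (Oj : In j (common y)) by (apply in_common; auto).
      destruct (Nat.eq_dec (length (common y)) 2) as [E2|E2].
      * exfalso. apply Y4. apply Hx. rewrite in_nbrs. split; auto.
        unfold is_sq. rewrite Fy, E2. simpl. apply Nat.eqb_eq. apply opp_eq; auto.
      * apply L2; auto. exists y. repeat split; auto.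
        assert (length [i; j] <= length (common y)); [|simpl in *; lia]. apply NoDup_incl_length.
        -- repeat constructor; simpl; intuition congruence.
        -- intros z [<-|[<-|[]]]; auto.
    + assert (Avy : adj es v y).
      { destruct (adjb v y) eqn:Avy; [apply adjb_spec; auto|].
        assert (far y = true); [|congruence]. apply far_spec. rewrite <- adjb_spec. intuition congruence. }
      apply nb_surj in Avy as (k & Hk & <-).
      apply Ltrans with k; [|apply Lsym]; apply L1; auto.
  - exfalso. apply HU. exists x. repeat split; auto.
    intros y Y1 Y2. destruct (Nat.eq_dec y v); auto. destruct (Nat.eq_dec y x); auto.
    exfalso. apply not_true_iff_false in Ex. apply Ex. apply existsb_exists. exists y.
    rewrite in_nbrs, !andb_true_iff, !negb_true_iff, adjb_spec, !Nat.eqb_neq. auto.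
Qed.

(* The two ways in which an edge off [E_v] can be [delta]-related to [v nb_k]. *)
Definition kind1 (e : Edge) (k : nat) : Prop :=
  exists y, e = ed (nb k) y /\ y <> v /\ adj es (nb k) y /\
    ~ unique_chordless_square es (nb k) y v.
Definition kind2 (e : Edge) (k : nat) : Prop :=
  exists x j, e = ed (nb j) x /\ j < d /\ far x = true /\ j <> k /\
    adj es (nb k) x /\ adj es (nb j) x /\ ~ adj es (nb k) (nb j).

Lemma delta_kinds e k : k < d -> ~ incident v e -> delta es e (ed v (nb k)) ->
  kind1 e k \/ kind2 e k.
Proof.
  intros Hk Hv (He & _ & H). destruct H as [H|[H|H]].
  - left. destruct H as (Hn & z & Hz1 & Hz2 & HU). apply incident_ed in Hz2.
    destruct Hz2 as [->| ->]; [contradiction|].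
    rewrite (ed_sym v), other_ed in HU.
    assert (Ee : e = ed (nb k) (other e (nb k)) /\ other e (nb k) <> v).
    { destruct e as [a b]. assert (Hab := proj2 Hwf _ _ He).
      unfold incident, other, ed in *; simpl in *.
      destruct (Nat.eqb_spec a (nb k)); split; try (f_equal; lia); lia. }
    destruct Ee as [Ee En]. exists (other e (nb k)). split; auto. split; auto.
    split; auto. apply adj_ed. rewrite <- Ee. auto.
  - right. destruct H as (a & b & c & d' & Hs & -> & Hf).
    destruct Hs as (ND & A1 & A2 & A3 & A4 & A5 & A6).
    apply ed_inj in Hf.
    assert (Hva : a <> v /\ b <> v) by (rewrite incident_ed in Hv; split; intros ->; apply Hv; auto).
    repeat rewrite NoDup_cons_iff in ND. simpl in ND.
    destruct Hf as [[Hc Hd]|[Hc Hd]]; subst c d'.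
    + destruct (nb_surj b (adj_sym _ _ _ A2)) as (j & Hj & Eb). exists a, j.
      subst b. split; [apply ed_sym|]. split; auto. split.
      * apply far_spec. split; [tauto|]. intros H. apply A5. apply adj_sym; auto.
      * split; [intros ->; tauto|]. split; auto. split; [apply adj_sym; auto|].
        intros H. apply A6. apply adj_sym; auto.
    + destruct (nb_surj a A4) as (j & Hj & Ea). exists b, j.
      subst a. split; auto. split; auto. split.
      * apply far_spec. split; [tauto|]. intros H. apply A6. apply adj_sym; auto.
      * split; [intros ->; tauto|]. split; [apply adj_sym; auto|]. split; auto.
        intros H. apply A5. apply adj_sym; auto.
  - exfalso. apply Hv. rewrite H. apply incident_ed. auto.
Qed.

(** The edge is [nb k] to x with x far and adjacent to [nb l]. Were [common x] just {k, l}, the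
    edges from [nb k] to x and to v would span a unique chordless square with top [nb l], contrary
    to [kind1]. Hence [common x] is larger and [gen2] applies. In the other orientation x would be a
    neighbour of v. *)
Lemma kind12_L e k l : k < d -> l < d -> kind1 e k -> kind2 e l -> L k l.
Proof.
  intros Hk Hl (y & -> & Hy & Ay & HU) (x & j & He & Hj & Fx & Hn & Al & Aj & Hlj).
  assert (Fx' := Fx). apply far_spec in Fx' as [Fx1 Fx2].
  apply ed_inj in He. destruct He as [[He1 He2]|[He1 He2]].
  - subst y. apply nb_inj in He1; auto. subst j. 
    assert (Ok : In k (common x)) by (apply in_common; auto).
    assert (Ol : In l (common x)) by (apply in_common; auto).
    destruct (le_lt_dec 3 (length (common x))) as [Lg|Lg]; [apply L2; auto; exists x; auto|].
    exfalso. apply HU. exists (nb l).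
    assert (nb l <> nb k) by (intros H; apply nb_inj in H; auto; congruence).
    repeat split; auto using adj_sym.
    + apply nb_adj; auto.
    + intros z Z1 Z2. apply nb_surj in Z2 as (q & Hq & <-).
      destruct (Nat.eq_dec q k) as [->|]; auto. destruct (Nat.eq_dec q l) as [->|]; auto.
      exfalso. assert (3 <= length (common x)); [|lia].
      apply (NoDup_len3 _ k l q); auto. apply in_common; split; auto. apply adj_sym; auto.
  - exfalso. apply Fx2. rewrite <- He1. apply nb_adj; auto.
Qed.

(** An excursion out of $E_v$ over a single edge e connects only L-related positions. With two
    shared endpoints, e joins [nb k] to [nb l] or k = l; if e is opposite to both edges, then j, k
    and l are three members of one [common x]. *)
Lemma kinds_L e k l : k < d -> l < d -> kind1 e k \/ kind2 e k -> kind1 e l \/ kind2 e l -> L k l.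
Proof.
  intros Hk Hl [K1|K1] [K2|K2].
  - destruct K1 as (y & -> & Hy & Ay & _), K2 as (z & He & Hz & Az & _).
    apply ed_inj in He as [[He1 He2]|[He1 He2]].
    + apply nb_inj in He1; auto. subst. auto.
    + apply L1; auto. unfold gen1. rewrite He1. apply adj_sym; auto.
  - eapply kind12_L; eauto.
  - apply Lsym. eapply kind12_L; eauto.
  - destruct (Nat.eq_dec k l) as [->|Hkl]; auto.
    destruct K1 as (x & j & -> & Hj & Fx & Hn & Al & Aj & Hlj).
    destruct K2 as (x' & j' & He & Hj' & Fx' & Hn' & Al' & Aj' & Hlj').
    apply ed_inj in He as [[He1 He2]|[He1 He2]].
    + apply nb_inj in He1; auto. subst x' j'. apply L2; auto. exists x.
      split; auto. assert (In k (common x)) by (apply in_common; auto).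
      assert (In l (common x)) by (apply in_common; auto). assert (In j (common x)) by (apply in_common; auto).
      repeat split; auto. apply (NoDup_len3 _ j k l); auto.
    + exfalso. apply far_spec in Fx as [_ Fx]. apply Fx. rewrite He2. apply nb_adj; auto.
Qed.

Lemma Ev_pair_L k l : k < d -> l < d -> delta es (ed v (nb k)) (ed v (nb l)) -> L k l.
Proof.
  intros Hk Hl (_ & _ & H). destruct (Nat.eq_dec k l) as [->|Hkl]; auto.
  assert (Hnb : nb k <> nb l) by (intros h; apply nb_inj in h; auto).
  assert (Ak := adj_lt _ _ (nb_adj k Hk)). assert (Al := adj_lt _ _ (nb_adj l Hl)).
  destruct H as [H|[H|H]].
  - destruct H as (_ & z & Hz1 & Hz2 & HU). apply incident_ed in Hz1, Hz2.
    assert (z = v) by lia. subst z. rewrite !other_ed in HU. apply not_unique_L; auto.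
  - exfalso. destruct H as (a & b & c & d' & (ND & _) & H1 & H2).
    repeat rewrite NoDup_cons_iff in ND. simpl in ND.
    apply ed_inj in H1, H2. intuition congruence.
  - exfalso. apply ed_inj_l in H. auto.
Qed.

Lemma incident_Ev e : In e es -> incident v e -> exists k, k < d /\ e = ed v (nb k).
Proof.
  intros He Hv. destruct e as [a b]. assert (X := proj2 Hwf _ _ He).
  unfold incident in Hv; simpl in Hv. destruct Hv as [->| ->].
  - destruct (nb_surj b) as (k & Hk & <-); [left; auto|]. exists k. split; auto.
    unfold ed. f_equal; lia.
  - destruct (nb_surj a) as (k & Hk & <-); [right; auto|]. exists k. split; auto.
    unfold ed. f_equal; lia.
Qed.

(** Induction along the chain, where an edge off $E_v$ keeps track of an edge at v to which it is
    related. *)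
Lemma dvstar_L i j : i < d -> j < d -> nrel i j -> L i j.
Proof.
  intros Hi Hj H.
  (* [T f] says that the chain has reached f. Two outside edges are never consecutive, because each
     [dv] step has an end in $E_v$. *)
  set (T := fun f => In f es /\
    (forall k, k < d -> f = ed v (nb k) -> L i k) /\
    (~ incident v f -> exists k, k < d /\ delta es f (ed v (nb k)) /\ L i k)).
  assert (Hstep : forall f g, T f -> dv es v f g -> T g).
  { intros f g (Hf & T1 & T2) [Hd Hi']. split; [apply Hd|].
    destruct Hi' as [Iv|Iv].
    - destruct (incident_Ev f Hf Iv) as (k & Hk & ->). specialize (T1 k Hk eq_refl). split.
      + intros l Hl ->. apply Ltrans with k; auto. apply Ev_pair_L; auto.
      + intros Hg. exists k. split; auto. split; auto. apply delta_sym. auto.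
    - split; [|contradiction]. intros l Hl ->.
      destruct (existsb (Nat.eqb (fst f)) [v] || existsb (Nat.eqb (snd f)) [v]) eqn:B.
      + assert (Iv' : incident v f).
        { unfold incident. simpl in B. rewrite !orb_false_r, orb_true_iff, !Nat.eqb_eq in B. auto. }
        destruct (incident_Ev f Hf Iv') as (k & Hk & ->). apply Ltrans with k; auto.
        apply Ev_pair_L; auto.
      + assert (Iv' : ~ incident v f).
        { unfold incident. simpl in B. rewrite !orb_false_r, orb_false_iff, !Nat.eqb_neq in B. tauto. }
        destruct (T2 Iv') as (k & Hk & Hdk & Lk). apply Ltrans with k; auto.
        apply (kinds_L f); auto; apply delta_kinds; auto. }
  assert (Hall : forall e f, dvstar es v e f -> T e -> T f).
  { intros e f Hef. induction Hef; eauto. }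
  refine (proj1 (proj2 (Hall _ _ H _)) j Hj eq_refl).
  split; [apply inEv; auto|]. split.
  - intros k Hk Ek. apply ed_inj_l in Ek. apply nb_inj in Ek; auto. subst; auto.
  - intros Hn. exfalso. apply Hn. apply incident_ed. auto.
Qed.

End Complete.

(* The walks of length two from [v]: position of the midpoint, end, second edge. *)
Definition wedges : list (nat * (nat * nat)) :=
  flat_map (fun i => map (pair i) (arcs (nb i))) (seq 0 d).

Lemma in_wedges i x e : In (i, (x, e)) wedges <-> i < d /\ e < m /\ edge e = ed (nb i) x.
Proof.
  unfold wedges. rewrite in_flat_map. split.
  - intros (i' & H1 & H2). apply in_map_iff in H2 as ([x' e'] & H2 & H3).
    injection H2 as -> -> ->. apply in_seq in H1. apply in_arcs in H3. split; [lia|auto].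
  - intros (H1 & H2). exists i. split; [apply in_seq; lia|]. apply in_map. apply in_arcs. auto.
Qed.

Lemma wedges_adj i x e : In (i, (x, e)) wedges -> i < d /\ adj es (nb i) x /\ In i (common x).
Proof.
  intros H. apply in_wedges in H as (H1 & H2 & H3).
  assert (adj es (nb i) x) by (apply adj_ed; rewrite <- H3; apply edge_in; auto).
  rewrite in_common. auto.
Qed.

(** Here [pre] is meant as a prefix of [wedges], the walks scanned so far; [occ pre x] is the part
    of [common x] discovered by them, in the same order. *)
Definition occ (pre : list (nat * (nat * nat))) (x : nat) : list nat :=
  map fst (filter (fun t => fst (snd t) =? x) pre).

Lemma occ_app l1 l2 x : occ (l1 ++ l2) x = occ l1 x ++ occ l2 x.
Proof. unfold occ. rewrite filter_app, map_app. reflexivity. Qed.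

Lemma occ_wedges x : occ wedges x = common x.
Proof.
  unfold wedges, common. generalize (seq 0 d) as l. induction l as [|i l IH]; [reflexivity|].
  cbn [flat_map filter]. rewrite occ_app, IH.
  assert (Hi : occ (map (pair i) (arcs (nb i))) x = if adjb (nb i) x then [i] else []).
  { unfold adjb. assert (ND := NoDup_nbrs (nb i)). unfold nbrs in *. clear IH.
    induction (arcs (nb i)) as [|[y e] l' IH]; [reflexivity|].
    cbn [map existsb fst] in *. apply NoDup_cons_iff in ND as [ND1 ND2]. unfold occ.
    cbn [map filter fst snd]. rewrite Nat.eqb_sym. destruct (Nat.eqb_spec x y) as [->|Hn].
    - cbn [map fst orb]. f_equal.
      change (occ (map (pair i) l') y = []). rewrite (IH ND2).
      destruct (existsb (Nat.eqb y) (map fst l')) eqn:Ex; auto.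
      apply existsb_exists in Ex as (z & Z1 & Z2). apply Nat.eqb_eq in Z2. subst. contradiction.
    - apply IH. auto. }
  rewrite Hi. destruct (adjb (nb i) x); reflexivity.
Qed.

Definition star (lab : nat -> nat) : list (nat * nat) :=
  map (fun i => (ne i, lab i)) (seq 0 d) ++
  flat_map (fun t => let '(i, (x, e)) := t in
     if is_sq x && negb (lab (opp i x) =? lab i) then [(e, lab (opp i x))] else []) wedges.

Section Star.

Context (lab : nat -> nat)
  (Hlab : forall i j, i < d -> j < d -> lab i = lab j <-> nrel i j).

Lemma lab_gen2 i j : i < d -> j < d -> gen2 i j -> lab i = lab j.
Proof. intros. apply Hlab; auto. apply gen2_nrel; auto. Qed.

Lemma lab_gen1 i j : i < d -> j < d -> gen1 i j -> lab i = lab j.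
Proof. intros. apply Hlab; auto. apply gen1_nrel; auto. Qed.

Lemma star_far_edge i x e : In (i, (x, e)) wedges -> is_sq x = true -> lab (opp i x) <> lab i ->
  opp i x < d /\ chordless_sq es v (nb i) x (nb (opp i x)) /\ edge e = ed (nb i) x /\ e < m.
Proof.
  intros H Hs Hl. assert (Hp := wedges_adj _ _ _ H). destruct Hp as (Hi & Ax & Ox).
  apply in_wedges in H as (_ & He & Ee).
  unfold is_sq in Hs. apply andb_true_iff in Hs as [Fx HL]. apply Nat.eqb_eq in HL.
  destruct (opp_spec i x HL Ox) as (O1 & O2 & _). apply in_common in O2 as [O2 O3].
  split; auto. split; auto. apply far_square; auto.
  intros Ha. apply Hl. symmetry. apply lab_gen1; auto.
Qed.

Lemma star_sound e k : In (e, k) (star lab) ->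
  e < m /\ inSv es v (edge e) /\
  exists i, i < d /\ lab i = k /\ dvstar es v (edge e) (ed v (nb i)).
Proof.
  unfold star. rewrite in_app_iff, in_map_iff, in_flat_map. intros [(i & H1 & H2)|([i [x e']] & H1 & H2)].
  - injection H1 as <- <-. apply in_seq in H2. destruct (ne_spec i ltac:(lia)) as [A1 A2].
    split; auto. rewrite A2. split.
    + split; [apply inEv; lia|]. left. apply incident_ed. auto.
    + exists i. split; [lia|]. split; auto. apply nrel_refl; lia.
  - destruct (is_sq x && negb (lab (opp i x) =? lab i)) eqn:B; [|contradiction].
    destruct H2 as [H2|[]]. injection H2 as -> <-.
    apply andb_true_iff in B as [B1 B2]. apply negb_true_iff, Nat.eqb_neq in B2.
    destruct (star_far_edge i x e H1 B1 B2) as (O & S1 & S2 & S3).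
    assert (S' := S1). destruct S1 as (ND & S4 & S5 & S6 & S7 & S8 & S9).
    repeat rewrite NoDup_cons_iff in ND. simpl in ND.
    assert (Hi := proj1 (wedges_adj _ _ _ H1)).
    split; auto. rewrite S2. split.
    + split; [apply adj_ed; auto|]. right. split; [apply adj_ed; auto|].
      split; [rewrite incident_ed; intuition|].
      exists (nb i), x, (nb (opp i x)). split; auto. split.
      * intros H. apply B2. symmetry. apply Hlab; auto.
      * left; auto.
    + exists (opp i x). split; auto. split; auto. apply t_step, dv_sym.
      apply nrel_opposite. unfold is_sq in B1. apply andb_true_iff in B1 as [B1 _].
      apply far_square; auto using adj_sym.
Qed.

(** If i and j carry different labels, no third position can lie in [common x], since [gen2] would
    give all of them one label. So every square on two unrelated edges at v is detected by
    [is_sq]. *)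
Lemma square_star i j x : i < d -> j < d -> lab i <> lab j -> 
  far x = true -> adj es (nb i) x -> adj es (nb j) x ->
  exists e, In (e, lab j) (star lab) /\ e < m /\ edge e = ed (nb i) x.
Proof.
  intros Hi Hj Hl Fx Ai Aj.
  assert (Oi : In i (common x)) by (apply in_common; auto).
  assert (Oj : In j (common x)) by (apply in_common; auto).
  assert (Hn : i <> j) by congruence.
  assert (HL : length (common x) = 2).
  { assert (length [i; j] <= length (common x)).
    { apply NoDup_incl_length.
      - repeat constructor; simpl; intuition congruence.
      - intros z [<-|[<-|[]]]; auto. }
    simpl in H. destruct (le_lt_dec 3 (length (common x))) as [L|L]; [|lia].
    exfalso. apply Hl. apply lab_gen2; auto. exists x. auto. }
  assert (Ho : opp i x = j) by (apply opp_eq; auto).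
  apply adj_ed, edge_surj in Ai as (e & He & Ee). exists e. split; auto.
  unfold star. rewrite in_app_iff. right. apply in_flat_map. exists (i, (x, e)). split.
  - apply in_wedges. auto.
  - unfold is_sq. rewrite Fx, HL, Ho. simpl.
    destruct (Nat.eqb_spec (lab j) (lab i)); [congruence|]. left; auto.
Qed.

Lemma star_complete e : e < m -> inSv es v (edge e) -> exists k, In (e, k) (star lab).
Proof.
  intros He [Hin [Hv|Hv]].
  - destruct (incident_Ev (edge e) Hin Hv) as (i & Hi & Ei). exists (lab i). unfold star.
    rewrite in_app_iff. left. apply in_map_iff. exists i. split; [|apply in_seq; lia].
    f_equal. destruct (ne_spec i Hi) as [A1 A2]. apply edge_inj; auto. congruence.
  - destruct Hv as (_ & Hv & u & x & w & Hs & Hd & Hg).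
    assert (Hs' := Hs). destruct Hs as (ND & A1 & A2 & A3 & A4 & A5 & A6).
    destruct (nb_surj u A1) as (i & Hi & <-). destruct (nb_surj w (adj_sym _ _ _ A4)) as (j & Hj & <-).
    assert (Hl : lab i <> lab j) by (intros H; apply Hd; apply Hlab in H; auto).
    assert (Fx : far x = true).
    { apply far_spec. split; auto. repeat rewrite NoDup_cons_iff in ND. simpl in ND. intuition. }
    destruct Hg as [Hg|Hg].
    + destruct (square_star i j x) as (e' & H1 & H2 & H3); auto using adj_sym.
      exists (lab j). replace e with e'; auto. apply edge_inj; auto. congruence.
    + destruct (square_star j i x) as (e' & H1 & H2 & H3); auto using adj_sym.
      exists (lab i). replace e with e'; auto. apply edge_inj; auto. rewrite H3, Hg. apply ed_sym.
Qed.

Lemma star_dS e f k l : In (e, k) (star lab) -> In (f, l) (star lab) ->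
  dS es v (edge e) (edge f) <-> k = l.
Proof.
  intros He Hf. destruct (star_sound e k He) as (_ & Se & i & Hi & <- & Di).
  destruct (star_sound f l Hf) as (_ & Sf & j & Hj & <- & Dj). split.
  - intros (H & _ & _). apply Hlab; auto.
    eapply dvstar_trans; [apply dvstar_sym; exact Di|]. eapply dvstar_trans; eauto.
  - intros H. apply Hlab in H; auto. split; auto.
    eapply dvstar_trans; [exact Di|]. eapply dvstar_trans; [exact H|]. apply dvstar_sym; auto.
Qed.

(** Let p be [nb j]. If i and j have one class, the edge vp itself serves. Otherwise the two edges
    are unrelated, hence span a square with far top, and its edge at p opposite to v [nb i] has the
    class of i. *)
Lemma star_parent p i : adj es v p -> i < d ->
  exists e, In (e, lab i) (star lab) /\ e < m /\ incident p (edge e).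
Proof.
  intros Hp Hi. destruct (nb_surj p Hp) as (j & Hj & <-).
  destruct (Nat.eq_dec (lab i) (lab j)) as [H|H].
  - exists (ne j). destruct (ne_spec j Hj) as [A1 A2]. split; [|split; auto].
    + unfold star. apply in_app_iff. left. apply in_map_iff. exists j. rewrite H.
      split; auto. apply in_seq; lia.
    + rewrite A2. apply incident_ed. auto.
  - assert (Hn : i <> j) by congruence.
    destruct (existsb (fun x => far x && adjb (nb j) x) (nbrs (nb i))) eqn:Ex.
    + apply existsb_exists in Ex as (x & X1 & X2). apply in_nbrs in X1.
      apply andb_true_iff in X2 as [X2 X3]. apply adjb_spec in X3.
      destruct (square_star j i x) as (e & S1 & S2 & S3); auto.
      exists e. split; auto. split; auto. rewrite S3. apply incident_ed. auto.
    + exfalso. apply H. apply Hlab; auto. apply nrel_direct; auto.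
      intros (x & H1 & H2 & H3 & H4 & H5 & H6).
      apply not_true_iff_false in Ex. apply Ex. apply existsb_exists. exists x.
      rewrite in_nbrs, andb_true_iff, far_spec, adjb_spec. auto.
Qed.

End Star.
End Local.
End Graph.

(** * Program logic with tick counting *)

(** Modified variables and arrays are read off the syntax, so most frame conditions are proved by
    [reflexivity]. *)
Fixpoint modv (c : cmd) (x : var) : bool :=
  match c with
  | Skip | Store _ _ _ => false
  | Assign y _ => var_beq x y
  | Seq c1 c2 | If _ c1 c2 => modv c1 x || modv c2 x
  | While _ c => modv c x
  end.

Fixpoint moda (c : cmd) (j : arr) : bool :=
  match c with
  | Skip | Assign _ _ => false
  | Store j' _ _ => arr_beq j j'
  | Seq c1 c2 | If _ c1 c2 => moda c1 j || moda c2 j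
  | While _ c => moda c j
  end.

Definition fr (c : cmd) (s s' : st) : Prop :=
  (forall x, modv c x = false -> sv s' x = sv s x) /\
  (forall j, moda c j = false -> sa s' j = sa s j).

Definition For (i y : var) (c : cmd) : cmd :=
  Seq (Assign i (Ct 0)) (While (Lt (Va i) (Va y)) (Seq c (Assign i (Pl (Va i) 1)))).

Definition Chain (p : var) (e : expr) (c : cmd) : cmd :=
  Seq (Assign p e) (While (Lt (Ct 0) (Va p)) (Seq c (Assign p (Rd aNX (Va p))))).

Fixpoint chain (B : nat) (nx to ei : nat -> nat) (p : nat) (l : list (nat * nat)) : Prop :=
  match l with
  | [] => p = 0
  | (u, e) :: l => 0 < p <= B /\ to p = u /\ ei p = e /\ chain B nx to ei (nx p) l
  end.

Ltac sx := cbn [sv sa setv seta ev evb eok bok valid var_beq arr_beq].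
Ltac sxin H := cbn [sv sa setv seta ev evb eok bok valid var_beq arr_beq] in H.

Section Rules.

Context (IB B0 : nat).
Notation wp := (wp IB B0).
Notation exec := (exec IB B0).

Lemma wp_skip Q s : Q 0 s -> wp Skip Q s.
Proof. intros H. exists 0, s. split; auto. constructor. Qed.

Lemma wp_assign x e Q s : eok IB B0 e s -> Q 1 (setv s x (ev e s)) -> wp (Assign x e) Q s.
Proof. intros H1 H2. exists 1, (setv s x (ev e s)). split; auto. constructor. auto. Qed.

Lemma wp_store j e1 e2 Q s : eok IB B0 e1 s -> eok IB B0 e2 s -> valid IB B0 j (ev e1 s) ->
  Q 1 (seta s j (ev e1 s) (ev e2 s)) -> wp (Store j e1 e2) Q s.
Proof. intros H1 H2 H3 H4. eexists _, _. split; [|exact H4]. constructor; auto. Qed.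

Lemma wp_seq c1 c2 Q s :
  wp c1 (fun t1 s1 => wp c2 (fun t2 s2 => Q (t1 + t2) s2) s1) s -> wp (Seq c1 c2) Q s.
Proof.
  intros (t1 & s1 & E1 & t2 & s2 & E2 & H). eexists _, _. split; [|exact H].
  econstructor; eauto.
Qed.

Lemma wp_if b c1 c2 Q s : bok IB B0 b s ->
  (evb b s = true -> wp c1 (fun t s' => Q (S t) s') s) ->
  (evb b s = false -> wp c2 (fun t s' => Q (S t) s') s) -> wp (If b c1 c2) Q s.
Proof.
  intros Hb H1 H2. destruct (evb b s) eqn:Eb.
  - destruct (H1 eq_refl) as (t & s' & Ex & HQ). exists (S t), s'. split; auto.
    constructor; auto. rewrite Eb. auto.
  - destruct (H2 eq_refl) as (t & s' & Ex & HQ). exists (S t), s'. split; auto.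
    constructor; auto. rewrite Eb. auto.
Qed.

Lemma wp_eq e1 e2 c1 c2 Q s : eok IB B0 e1 s -> eok IB B0 e2 s ->
  (ev e1 s = ev e2 s -> wp c1 (fun t s' => Q (S t) s') s) ->
  (ev e1 s <> ev e2 s -> wp c2 (fun t s' => Q (S t) s') s) -> wp (If (Eq e1 e2) c1 c2) Q s.
Proof.
  intros O1 O2 H1 H2. apply wp_if; [split; auto| |]; simpl; intros H.
  - apply H1. now apply Nat.eqb_eq.
  - apply H2. now apply Nat.eqb_neq.
Qed.

Lemma wp_lt e1 e2 c1 c2 Q s : eok IB B0 e1 s -> eok IB B0 e2 s ->
  (ev e1 s < ev e2 s -> wp c1 (fun t s' => Q (S t) s') s) ->
  (ev e2 s <= ev e1 s -> wp c2 (fun t s' => Q (S t) s') s) -> wp (If (Lt e1 e2) c1 c2) Q s.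
Proof.
  intros O1 O2 H1 H2. apply wp_if; [split; auto| |]; simpl; intros H.
  - apply H1. now apply Nat.ltb_lt.
  - apply H2. now apply Nat.ltb_ge.
Qed.

Lemma exec_fr c s t s' : exec c s t s' -> fr c s s'.
Proof.
  induction 1 as [s|x e s Hok|j e1 e2 s O1 O2 Hv|c1 c2 s t1 s1 t2 s2 E1 IH1 E2 IH2
    |b c1 c2 s t s' Hok E1 IH1|b c s Hok Hf|b c s t1 s1 t2 s2 Hok Ht E1 IH1 E2 IH2];
    try (split; reflexivity).
  - split; simpl; auto. intros y Hy. rewrite Hy. auto.
  - split; simpl; auto. intros j' Hj. rewrite Hj. auto.
  - split; simpl; intros y Hy; apply orb_false_iff in Hy as [Y1 Y2].
    + rewrite (proj1 IH2), (proj1 IH1); auto.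
    + rewrite (proj2 IH2), (proj2 IH1); auto.
  - split; simpl; intros y Hy; apply orb_false_iff in Hy as [Y1 Y2]; destruct (evb b s);
      apply IH1; auto.
  - split; simpl; intros y Hy.
    + rewrite (proj1 IH2), (proj1 IH1); auto.
    + rewrite (proj2 IH2), (proj2 IH1); auto.
Qed.

Lemma wp_conseq c (Q Q' : nat -> st -> Prop) s :
  wp c Q s -> (forall t s', fr c s s' -> Q t s' -> Q' t s') -> wp c Q' s.
Proof.
  intros (t & s' & Ex & HQ) H. exists t, s'. split; auto. apply H; auto.
  eapply exec_fr; eauto.
Qed.

Lemma wp_fr c (Q : nat -> st -> Prop) s :
  wp c (fun t s' => fr c s s' -> Q t s') s -> wp c Q s.
Proof. intros H. eapply wp_conseq; [exact H|]. auto. Qed.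

Lemma fr_refl c s : fr c s s.
Proof. split; auto. Qed.

Lemma fr_trans c s1 s2 s3 : fr c s1 s2 -> fr c s2 s3 -> fr c s1 s3.
Proof.
  intros [A1 A2] [B1 B2]. split; intros.
  - rewrite B1, A1; auto.
  - rewrite B2, A2; auto.
Qed.

Lemma fr_weaken c c' s s' : (forall x, modv c' x = false -> modv c x = false) ->
  (forall j, moda c' j = false -> moda c j = false) -> fr c s s' -> fr c' s s'.
Proof. intros H1 H2 [F1 F2]. split; auto. Qed.

Lemma fr_setv c s s' x a : modv c x = true -> fr c s s' -> fr c s (setv s' x a).
Proof.
  intros H [F1 F2]. split; auto. intros y Hy. simpl. destruct (var_beq y x) eqn:Exy; auto.
  apply var_beq_true in Exy. congruence.
Qed.

(* Loops carry a potential: the body may spend [b] ticks plus whatever [Phi] releases. *)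
Lemma wp_for i y c (Phi : nat -> st -> nat) b (I : nat -> st -> Prop) Q s :
  var_beq y i = false -> modv c i = false -> modv c y = false ->
  I 0 (setv s i 0) ->
  (forall k s1, k < sv s y -> sv s1 i = k -> sv s1 y = sv s y -> fr (For i y c) s s1 ->
    I k s1 -> wp c (fun t s2 => t + Phi (S k) (setv s2 i (S k)) <= b + Phi k s1 /\
                                I (S k) (setv s2 i (S k))) s1) ->
  (forall T s1, sv s1 i = sv s y -> fr (For i y c) s s1 -> I (sv s y) s1 ->
     T + Phi (sv s y) s1 <= sv s y * (b + 2) + 2 + Phi 0 (setv s i 0) -> Q T s1) ->
  wp (For i y c) Q s.
Proof.
  intros Hyi Hci Hcy H0 Hstep Hend.
  assert (Hyi' : y <> i) by (intros ->; rewrite var_beq_refl in Hyi; discriminate).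
  set (W := While (Lt (Va i) (Va y)) (Seq c (Assign i (Pl (Va i) 1)))).
  (* Induction on the number r of rounds left; [T0] collects the ticks already spent, so the
     potential is balanced round by round. *)
  assert (X : forall r k s1 T0, r + k = sv s y -> sv s1 i = k -> sv s1 y = sv s y ->
    fr (For i y c) s s1 -> I k s1 ->
    T0 + Phi k s1 <= k * (b + 2) + 1 + Phi 0 (setv s i 0) ->
    exists t s2, exec W s1 t s2 /\ Q (T0 + t) s2).
  { induction r as [|r IH]; intros k s1 T0 Hr Hi Hy Hf HI HT.
    - exists 1, s1. split.
      + apply ex_while_end; [split; exact Logic.I|]. simpl. apply Nat.ltb_ge. lia.
      + apply Hend; auto; [lia| |]; replace (sv s y) with k by lia; auto. lia.
    - destruct (Hstep k s1 ltac:(lia) Hi Hy Hf HI) as (t & s2 & Ex & Ht & HI2).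
      assert (Fr := exec_fr _ _ _ _ Ex). destruct Fr as [F1 F2].
      set (s3 := setv s2 i (S k)) in *.
      assert (E3 : exec (Seq c (Assign i (Pl (Va i) 1))) s1 (t + 1) s3).
      { econstructor; [exact Ex|]. unfold s3. replace (S k) with (ev (Pl (Va i) 1) s2).
        - constructor. simpl. auto.
        - simpl. rewrite F1 by auto. lia. }
      destruct (IH (S k) s3 (T0 + t + 2)) as (t' & s4 & E4 & HQ); auto; try lia.
      + unfold s3. simpl. rewrite var_beq_refl. auto.
      + unfold s3. simpl. rewrite Hyi. rewrite F1; auto.
      + eapply fr_trans; [exact Hf|]. unfold s3, For. split; simpl.
        * intros x Hx. apply orb_false_iff in Hx as [Hx1 Hx2]. apply orb_false_iff in Hx2 as [Hx2 _].
          rewrite Hx1. apply F1; auto.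
        * intros j Hj. apply orb_false_iff in Hj as [Hj _]. apply F2; auto.
      + exists (S ((t + 1) + t')), s4. split.
        * apply ex_while_step with s3; auto; [split; exact Logic.I|]. simpl. apply Nat.ltb_lt. lia.
        * replace (T0 + S (t + 1 + t')) with (T0 + t + 2 + t') by lia. auto. }
  destruct (X (sv s y) 0 (setv s i 0) 1) as (t & s2 & Ex & HQ); auto; try lia.
  - simpl. rewrite var_beq_refl. auto.
  - simpl. rewrite Hyi. auto.
  - split; simpl; auto. intros x Hx. apply orb_false_iff in Hx as [Hx _]. rewrite Hx. auto.
  - exists (1 + t), s2. split; auto. econstructor; [|exact Ex].
    change (setv s i 0) with (setv s i (ev (Ct 0) s)). constructor. exact Logic.I.
Qed.

(** The list is taken from the state at entry and stays valid because the body leaves [aNX], [aTO]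
    and [aEI] alone. The invariant may not depend on the cursor p. *)
Lemma wp_chain B p e c l (Phi : st -> nat) b (I : list (nat * nat) -> st -> Prop) Q s :
  B <= IB -> modv c p = false -> moda c aNX = false -> moda c aTO = false ->
  moda c aEI = false -> eok IB B0 e s ->
  chain B (sa s aNX) (sa s aTO) (sa s aEI) (ev e s) l ->
  (forall s a, Phi (setv s p a) = Phi s) ->
  (forall l s a, I l s -> I l (setv s p a)) ->
  I [] s ->
  (forall dn u f rest s1, l = dn ++ (u, f) :: rest ->
    sa s1 aTO (sv s1 p) = u -> sa s1 aEI (sv s1 p) = f -> sv s1 p <= B ->
    fr (Chain p e c) s s1 -> I dn s1 ->
    wp c (fun t s2 => t + Phi s2 <= b + Phi s1 /\ I (dn ++ [(u, f)]) s2) s1) ->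
  (forall T s1, fr (Chain p e c) s s1 -> I l s1 ->
     T + Phi s1 <= length l * (b + 2) + 2 + Phi s -> Q T s1) ->
  wp (Chain p e c) Q s.
Proof.
  intros HB Hp Hn Ht He Hok Hch HPhi HI H0 Hstep Hend.
  set (W := While (Lt (Ct 0) (Va p)) (Seq c (Assign p (Rd aNX (Va p))))).
  assert (X : forall r dn s1 T0, l = dn ++ r ->
    chain B (sa s aNX) (sa s aTO) (sa s aEI) (sv s1 p) r ->
    fr (Chain p e c) s s1 -> I dn s1 ->
    T0 + Phi s1 <= length dn * (b + 2) + 1 + Phi s ->
    exists t s2, exec W s1 t s2 /\ Q (T0 + t) s2).
  { induction r as [|[u f] r IH]; intros dn s1 T0 Hl Hc Hf HI1 HT.
    - rewrite app_nil_r in Hl. subst dn. simpl in Hc. exists 1, s1. split.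
      + apply ex_while_end; [split; exact Logic.I|]. simpl. apply Nat.ltb_ge. lia.
      + apply Hend; auto. lia.
    - simpl in Hc. destruct Hc as (Hb & C1 & C2 & C3).
      assert (F' : forall j, moda c j = false -> sa s1 j = sa s j).
      { intros j Hj. apply Hf. simpl. rewrite Hj. auto. }
      destruct (Hstep dn u f r s1 Hl) as (t & s2 & Ex & Ht' & HI2); auto; try lia.
      { rewrite F'; auto. } { rewrite F'; auto. }
      assert (Fr := exec_fr _ _ _ _ Ex). destruct Fr as [F1 F2].
      set (s3 := setv s2 p (sa s aNX (sv s1 p))) in *.
      assert (E3 : exec (Seq c (Assign p (Rd aNX (Va p)))) s1 (t + 1) s3).
      { econstructor; [exact Ex|]. unfold s3.
        replace (sa s aNX (sv s1 p)) with (ev (Rd aNX (Va p)) s2).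
        - constructor. simpl. split; auto. rewrite F1; auto. lia.
        - simpl. rewrite F1, F2, F'; auto. }
      destruct (IH (dn ++ [(u, f)]) s3 (T0 + t + 2)) as (t' & s4 & E4 & HQ).
      + rewrite Hl, <- app_assoc. reflexivity.
      + unfold s3. simpl. rewrite var_beq_refl. auto.
      + eapply fr_trans; [exact Hf|]. unfold s3, Chain. split; simpl.
        * intros x Hx. apply orb_false_iff in Hx as [Hx1 Hx2]. apply orb_false_iff in Hx2 as [Hx2 _].
          rewrite Hx1. apply F1; auto.
        * intros j Hj. apply orb_false_iff in Hj as [Hj _]. apply F2; auto.
      + apply HI. auto.
      + unfold s3. rewrite HPhi, length_app. simpl. lia.
      + exists (S ((t + 1) + t')), s4. split.
        * apply ex_while_step with s3; auto; [split; exact Logic.I|]. simpl. apply Nat.ltb_lt. lia.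
        * replace (T0 + S (t + 1 + t')) with (T0 + t + 2 + t') by lia. auto. }
  destruct (X l [] (setv s p (ev e s)) 1) as (t & s2 & Ex & HQ); auto.
  - simpl. rewrite var_beq_refl. auto.
  - split; simpl; auto. intros x Hx. apply orb_false_iff in Hx as [Hx _]. rewrite Hx. auto.
  - rewrite HPhi. simpl. lia.
  - exists (1 + t), s2. split; auto. econstructor; [|exact Ex]. constructor. auto.
Qed.

End Rules.

(** * Counting the distinct labels in use, the source of both potentials *)

Definition dcount (P : nat -> bool) (f : nat -> nat) (k : nat) : nat :=
  length (nodup Nat.eq_dec (filter P (map f (seq 0 k)))).

Lemma in_img P f k c :
  In c (nodup Nat.eq_dec (filter P (map f (seq 0 k)))) <-> P c = true /\ exists i, i < k /\ f i = c.
Proof.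
  rewrite nodup_In, filter_In, in_map_iff. split.
  - intros [(i & H1 & H2) H3]. apply in_seq in H2. split; auto. exists i. split; auto; lia.
  - intros [H1 (i & H2 & H3)]. split; auto. exists i. split; auto. apply in_seq. lia.
Qed.

Lemma dcount_le P f k l : (forall i, i < k -> P (f i) = true -> In (f i) l) ->
  dcount P f k <= length l.
Proof.
  intros H. apply NoDup_incl_length; [apply NoDup_nodup|]. intros c Hc.
  apply in_img in Hc as (H1 & i & H2 & <-). auto.
Qed.

Lemma dcount_incl P f g k : (forall i, i < k -> P (g i) = true -> exists j, j < k /\ f j = g i) ->
  dcount P g k <= dcount P f k.
Proof.
  intros H. apply dcount_le. intros i Hi HP. apply in_img. auto.
Qed.

(** The value a disappears and b was present before, so no new value makes up for the loss. *)
Lemma dcount_merge P f g k a b : a <> b -> P a = true ->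
  (exists i, i < k /\ f i = a) -> (exists i, i < k /\ f i = b) ->
  (forall i, i < k -> g i = if f i =? a then b else f i) ->
  dcount P g k + 1 <= dcount P f k.
Proof.
  intros Hab HP Ha Hb Hg.
  set (l := nodup Nat.eq_dec (filter P (map f (seq 0 k)))).
  assert (Ia : In a l) by (apply in_img; auto).
  assert (ND : NoDup l) by apply NoDup_nodup.
  apply in_split in Ia as (l1 & l2 & El).
  assert (HL : dcount P f k = length (l1 ++ l2) + 1).
  { change (dcount P f k) with (length l). rewrite El, !length_app. simpl. lia. }
  rewrite HL. apply Nat.add_le_mono_r. apply dcount_le. intros i Hi HPi.
  assert (Hin : In (g i) l /\ g i <> a).
  { rewrite Hg by auto. rewrite Hg in HPi by auto. destruct (Nat.eqb_spec (f i) a).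
    - split; auto. apply in_img. auto.
    - split; auto. apply in_img. split; auto. exists i. auto. }
  destruct Hin as [Hin Hne]. rewrite El in Hin. apply in_app_iff in Hin.
  apply in_app_iff. simpl in Hin. intuition congruence.
Qed.

(** * The star at one vertex *)

(** The loop running through [wedges] in order, with the position in [vI], the end of the walk in
    [vX] and its second arc in [vQ]. *)
Definition For2 (body : cmd) : cmd :=
  For vI vD (Chain vQ (Rd aHD (Rd aNB (Va vI))) (Seq (Assign vX (Rd aTO (Va vQ))) body)).

Definition load_nbrs : cmd :=
  Seq (Assign vD (Ct 0))
  (Chain vQ (Rd aHD (Va vV))
    (Seq (Store aNB (Va vD) (Rd aTO (Va vQ)))
    (Seq (Store aNE (Va vD) (Rd aEI (Va vQ)))
         (Assign vD (Pl (Va vD) 1))))).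

(** Only the cells of vertices at the end of a walk are cleared, as clearing whole arrays would cost
    O(n) at each vertex. Positions are written after the clearing, which also hits neighbours of v.
    The nonzero mark at v keeps v from passing as far. *)
Definition mark_nbrs : cmd :=
  Seq (For2 (Seq (Store aKX (Va vX) (Ct 0)) (Store aPS (Va vX) (Ct 0))))
  (Seq (For vI vD (Store aPS (Rd aNB (Va vI)) (Pl (Va vI) 1)))
       (Store aPS (Va vV) (Pl (Va vD) 1))).

Definition count_common : cmd :=
  For2 (Seq (If (Eq (Rd aKX (Va vX)) (Ct 0)) (Store aF1 (Va vX) (Va vI)) Skip)
       (Seq (Store aFL (Va vX) (Va vI))
            (Store aKX (Va vX) (Pl (Rd aKX (Va vX)) 1)))).

Ltac ok := sx; repeat split; try (exact Logic.I); try lia.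
Ltac w1 := lazymatch goal with
 | |- wp _ _ (Seq _ _) _ _ => apply wp_seq
 | |- wp _ _ (Assign _ _) _ _ => apply wp_assign; [ok|]; sx
 | |- wp _ _ (Store _ _ _) _ _ => apply wp_store; [ok|ok|ok|]; sx
 | |- wp _ _ Skip _ _ => apply wp_skip; sx
 | |- wp _ _ (If (Eq _ _) _ _) _ _ => apply wp_eq; [ok|ok|sx; intros|sx; intros]
 | |- wp _ _ (If (Lt _ _) _ _) _ _ => apply wp_lt; [ok|ok|sx; intros|sx; intros]
 end.

Lemma seq_split k d : k < d -> seq 0 d = seq 0 k ++ k :: seq (S k) (d - S k).
Proof.
  intros H. replace d with (k + S (d - S k)) at 1 by lia. rewrite seq_app. reflexivity.
Qed.

Section Process.

Context (n : nat) (es : list Edge) (Hwf : wf_graph n es).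
Let m := length es.
Context (D : nat) (HD : forall u, u < n -> length (arcs es u) <= D).
Context (IB B0 : nat) (HIB : n + 2 * m + 2 <= IB).
Notation wp := (wp IB B0).

Definition Gr (s : st) : Prop :=
  sv s vN = n /\ sv s vM = m /\
  forall u, u < n -> chain (2 * m) (sa s aNX) (sa s aTO) (sa s aEI) (sa s aHD u) (arcs es u).

(** [gsafe], [lsafe], [esafe] and [ssafe] are boolean tests on the syntax of a command, guaranteeing
    that growing portions of the state survive it. *)
Definition gsafe (c : cmd) : bool :=
  negb (modv c vN || modv c vM || moda c aNX || moda c aTO || moda c aEI || moda c aHD).

Lemma Gr_fr c s s' : gsafe c = true -> fr c s s' -> Gr s -> Gr s'.
Proof.
  unfold gsafe. rewrite negb_true_iff, !orb_false_iff. intros H [F1 F2] (G1 & G2 & G3).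
  unfold Gr. rewrite !F1, !F2 by tauto. auto.
Qed.

Context (v : nat) (Hv : v < n).
Let d := length (arcs es v).
Notation nb := (nb es v).
Notation ne := (ne es v).
Notation wedges := (wedges es v).
Notation common := (common es v).
Notation far := (far es v).

Lemma d_le_D : d <= D. Proof. apply HD. auto. Qed.
Lemma d_le_n : d <= n. Proof. apply (length_arcs_le n es Hwf). Qed.

Lemma nb_lt i : i < d -> nb i < n.
Proof. intros H. apply (nb_adj n es Hwf) in H. apply (adj_lt n es Hwf) in H. tauto. Qed.

Lemma wedges_lt i x e : In (i, (x, e)) wedges -> i < d /\ x < n /\ e < m.
Proof.
  intros H. assert (X := wedges_adj n es Hwf v _ _ _ H). apply (in_wedges n es Hwf) in H.
  destruct X as (X1 & X2 & _). apply (adj_lt n es Hwf) in X2. split; auto. split; [tauto|apply H].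
Qed.

Definition Loc (s : st) : Prop :=
  Gr s /\ sv s vV = v /\ sv s vD = d /\
  forall i, i < d -> sa s aNB i = nb i /\ sa s aNE i = ne i.

Definition lsafe (c : cmd) : bool :=
  gsafe c && negb (modv c vV || modv c vD || moda c aNB || moda c aNE).

Lemma Loc_fr c s s' : lsafe c = true -> fr c s s' -> Loc s -> Loc s'.
Proof.
  unfold lsafe. rewrite andb_true_iff, negb_true_iff, !orb_false_iff.
  intros [Hg H] F (L1 & L2 & L3 & L4). assert (G := Gr_fr c s s' Hg F L1).
  destruct F as [F1 F2]. unfold Loc. rewrite !F1, !F2 by tauto. auto.
Qed.

Definition loopvar (x : var) : Prop := x = vI \/ x = vQ \/ x = vX.

Lemma wp_for2 (Phi : st -> nat) b (I : list (nat * (nat * nat)) -> st -> Prop) body Q s :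
  lsafe body = true -> modv body vI = false -> modv body vQ = false ->
  Loc s ->
  (forall x a s, loopvar x -> Phi (setv s x a) = Phi s) ->
  (forall l s x a, loopvar x -> I l s -> I l (setv s x a)) ->
  I [] s ->
  (forall dn i x e rest s1, wedges = dn ++ (i, (x, e)) :: rest ->
     sv s1 vI = i -> sv s1 vX = x -> sa s1 aEI (sv s1 vQ) = e -> sv s1 vQ <= 2 * m ->
     fr (For2 body) s s1 -> Loc s1 -> I dn s1 ->
     wp body (fun t s2 => t + Phi s2 <= b + Phi s1 /\ I (dn ++ [(i, (x, e))]) s2) s1) ->
  (forall T s1, fr (For2 body) s s1 -> Loc s1 -> I wedges s1 ->
     T + Phi s1 <= d * (D * (b + 3) + 4) + 2 + Phi s -> Q T s1) ->
  wp (For2 body) Q s.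
Proof.
  intros Hb HbI HbQ HL HPhi HI H0 Hstep Hend.
  assert (Hls : lsafe (For2 body) = true /\ modv (For2 body) vD = false).
  { unfold lsafe, gsafe in *. simpl. rewrite !andb_true_iff, !negb_true_iff, !orb_false_iff in *.
    simpl. tauto. }
  destruct Hls as [Hls HbD].
  set (pk k := flat_map (fun i => map (pair i) (arcs es (nb i))) (seq 0 k)).
  assert (HbD' : modv body vD = false /\ moda body aNX = false /\ moda body aTO = false /\
    moda body aEI = false).
  { unfold lsafe, gsafe in *. rewrite !andb_true_iff, !negb_true_iff, !orb_false_iff in *. tauto. }
  destruct HbD' as (HbD' & HbX & HbT & HbE).
  (* Per walk, one tick sets [vX] and two drive the chain, hence [b + 3]; there are at most D arcs,
     and entering and leaving the chain costs 2. *)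
  unfold For2. apply wp_for with (Phi := fun _ => Phi) (b := D * (b + 3) + 2) (I := fun k => I (pk k));
    simpl; rewrite ?orb_false_r; auto.
  - apply HI; auto. left; auto.
  - intros k s1 Hk Hi Hy Hf HIk.
    assert (HL1 : Loc s1) by (eapply Loc_fr; [|exact Hf|]; auto).
    assert (Hk' : k < d) by (destruct HL as (_ & _ & <- & _); auto).
    assert (Hnb : nb k < n) by (apply nb_lt; auto).
    assert (ENB : sa s1 aNB k = nb k) by (apply HL1; auto).
    assert (Hdn := d_le_n).
    apply wp_chain with (B := 2 * m) (l := arcs es (nb k)) (Phi := Phi) (b := b + 1)
      (I := fun dn s => I (pk k ++ map (pair k) dn) s /\ sv s vI = k); simpl; auto; try lia.
    + rewrite Hi, ENB. repeat split; lia.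
    + rewrite Hi, ENB. apply HL1. auto.
    + intros s0 a. apply HPhi. right; left; auto.
    + intros l s0 a [HIl Hl]. split; auto. apply HI; auto. right; left; auto.
    + rewrite app_nil_r. auto.
    + intros dn u f rest s2 Hl HTO HEI HQ Hf2 [HIs Hi2].
      assert (HL2 : Loc s2).
      { eapply Loc_fr; [|exact Hf2|]; auto. unfold lsafe, gsafe in *. simpl.
        rewrite !andb_true_iff, !negb_true_iff, !orb_false_iff in *. simpl. tauto. }
      apply wp_seq. apply wp_assign; [simpl; lia|]. simpl. rewrite HTO.
      eapply wp_conseq.
      * apply (Hstep (pk k ++ map (pair k) dn) k u f
          (map (pair k) rest ++ flat_map (fun i => map (pair i) (arcs es (nb i))) (seq (S k) (d - S k))));
          simpl; auto.
        -- unfold wedges, wedges. fold d. rewrite (seq_split k d Hk'), flat_map_app. fold (pk k).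
           cbn [flat_map]. rewrite Hl, map_app, <- !app_assoc. reflexivity.
        -- apply fr_setv; [simpl; rewrite ?orb_true_r; reflexivity|].
           eapply fr_trans; [exact Hf|]. eapply fr_weaken; [| |exact Hf2]; simpl; intros y;
             rewrite ?orb_false_iff; tauto.
        -- apply HI; auto. right; right; auto.
      * intros t s3 Hf3 [Ht HI3]. rewrite HPhi in Ht by (right; right; auto). split; [lia|].
        split; [rewrite map_app; cbn [map]; rewrite app_assoc; exact HI3|].
        rewrite (proj1 Hf3); auto.
    + intros T s2 Hf2 [HI2 Hi2] HT. rewrite HPhi by (left; auto).
      assert (HDk := HD _ Hnb). split.
      * enough (length (arcs es (nb k)) * (b + 1 + 2) <= D * (b + 3)) by lia. nia.
      * replace (pk (S k)) with (pk k ++ map (pair k) (arcs es (nb k))).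
        -- apply HI; auto. left; auto.
        -- unfold pk. rewrite seq_S, flat_map_app. simpl. rewrite app_nil_r. reflexivity.
  - intros T s1 Hi Hf HI1 HT. assert (Es : sv s vD = d) by apply HL. rewrite Es in *.
    rewrite HPhi in HT by (left; auto). apply Hend; auto.
    + eapply Loc_fr; [|exact Hf|]; auto.
    + lia.
Qed.

Lemma load_nbrs_ok Q s : Gr s -> sv s vV = v ->
  (forall T s', fr load_nbrs s s' -> Loc s' -> T <= 5 * d + 3 -> Q T s') -> wp load_nbrs Q s.
Proof.
  intros HG HV HQ. apply wp_fr. unfold load_nbrs. w1. w1. 
  assert (Hd := d_le_n). assert (HdD := d_le_D).
  apply wp_chain with (B := 2 * m) (l := arcs es v) (Phi := fun _ => 0) (b := 3)
    (I := fun dn s => sv s vD = length dn /\ forall i, i < length dn ->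
      sa s aNB i = fst (nth i dn (0, 0)) /\ sa s aNE i = snd (nth i dn (0, 0))); auto; try lia.
  - ok.
  - ok. rewrite HV. apply HG. auto.
  - split; [reflexivity|]. simpl. intros; lia.
  - intros dn u f rest s1 Hl HT HE HQ1 Hf (I1 & I2).
    assert (Hlen : length dn < d) by (unfold d; rewrite Hl, length_app; simpl; lia).
    w1. w1. w1. w1. w1. split; [lia|]. rewrite length_app. cbn [length]. split; [lia|].
    intros i Hi. rewrite !I1. destruct (Nat.eq_dec i (length dn)) as [->|Hn].
    + rewrite !upd_same. rewrite app_nth2, Nat.sub_diag by lia. auto.
    + rewrite !upd_other by auto. rewrite app_nth1 by lia. apply I2. lia.
  - intros T s1 Hf (I1 & I2) HT. cbv beta in HT. fold d in HT.
    intros Hf'. apply HQ; [exact Hf'| |nia]. split; [eapply Gr_fr; [|exact Hf'|]; auto|].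
    split; [rewrite (proj1 Hf') by reflexivity; auto|]. split; auto.
Qed.

(** The first clause is limited to ends of walks; elsewhere [aPS] may hold marks left by earlier
    vertices. *)
Definition PSok (s : st) : Prop :=
  (forall i x e, In (i, (x, e)) wedges -> (sa s aPS x = 0 <-> far x = true)) /\
  (forall i, i < d -> sa s aPS (nb i) = S i).

Lemma mark_nbrs_ok Q s : Loc s ->
  (forall T s', fr mark_nbrs s s' -> Loc s' -> PSok s' ->
     (forall i x e, In (i, (x, e)) wedges -> sa s' aKX x = 0) ->
     T <= d * (5 * D + 4) + 2 + (d * 3 + 2) + 1 -> Q T s') -> wp mark_nbrs Q s.
Proof.
  intros HL HQ. assert (Hd := d_le_n). assert (HdD := d_le_D).
  apply wp_fr. unfold mark_nbrs. w1.
  apply wp_for2 with (Phi := fun _ => 0) (b := 2)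
    (I := fun dn s => forall i x e, In (i, (x, e)) dn -> sa s aKX x = 0 /\ sa s aPS x = 0); auto.
  - intros ? ? ? [].
  - intros dn i x e rest s1 HP Hi Hx He HQ1 Hf HL1 HI.
    assert (Hin : In (i, (x, e)) wedges) by (rewrite HP; apply in_elt).
    assert (X := wedges_lt _ _ _ Hin).
    w1. w1. w1. split; [lia|]. rewrite Hx. intros i' x' e' H. apply in_app_iff in H.
    unfold upd. destruct (Nat.eqb_spec x' x); auto.
    destruct H as [H|[H|[]]]; [eauto|congruence].
  - intros T1 s1 Hf1 HL1 HI1 HT1. w1.
    apply wp_for with (Phi := fun _ _ => 0) (b := 1)
      (I := fun k s => (forall i, i < k -> sa s aPS (nb i) = S i) /\
        (forall x, (forall i, i < k -> nb i <> x) -> sa s aPS x = sa s1 aPS x)); auto.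
    + sx. split; auto; lia.
    + intros k s2 Hk Hi Hy Hf2 [I1 I2].
      assert (HL2 : Loc s2) by (eapply Loc_fr; [|exact Hf2|]; auto).
      assert (Es : sv s1 vD = d) by apply HL1. rewrite Es in Hk.
      assert (En : sa s2 aNB (sv s2 vI) = nb k) by (rewrite Hi; apply HL2; auto).
      assert (Hnb := nb_lt k Hk).
      w1. rewrite En. split; [lia|]. rewrite Hi. split.
      * intros i Hi'. unfold upd. destruct (Nat.eqb_spec (nb i) (nb k)) as [E|E].
        -- apply (nb_inj n es Hwf) in E; fold d; try lia.
        -- apply I1. assert (i <> k) by congruence. lia.
      * intros x Hx. rewrite upd_other by (intros ->; apply (Hx k); auto). apply I2.
        intros i Hi'. apply Hx. lia.
    + intros T2 s2 Hi2 Hf2 [I1 I2] HT2.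
      assert (HL2 : Loc s2) by (eapply Loc_fr; [|exact Hf2|]; auto).
      assert (Es : sv s1 vD = d) by apply HL1. rewrite Es in *.
      assert (EV : sv s2 vV = v) by apply HL2. assert (ED : sv s2 vD = d) by apply HL2.
      w1. rewrite EV, ED. intros Hf. apply HQ; auto; [| |nia].
      * split.
        -- intros i x e Hin. unfold PSok; sx; unfold upd. rewrite (far_spec n es Hwf).
           destruct (Nat.eqb_spec x v) as [->|Hxv]; [split; [intros; lia|tauto]|].
           destruct (adjb es v x) eqn:Ab.
           ++ apply (adjb_spec n es Hwf) in Ab. split; [|tauto]. intros H0. exfalso.
              destruct (nb_surj n es Hwf v x Ab) as (j & Hj & <-). rewrite I1 in H0 by auto. lia.
           ++ assert (Nab : ~ adj es v x) by (rewrite <- (adjb_spec n es Hwf); congruence).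
              split; [tauto|]. intros _. rewrite I2; [apply (HI1 i x e Hin)|].
              intros j Hj <-. apply Nab. apply (nb_adj n es Hwf). auto.
        -- intros i Hi. sx. unfold upd. destruct (Nat.eqb_spec (nb i) v) as [E|E]; auto.
           exfalso. assert (X := nb_adj n es Hwf v i Hi). rewrite E in X.
           apply (adj_irrefl n es Hwf) in X. auto.
      * intros i x e Hin. sx. rewrite (proj2 Hf2) by reflexivity. apply (HI1 i x e Hin).
Qed.

Definition OCok (s : st) : Prop :=
  forall i x e, In (i, (x, e)) wedges ->
    sa s aKX x = length (common x) /\ sa s aF1 x = hd 0 (common x) /\ sa s aFL x = last (common x) 0.

Lemma count_common_ok Q s : Loc s -> (forall i x e, In (i, (x, e)) wedges -> sa s aKX x = 0) ->
  (forall T s', fr count_common s s' -> Loc s' -> OCok s' -> T <= d * (7 * D + 4) + 2 -> Q T s') ->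
  wp count_common Q s.
Proof.
  intros HL H0 HQ. assert (Hd := d_le_n). assert (HdD := d_le_D). unfold count_common.
  apply wp_for2 with (Phi := fun _ => 0) (b := 4)
    (I := fun dn s => forall i x e, In (i, (x, e)) wedges ->
       sa s aKX x = length (occ dn x) /\ (occ dn x <> [] -> sa s aF1 x = hd 0 (occ dn x) /\
         sa s aFL x = last (occ dn x) 0)); auto.
  - intros i x e Hin. split; [apply (H0 _ _ _ Hin)|]. intros []. reflexivity.
  - intros dn i x e rest s1 HP Hi Hx He HQ1 Hf HL1 HI.
    assert (Hin : In (i, (x, e)) wedges) by (rewrite HP; apply in_elt).
    assert (X := wedges_lt _ _ _ Hin).
    destruct (HI _ _ _ Hin) as [K1 K2].
    assert (Ho : forall y, occ [(i, (x, e))] y = if x =? y then [i] else []).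
    { intros y. unfold occ. cbn [filter fst snd]. destruct (x =? y); reflexivity. }
    w1. w1.
    + w1. w1. w1. w1. split; [lia|]. rewrite Hx, Hi in *. intros i' y e' Hin'.
      rewrite occ_app, Ho, length_app. unfold upd. rewrite (Nat.eqb_sym y x).
      destruct (Nat.eqb_spec x y) as [<-|Hn].
      * rewrite K1 in H. destruct (occ dn x) as [|? ?]; [|simpl in H; lia].
        split; [rewrite K1; reflexivity|]. intros _. split; reflexivity.
      * rewrite app_nil_r, Nat.add_0_r. apply (HI _ _ _ Hin').
    + w1. w1. w1. w1. split; [lia|]. rewrite Hx, Hi in *. intros i' y e' Hin'.
      rewrite occ_app, Ho, length_app. unfold upd. rewrite (Nat.eqb_sym y x).
      destruct (Nat.eqb_spec x y) as [<-|Hn].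
      * rewrite K1 in H. split; [rewrite K1; reflexivity|]. intros _.
        destruct K2 as [K2 K3]; [intros K2; rewrite K2 in H; apply H; reflexivity|].
        rewrite last_last, K2. destruct (occ dn x); [exfalso; apply H|]; auto.
      * rewrite app_nil_r, Nat.add_0_r. apply (HI _ _ _ Hin').
  - intros T s1 Hf HL1 HI HT. apply HQ; auto; [|nia].
    intros i x e Hin. destruct (HI i x e Hin) as [K1 K2]. rewrite (occ_wedges n es Hwf) in K1, K2.
    split; auto. apply K2. assert (Y := wedges_adj n es Hwf v _ _ _ Hin).
    destruct Y as (_ & _ & Y). intros K. rewrite K in Y. contradiction.
Qed.

End Process.

(** * The classes of the local colouring *)

Definition relab (j : arr) (y : var) : cmd :=
  For vT y (If (Eq (Rd j (Va vT)) (Va vA1)) (Store j (Va vT) (Va vB1)) Skip).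

Definition union : cmd :=
  Seq (Assign vA1 (Rd aLB (Va vI)))
  (Seq (Assign vB1 (Rd aLB (Va vO)))
  (If (Eq (Va vA1) (Va vB1)) Skip (relab aLB vD))).

Definition set_opp : cmd :=
  If (Eq (Rd aF1 (Va vX)) (Va vI)) (Assign vO (Rd aFL (Va vX))) (Assign vO (Rd aF1 (Va vX))).

(** Joining each member of [common x] to the last one joins them all, at the cost of one union per
    walk. A single member is its own last one, and that union does nothing. *)
Definition union_stars : cmd :=
  For2 (If (Eq (Rd aPS (Va vX)) (Ct 0))
    (If (Eq (Rd aKX (Va vX)) (Ct 2)) Skip (Seq (Assign vO (Rd aFL (Va vX))) union))
    (If (Eq (Va vX) (Va vV)) Skip (Seq (Assign vO (Mi (Rd aPS (Va vX)) 1)) union))).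

Definition count_squares : cmd :=
  Chain vQ (Rd aHD (Rd aNB (Va vI)))
    (Seq (Assign vX (Rd aTO (Va vQ)))
      (If (Eq (Rd aPS (Va vX)) (Ct 0))
        (If (Eq (Rd aKX (Va vX)) (Ct 2))
          (Seq set_opp (Store aCT (Va vO) (Pl (Rd aCT (Va vO)) 1))) Skip)
        Skip)).

(** The counts are produced one row i at a time, in a reused array. A row costs O(d) for clearing
    and testing and O(Delta) for counting, so all pairs together stay within d Delta. *)
Definition union_pairs : cmd :=
  For vI vD
    (Seq (For vJ vD (Store aCT (Va vJ) (Ct 0)))
    (Seq count_squares
         (For vJ vD (If (Eq (Va vJ) (Va vI)) Skip
            (If (Eq (Rd aCT (Va vJ)) (Ct 1)) Skip (Seq (Assign vO (Va vJ)) union)))))).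

Definition local_classes : cmd :=
  Seq (For vI vD (Store aLB (Va vI) (Va vI))) (Seq union_stars union_pairs).

Section Process.

Context (n : nat) (es : list Edge) (Hwf : wf_graph n es).
Let m := length es.
Context (D : nat) (HD : forall u, u < n -> length (arcs es u) <= D).
Context (IB B0 : nat) (HIB : n + 2 * m + 2 <= IB).
Notation wp := (wp IB B0).

Lemma relab_ok j y Q s : j <> aLOW -> var_beq y vT = false -> sv s y <= IB ->
  (forall T s', fr (relab j y) s s' ->
    (forall t, t < sv s y ->
       sa s' j t = if sa s j t =? sv s vA1 then sv s vB1 else sa s j t) ->
    T <= sv s y * 4 + 2 -> Q T s') -> wp (relab j y) Q s.
Proof.
  intros Hj Hy HyI HQ.
  assert (Hval : forall i, i <= IB -> valid IB B0 j i) by (destruct j; simpl; auto; congruence).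
  unfold relab. apply wp_for with (Phi := fun _ _ => 0) (b := 2)
    (I := fun k s' => forall t, t < sv s y -> sa s' j t =
      if t <? k then (if sa s j t =? sv s vA1 then sv s vB1 else sa s j t) else sa s j t); auto.
  - intros k s1 Hk Hi Hy1 Hf HI.
    assert (E1 : sv s1 vA1 = sv s vA1) by (apply Hf; reflexivity).
    assert (E2 : sv s1 vB1 = sv s vB1) by (apply Hf; reflexivity).
    assert (Ek := HI k Hk). rewrite Nat.ltb_irrefl in Ek.
    apply wp_eq; [ok; apply Hval; lia|ok| |]; sx; intros H.
    + apply wp_store; [ok|ok|ok; apply Hval; lia|]. sx. rewrite arr_beq_refl. split; [lia|].
      intros t Ht. rewrite Hi, E2. rewrite Hi, Ek, E1 in H.
      destruct (Nat.eq_dec t k) as [->|Hn].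
      * rewrite upd_same. destruct (Nat.ltb_spec k (S k)); [|lia].
        apply Nat.eqb_eq in H. rewrite H. reflexivity.
      * rewrite upd_other by auto. rewrite HI by auto.
        destruct (Nat.ltb_spec t k), (Nat.ltb_spec t (S k)); auto; lia.
    + apply wp_skip. sx. split; [lia|]. rewrite Hi, Ek, E1 in H.
      intros t Ht. rewrite HI by auto.
      destruct (Nat.ltb_spec t k), (Nat.ltb_spec t (S k)); auto; try lia.
      replace t with k by lia. apply Nat.eqb_neq in H. rewrite H. reflexivity.
  - intros T s1 Hi Hf HI HT. apply HQ; auto; [|lia].
    intros t Ht. rewrite HI by auto. destruct (Nat.ltb_spec t (sv s y)); auto; lia.
Qed.

Context (v : nat) (Hv : v < n).
Let d := length (arcs es v).
Notation nb := (nb es v).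
Notation ne := (ne es v).
Notation wedges := (wedges es v).
Notation common := (common es v).
Notation far := (far es v).
Notation is_sq := (is_sq es v).
Notation opp := (opp es v).
Notation nrel := (nrel es v).
Notation Loc := (Loc n es v).

(* A union of two classes destroys a label, which pays for the scan of [aLB]. *)
Definition PhiL (s : st) : nat := (4 * d + 4) * dcount (fun _ => true) (sa s aLB) d.

Lemma union_ok i o Q s : sv s vI = i -> sv s vO = o -> sv s vD = d -> i < d -> o < d ->
  (forall T s', fr union s s' ->
    (forall t, t < d ->
       sa s' aLB t = if sa s aLB t =? sa s aLB i then sa s aLB o else sa s aLB t) ->
    T + PhiL s' <= 4 + PhiL s -> Q T s') -> wp union Q s.
Proof.
  intros Hi Ho Hd Hid Hod HQ. assert (Hn := d_le_n n es Hwf v : d <= n).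
  apply wp_fr.
  unfold union. w1. w1. w1. w1. rewrite Hi, Ho. w1.
  - w1. intros Hf. apply HQ; auto; [|unfold PhiL; sx; lia]. intros t Ht. sx.
    destruct (Nat.eqb_spec (sa s aLB t) (sa s aLB i)); congruence.
  - apply relab_ok; try discriminate; try reflexivity; sx; [lia|].
    intros T s' Hf H' HT. rewrite Hd in *. sxin H'.
    intros Hf'. apply HQ; [exact Hf'|exact H'|].
    assert (X : dcount (fun _ => true) (sa s' aLB) d + 1 <= dcount (fun _ => true) (sa s aLB) d).
    { apply dcount_merge with (sa s aLB i) (sa s aLB o); eauto. }
    unfold PhiL. nia.
Qed.

Definition Env (s : st) : Prop := Loc s /\ PSok es v s /\ OCok es v s.

Definition esafe (c : cmd) : bool :=
  lsafe c && negb (moda c aPS || moda c aKX || moda c aF1 || moda c aFL).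

Lemma Env_fr c s s' : esafe c = true -> fr c s s' -> Env s -> Env s'.
Proof.
  unfold esafe. rewrite andb_true_iff, negb_true_iff, !orb_false_iff.
  intros [Hl H] F (L & P & O). split; [eapply Loc_fr; eauto|].
  destruct F as [F1 F2]. unfold PSok, OCok in *. rewrite !F2 by tauto. auto.
Qed.

Lemma nrel_sym i j : nrel i j -> nrel j i.
Proof. apply dvstar_sym. Qed.

Lemma nrel_trans i j k : nrel i j -> nrel j k -> nrel i k.
Proof. apply dvstar_trans. Qed.

Definition sound (s : st) : Prop :=
  (forall i, i < d -> sa s aLB i < d) /\
  (forall i j, i < d -> j < d -> sa s aLB i = sa s aLB j -> nrel i j).

(** Unions only coarsen the partition, so an equality of labels, once achieved, persists; a label
    itself may change. *)
Definition le_lab (s s' : st) : Prop :=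
  forall i j, i < d -> j < d -> sa s aLB i = sa s aLB j -> sa s' aLB i = sa s' aLB j.

Lemma le_lab_trans s1 s2 s3 : le_lab s1 s2 -> le_lab s2 s3 -> le_lab s1 s3.
Proof. unfold le_lab; auto. Qed.

Lemma union_ok' i o Q s : Loc s -> sv s vI = i -> sv s vO = o -> i < d -> o < d ->
  nrel i o -> sound s ->
  (forall T s', fr union s s' -> sound s' -> le_lab s s' -> sa s' aLB i = sa s' aLB o ->
    T + PhiL s' <= 4 + PhiL s -> Q T s') -> wp union Q s.
Proof.
  intros HL Hi Ho Hid Hod HR [S1 S2] HQ.
  apply (union_ok i o); auto; [apply HL|].
  intros T s' Hf H HT. apply HQ; auto.
  - split.
    + intros t Ht. rewrite H by auto. destruct (_ =? _); auto.
    (* After the union each position carries the old label of a position related to it, which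
       reduces soundness to that of the old labels. *)
    + assert (W : forall a, a < d -> exists b, b < d /\ nrel a b /\ sa s' aLB a = sa s aLB b).
      { intros a Ha. rewrite H by auto. destruct (Nat.eqb_spec (sa s aLB a) (sa s aLB i)) as [e|e].
        - exists o. split; auto. split; auto. apply nrel_trans with i; auto.
        - exists a. split; auto. }
      intros a b Ha Hb E. destruct (W a Ha) as (a' & A1 & A2 & A3).
      destruct (W b Hb) as (b' & B1 & B2 & B3).
      apply nrel_trans with a'; auto. apply nrel_trans with b'; [|apply nrel_sym; auto].
      apply S2; auto. congruence.
  - intros a b Ha Hb E. rewrite !H by auto. rewrite E. reflexivity.
  - rewrite !H by auto. rewrite Nat.eqb_refl. destruct (_ =? _); auto.
Qed.

Lemma is_sq_test s i x e : Env s -> In (i, (x, e)) wedges ->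
  (sa s aPS x = 0 /\ sa s aKX x = 2 <-> is_sq x = true).
Proof.
  intros (_ & [P _] & O) Hin. rewrite (P _ _ _ Hin). rewrite (proj1 (O _ _ _ Hin)).
  unfold is_sq, is_sq. rewrite andb_true_iff, Nat.eqb_eq. reflexivity.
Qed.

Lemma set_opp_ok i x e Q s : Env s -> In (i, (x, e)) wedges -> sv s vI = i -> sv s vX = x ->
  Q 2 (setv s vO (opp i x)) -> wp set_opp Q s.
Proof.
  intros (HL & _ & O) Hin Hi Hx HQ. destruct (O _ _ _ Hin) as (_ & O1 & O2).
  assert (X := wedges_lt n es Hwf v _ _ _ Hin). unfold opp, opp in HQ.
  unfold set_opp. w1.
  - w1. rewrite Hx, Hi, O1 in H. apply Nat.eqb_eq in H. rewrite H in HQ.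
    rewrite Hx, O2. exact HQ.
  - w1. rewrite Hx, Hi, O1 in H. apply Nat.eqb_neq in H. rewrite H in HQ.
    rewrite Hx, O1. exact HQ.
Qed.

Lemma last_in (l : list nat) a : l <> [] -> In (last l a) l.
Proof.
  intros H. destruct (exists_last H) as (l' & x & ->). rewrite last_last.
  apply in_or_app. right; left; auto.
Qed.

Definition gens12 (s : st) : Prop :=
  (forall i j, i < d -> j < d -> gen1 es v i j -> sa s aLB i = sa s aLB j) /\
  (forall i j, i < d -> j < d -> gen2 es v i j -> sa s aLB i = sa s aLB j).

Lemma union_stars_ok Q s : Env s -> sound s ->
  (forall T s', fr union_stars s s' -> Env s' -> sound s' -> gens12 s' ->
     T + PhiL s' <= d * (D * 10 + 4) + 2 + PhiL s -> Q T s') -> wp union_stars Q s.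
Proof.
  intros HE HS HQ. assert (Hn := d_le_n n es Hwf v : d <= n). unfold union_stars.
  (* What the body achieves for one walk. It consists of label equalities only, so that [Mono]
     carries it through the later unions. *)
  set (done_ok := fun (s : st) (t : nat * (nat * nat)) => let '(i, (x, e)) := t in
    (forall j, j < d -> x = nb j -> sa s aLB i = sa s aLB j) /\
    (far x = true -> length (common x) <> 2 -> sa s aLB i = sa s aLB (last (common x) 0))).
  assert (Mono : forall s1 s2 dn, incl dn wedges -> le_lab s1 s2 ->
    (forall t, In t dn -> done_ok s1 t) -> forall t, In t dn -> done_ok s2 t).
  { intros s1 s2 dn Hincl Hle H [i [x e]] Hin. specialize (H _ Hin). simpl in *.
    assert (Y := wedges_adj n es Hwf v _ _ _ (Hincl _ Hin)). destruct Y as (Y1 & Y2 & Y3).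
    split.
    - intros j Hj Hx. apply Hle; auto. apply H; auto.
    - intros F L. apply Hle; auto; [|apply H; auto].
      assert (Z : In (last (common x) 0) (common x)) by (apply last_in; intros E; rewrite E in Y3; contradiction).
      apply (in_common n es Hwf) in Z. apply Z. }
  apply wp_for2 with (n := n) (es := es) (D := D) (v := v) (Phi := PhiL) (b := 7)
    (I := fun dn s => sound s /\ forall t, In t dn -> done_ok s t); auto.
  - apply HE.
  - split; auto. intros ? [].
  - intros dn i x e rest s1 HP Hi Hx He HQ1 Hf HL1 [HS1 HI].
    assert (Hin : In (i, (x, e)) wedges) by (rewrite HP; apply in_elt).
    assert (Hincl : incl dn wedges) by (rewrite HP; intros t Ht; apply in_or_app; auto).
    assert (X := wedges_lt n es Hwf v _ _ _ Hin).
    assert (Y := wedges_adj n es Hwf v _ _ _ Hin). destruct Y as (Y1 & Y2 & Y3).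
    assert (HE1 : Env s1) by (eapply Env_fr; [|exact Hf|]; auto).
    destruct HE1 as (_ & [P1 P2] & O). destruct (O _ _ _ Hin) as (O1 & O2 & O3).
    assert (Pf := P1 _ _ _ Hin).
    w1; rewrite Hx in *.
    + assert (Fx : far x = true) by (apply Pf; auto).
      assert (Nnb : forall j, j < d -> x <> nb j).
      { intros j Hj ->. apply (far_spec n es Hwf) in Fx. apply (proj2 Fx).
        apply (nb_adj n es Hwf). auto. }
      w1; rewrite Hx in *.
      * w1. split; [lia|]. split; auto. intros t Ht. apply in_app_iff in Ht.
        destruct Ht as [Ht|[<-|[]]]; auto. simpl. split; [intros j Hj E; exfalso; eapply Nnb; eauto|].
        intros _ L. exfalso. apply L. rewrite <- O1. auto.
      * w1. w1. rewrite ?Hx, O3.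
        assert (Z : In (last (common x) 0) (common x))
          by (apply last_in; intros E; rewrite E in Y3; contradiction).
        assert (Z' := Z). apply (in_common n es Hwf) in Z'. destruct Z' as [Z1 Z2].
        apply (union_ok' i (last (common x) 0)); sx; auto.
        -- destruct (le_lt_dec 3 (length (common x))) as [L|L].
           ++ apply (gen2_nrel n es Hwf); auto. exists x. auto.
           (* Neither 2 nor at least 3, and i is a member: so i is also the last element. *)
           ++ assert (length (common x) = 1).
              { rewrite O1 in H0. destruct (common x); simpl in *; [contradiction|lia]. }
              destruct (common x) as [|a [|? ?]]; simpl in *; try lia.
              destruct Y3 as [->|[]]. apply (nrel_refl n es Hwf). auto.
        -- intros T s2 Hf2 S2 L2 E2 HT.
           assert (EP : PhiL (setv s1 vO (last (common x) 0)) = PhiL s1) by reflexivity.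
           split; [lia|]. split; auto. intros t Ht. apply in_app_iff in Ht.
           destruct Ht as [Ht|[<-|[]]].
           ++ eapply Mono; [exact Hincl| |exact HI|exact Ht]. exact L2.
           ++ simpl. split; [intros j Hj E; exfalso; eapply Nnb; eauto|]. auto.
    + assert (Fx : far x <> true) by (intros F; apply H; apply Pf; auto).
      w1; rewrite Hx in *.
      * w1. split; [lia|]. split; auto. intros t Ht. apply in_app_iff in Ht.
        destruct Ht as [Ht|[<-|[]]]; auto. simpl. split; [|intros; contradiction].
        intros j Hj E. exfalso. assert (Aj := nb_adj n es Hwf v j Hj).
        destruct HL1 as (_ & EV & _). rewrite <- E, H0, EV in Aj. apply (adj_irrefl n es Hwf) in Aj. auto.
      * w1. w1. rewrite Hx.
        assert (Avx : adj es v x).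
        { destruct HL1 as (_ & EV & _). rewrite EV in H0.
          destruct (adjb es v x) eqn:Ab; [apply (adjb_spec n es Hwf); auto|].
          exfalso. apply Fx. apply (far_spec n es Hwf). rewrite <- (adjb_spec n es Hwf).
          split; auto. congruence. }
        destruct (nb_surj n es Hwf v x Avx) as (j & Hj & Ej). fold d in Hj.
        assert (Ps := P2 j Hj). rewrite Ej in Ps. rewrite Ps. simpl Nat.sub. rewrite Nat.sub_0_r.
        apply (union_ok' i j); sx; auto.
        -- apply (gen1_nrel n es Hwf); auto. unfold gen1. rewrite Ej. auto.
        -- intros T s2 Hf2 S2 L2 E2 HT.
           assert (EP : PhiL (setv s1 vO j) = PhiL s1) by reflexivity.
           split; [lia|]. split; auto. intros t Ht. apply in_app_iff in Ht.
           destruct Ht as [Ht|[<-|[]]].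
           ++ eapply Mono; [exact Hincl| |exact HI|exact Ht]. exact L2.
           ++ simpl. split; [|intros; contradiction]. intros j' Hj' E.
              rewrite <- Ej in E. apply (nb_inj n es Hwf) in E; auto. subst j'. auto.
  - intros T s1 Hf HL1 [S1 HI] HT. fold d in HT.
    apply HQ; auto; [eapply Env_fr; [|exact Hf|]; auto|].
    split.
    + intros i j Hi Hj G. unfold gen1 in G.
      apply (adj_ed n es Hwf) in G. apply edge_surj in G as (e & He & Ee).
      apply (HI (i, (nb j, e))); auto. apply (in_wedges n es Hwf). auto.
    + intros i j Hi Hj (x & F & Oi & Oj & L).
      assert (W : forall k, In k (common x) -> sa s1 aLB k = sa s1 aLB (last (common x) 0)).
      { intros k Hk. apply (in_common n es Hwf) in Hk as [Hk1 Hk2].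
        apply (adj_ed n es Hwf) in Hk2. apply edge_surj in Hk2 as (e & He & Ee).
        apply (HI (k, (x, e))); auto; [apply (in_wedges n es Hwf); auto|]. lia. }
      rewrite (W i Oi), (W j Oj). reflexivity.
Qed.

Lemma count_squares_ok i Q s : Env s -> sv s vI = i -> i < d ->
  (forall j, j < d -> sa s aCT j = 0) ->
  (forall T s', fr count_squares s s' -> (forall j, j < d -> sa s' aCT j = cnt es v i j) ->
     T <= D * 8 + 2 -> Q T s') -> wp count_squares Q s.
Proof.
  intros HE Hi Hid H0 HQ. assert (Hn := d_le_n n es Hwf v : d <= n). unfold count_squares.
  assert (Hnb := nb_lt n es Hwf v i Hid).
  assert (ENB : sa s aNB i = nb i) by (apply HE; auto).
  apply wp_chain with (B := 2 * m) (l := arcs es (nb i)) (Phi := fun _ => 0) (b := 6)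
    (I := fun dn s => forall j, j < d -> sa s aCT j =
       length (filter (fun x => is_sq x && (opp i x =? j)) (map fst dn))); auto; try lia.
  - ok; rewrite Hi, ?ENB; lia.
  - sx. rewrite Hi, ENB. apply HE. auto.
  - intros dn x e rest s1 Hl HT HE1 HQ1 Hf HI.
    assert (EnvS : Env s1) by (eapply Env_fr; [|exact Hf|]; auto).
    assert (Ei : sv s1 vI = i) by (rewrite <- Hi; apply Hf; reflexivity).
    assert (Hin : In (i, (x, e)) wedges).
    { unfold wedges, wedges. apply in_flat_map. exists i. split; [apply in_seq; fold d; lia|].
      apply in_map. rewrite Hl. apply in_elt. }
    assert (X := wedges_lt n es Hwf v _ _ _ Hin).
    assert (Hsq := is_sq_test _ _ _ _ EnvS Hin).
    assert (Step : forall a, (a = if is_sq x then 1 else 0) -> forall j, 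
      length (filter (fun x => is_sq x && (opp i x =? j)) (map fst (dn ++ [(x, e)]))) =
      length (filter (fun x => is_sq x && (opp i x =? j)) (map fst dn)) +
        (if opp i x =? j then a else 0)).
    { intros a -> j. rewrite map_app, filter_app, length_app. simpl.
      destruct (is_sq x), (opp i x =? j); simpl; lia. }
    w1. w1. rewrite HT. w1.
    + w1.
      * assert (Sx : is_sq x = true) by (apply Hsq; auto).
        assert (HL2 : length (common x) = 2).
        { unfold is_sq, is_sq in Sx. apply andb_true_iff in Sx as [_ Sx]. apply Nat.eqb_eq; auto. }
        assert (Y := wedges_adj n es Hwf v _ _ _ Hin). destruct Y as (Y1 & Y2 & Y3).
        destruct (opp_spec es v i x HL2 Y3) as (_ & Z & _). apply (in_common n es Hwf) in Z as [Z _].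
        fold d in Z.
        w1. apply (set_opp_ok i x e); auto; sx.
        w1. split; [lia|]. intros j Hj. rewrite (Step 1) by (rewrite Sx; auto).
        unfold upd. rewrite (Nat.eqb_sym j). destruct (Nat.eqb_spec (opp i x) j) as [<-|Hne].
        -- rewrite HI by auto. reflexivity.
        -- rewrite HI by auto. lia.
      * w1. split; [lia|]. intros j Hj. rewrite (Step 0), HI by (auto; destruct (is_sq x); auto; exfalso; apply H1; apply Hsq; auto).
        destruct (_ =? _); lia.
    + w1. split; [lia|]. intros j Hj. rewrite (Step 0), HI by (auto; destruct (is_sq x); auto; exfalso; apply H; apply Hsq; auto).
      destruct (_ =? _); lia.
  - intros T s1 Hf HI HT. cbv beta in HT. apply HQ; auto.
    + assert (HDn := HD _ Hnb). nia.
Qed.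

Lemma union_pairs_ok Q s : Env s -> sound s -> gens12 s ->
  (forall T s', fr union_pairs s s' -> Env s' -> sound s' -> gens12 s' ->
     (forall i j, i < d -> j < d -> gen3 es v i j -> sa s' aLB i = sa s' aLB j) ->
     T + PhiL s' <= d * (D * 21 + 10) + 2 + PhiL s -> Q T s') -> wp union_pairs Q s.
Proof.
  intros HE HS HG HQ. assert (Hn := d_le_n n es Hwf v : d <= n). assert (HdD := d_le_D n es D HD v Hv : d <= D). unfold union_pairs.
  assert (Es : sv s vD = d) by apply HE.
  assert (GMono : forall s1 s2, le_lab s1 s2 -> gens12 s1 -> gens12 s2).
  { intros s1 s2 L [G1 G2]. split; intros; apply L; auto. }
  apply wp_for with (Phi := fun _ => PhiL) (b := D * 21 + 8)
    (I := fun k s => sound s /\ gens12 s /\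
      forall i j, i < k -> i < d -> j < d -> gen3 es v i j -> sa s aLB i = sa s aLB j); auto.
  - split; auto. split; auto. intros; lia.
  - intros i s1 Hk Hi Hy Hf (S1 & G1 & I1). rewrite Es in *.
    assert (E1 : Env s1) by (eapply Env_fr; [|exact Hf|]; auto).
    w1. apply wp_for with (Phi := fun _ _ => 0) (b := 1)
      (I := fun k s => forall j, j < k -> sa s aCT j = 0); auto.
    + intros; lia.
    + intros j s2 Hj Hj2 Hy2 Hf2 I2. rewrite Hy in *. w1. split; [lia|]. intros j' Hj'. rewrite Hj2.
      unfold upd. destruct (Nat.eqb_spec j' j); auto. apply I2. lia.
    + intros T2 s2 _ Hf2 I2 HT2. rewrite Hy in *.
      assert (E2 : Env s2) by (eapply Env_fr; [|exact Hf2|]; auto).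
      assert (Hi2 : sv s2 vI = i) by (rewrite <- Hi; apply Hf2; reflexivity).
      w1. apply (count_squares_ok i); auto.
      intros T3 s3 Hf3 C3 HT3.
      assert (E3 : Env s3) by (eapply Env_fr; [|exact Hf3|]; auto).
      assert (Hi3 : sv s3 vI = i) by (rewrite <- Hi2; apply Hf3; reflexivity).
      assert (L3 : sa s3 aLB = sa s1 aLB).
      { rewrite (proj2 Hf3), (proj2 Hf2); reflexivity. }
      assert (Es3 : sv s3 vD = d) by apply E3.
      apply wp_for with (Phi := fun _ => PhiL) (b := 7)
        (I := fun k s => sound s /\ le_lab s3 s /\
          forall j, j < k -> j < d -> gen3 es v i j -> sa s aLB i = sa s aLB j); auto.
      * unfold sound, le_lab. sx. rewrite L3. split; auto. split; auto. intros; lia.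
      * intros j s4 Hj Hj4 Hy4 Hf4 (S4 & Le4 & I4). rewrite Es3 in *.
        assert (E4 : Env s4) by (eapply Env_fr; [|exact Hf4|]; auto).
        assert (Hi4 : sv s4 vI = i) by (rewrite <- Hi3; apply Hf4; reflexivity).
        assert (C4 : sa s4 aCT = sa s3 aCT) by (apply Hf4; reflexivity).
        w1.
        -- w1. split; [unfold PhiL; sx; lia|]. split; [exact S4|]. split; [exact Le4|].
           intros j' Hj' Hd' G. destruct (Nat.eq_dec j' j) as [->|]; [|apply I4; auto; lia].
           destruct G as [G _]. congruence.
        -- w1.
           ++ w1. split; [unfold PhiL; sx; lia|]. split; [exact S4|]. split; [exact Le4|].
              intros j' Hj' Hd' G. destruct (Nat.eq_dec j' j) as [->|]; [|apply I4; auto; lia].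
              destruct G as [_ G]. rewrite Hj4, C4, C3 in H0 by auto. congruence.
           ++ rewrite Hj4, Hi4, C4, C3 in * by auto. w1. w1. rewrite Hj4.
              apply (union_ok' i j); sx; auto.
              (* A bare update of [vO] is framed as the effect of some command that assigns [vO]. *)
              ** eapply (Env_fr (Assign vO (Ct 0))); [reflexivity| |exact E4].
                 apply fr_setv; [reflexivity|apply fr_refl].
              ** apply (gen3_nrel n es Hwf); auto. split; auto.
              ** intros T5 s5 Hf5 S5 L5 E5 HT5.
                 assert (EP : PhiL (setv s4 vO j) = PhiL s4) by reflexivity.
                 assert (EP' : forall a, PhiL (setv s5 vJ a) = PhiL s5) by reflexivity.
                 split; [rewrite EP'; lia|]. split; [exact S5|].
                 split; [eapply le_lab_trans; [exact Le4|exact L5]|].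
                 intros j' Hj' Hd' G. sx. destruct (Nat.eq_dec j' j) as [->|]; [exact E5|].
                 apply L5; auto. apply I4; auto; lia.
      * intros T4 s4 _ Hf4 (S4 & Le4 & I4) HT4. rewrite Es3 in *.
        assert (EP : PhiL (setv s3 vJ 0) = PhiL s1) by (unfold PhiL; sx; rewrite L3; reflexivity).
        assert (EP' : forall a, PhiL (setv s4 vI a) = PhiL s4) by reflexivity.
        assert (Le1 : le_lab s1 s4) by (unfold le_lab in *; rewrite L3 in Le4; exact Le4).
        rewrite EP in HT4. split; [rewrite EP'; nia|]. split; [exact S4|].
        split; [exact (GMono _ _ Le1 G1)|]. sx.
        intros i' j' Hi' Hid' Hj' G. destruct (Nat.eq_dec i' i) as [->|]; [apply I4; auto|].
        apply Le1; auto. apply I1; auto; lia.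
  - intros T s1 _ Hf (S1 & G1 & I1) HT. rewrite Es in *.
    assert (EP : PhiL (setv s vI 0) = PhiL s) by reflexivity.
    apply HQ; auto; [eapply Env_fr; [|exact Hf|]; auto|]. nia.
Qed.

Definition LBok (s : st) : Prop :=
  (forall i, i < d -> sa s aLB i < d) /\
  (forall i j, i < d -> j < d -> (sa s aLB i = sa s aLB j <-> nrel i j)).

Lemma local_classes_ok Q s : Env s ->
  (forall T s', fr local_classes s s' -> Env s' -> LBok s' ->
     T <= d * (D * 40 + 30) + 6 -> Q T s') -> wp local_classes Q s.
Proof.
  intros HE HQ. assert (Hn := d_le_n n es Hwf v : d <= n). assert (HdD := d_le_D n es D HD v Hv : d <= D).
  apply wp_fr. unfold local_classes. assert (Es : sv s vD = d) by apply HE.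
  w1. apply wp_for with (Phi := fun _ _ => 0) (b := 1)
    (I := fun k s => forall i, i < k -> sa s aLB i = i); auto; [intros; lia| |].
  - intros k s1 Hk Hi Hy Hf I1. w1. split; [lia|]. rewrite Hi. intros i Hi'.
    unfold upd. destruct (Nat.eqb_spec i k); auto. apply I1; lia.
  - intros T1 s1 _ Hf1 I1 HT1. rewrite Es in *.
    assert (E1 : Env s1) by (eapply Env_fr; [|exact Hf1|]; auto).
    w1. apply union_stars_ok; auto.
    + split; intros; rewrite I1 in *; auto. rewrite I1 in * by auto. subst.
      apply (nrel_refl n es Hwf). auto.
    + intros T2 s2 Hf2 E2 S2 G2 HT2. apply union_pairs_ok; auto.
      intros T3 s3 Hf3 E3 S3 G3 H3 HT3.
      (* The initial labels are the d positions, so the whole potential is at most quadratic in d,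
         and d is at most D. *)
      assert (P0 : PhiL s1 <= (4 * d + 4) * d).
      { unfold PhiL. apply Nat.mul_le_mono_l.
        etransitivity; [apply dcount_le with (l := seq 0 d)|rewrite length_seq; auto].
        intros i Hi _. rewrite I1 by auto. apply in_seq. lia. }
      intros Hf. apply HQ; auto; [|nia].
      destruct S3 as [S3 S4]. split; auto. intros i j Hi Hj. split; [apply S4; auto|].
      intros HR. destruct G3 as [G3 G4].
      apply (dvstar_L n es Hwf v (fun i j => sa s3 aLB i = sa s3 aLB j)); auto; intros; congruence.
Qed.

End Process.

(** * Merging local colourings *)

(** The loop running through [star] in order, with the edge in [vE] and its local class in [vK]. The
    star itself is never stored. *)
Definition ForS (body : cmd) : cmd :=
  Seq (For vI vD
    (Seq (Assign vE (Rd aNE (Va vI))) (Seq (Assign vK (Rd aLB (Va vI))) body)))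
  (For2 (If (Eq (Rd aPS (Va vX)) (Ct 0))
    (If (Eq (Rd aKX (Va vX)) (Ct 2))
      (Seq set_opp (Seq (Assign vK (Rd aLB (Va vO)))
        (If (Eq (Va vK) (Rd aLB (Va vI))) Skip (Seq (Assign vE (Rd aEI (Va vQ))) body))))
      Skip) Skip)).

(** A class adopts the colour of its first coloured edge. A later edge of the class with another
    colour causes a merge, which must also be carried out in [aGC], as other classes may hold the
    colour that disappears. *)
Definition absorb : cmd :=
  If (Eq (Rd aCOL (Va vE)) (Ct 0)) Skip
  (If (Eq (Rd aGC (Va vK)) (Ct 0)) (Store aGC (Va vK) (Rd aCOL (Va vE)))
  (Seq (Assign vA1 (Rd aGC (Va vK))) (Seq (Assign vB1 (Rd aCOL (Va vE)))
    (If (Eq (Va vA1) (Va vB1)) Skip (Seq (relab aCOL vM) (relab aGC vD)))))).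

Definition paint : cmd := Store aCOL (Va vE) (Rd aGC (Va vK)).

Definition freshen : cmd :=
  For vI vD (If (Eq (Rd aGC (Va vI)) (Ct 0))
    (Seq (Assign vNC (Pl (Va vNC) 1)) (Store aGC (Va vI) (Va vNC))) Skip).

Definition merge_colours : cmd :=
  Seq (For vI vD (Store aGC (Va vI) (Ct 0)))
  (Seq (ForS absorb) (Seq freshen (ForS paint))).

Definition Base (es : list Edge) (P : list nat) : relation Edge :=
  fun e f => exists u, In u P /\ dS es u e f.

(** The global colouring with the list P of visited vertices in place of W. *)
Definition Col (es : list Edge) (P : list nat) : relation Edge := clos_trans Edge (Base es P).

Lemma dS_sym es u e f : dS es u e f -> dS es u f e.
Proof. intros (H1 & H2 & H3). split; auto. apply dvstar_sym; auto. Qed.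

Lemma Col_sym es P e f : Col es P e f -> Col es P f e.
Proof.
  induction 1 as [x y (u & H1 & H2)|x y z H1 IH1 H2 IH2].
  - apply t_step. exists u. split; auto. apply dS_sym; auto.
  - eapply t_trans; eauto.
Qed.

Lemma Col_trans es P e f g : Col es P e f -> Col es P f g -> Col es P e g.
Proof. intros. eapply t_trans; eauto. Qed.

Lemma Col_incl es P P' e f : incl P P' -> Col es P e f -> Col es P' e f.
Proof.
  intros Hi. induction 1 as [x y (u & H1 & H2)|x y z H1 IH1 H2 IH2].
  - apply t_step. exists u. auto.
  - eapply Col_trans; eauto.
Qed.

(** [Col es P] is reflexive only on edges of visited stars; the other edges have colour 0 and are
    not even related to themselves. This is also the output convention. *)
Definition ColOK (es : list Edge) (P : list nat) (col : nat -> nat) : Prop :=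
  forall e f, e < length es -> f < length es ->
    (col e = col f /\ col e <> 0 <-> Col es P (edge es e) (edge es f)).

Definition sloop (x : var) : Prop := loopvar x \/ x = vE \/ x = vK \/ x = vO.

Section Process.

Context (n : nat) (es : list Edge) (Hwf : wf_graph n es).
Let m := length es.
Context (D : nat) (HD : forall u, u < n -> length (arcs es u) <= D).
Context (IB B0 : nat) (HIB : n + 2 * m + 2 <= IB).
Notation wp := (wp IB B0).
Context (v : nat) (Hv : v < n).
Let d := length (arcs es v).
Notation nb := (nb es v).
Notation ne := (ne es v).
Notation wedges := (wedges es v).
Notation common := (common es v).
Notation far := (far es v).
Notation is_sq := (is_sq es v).
Notation opp := (opp es v).
Notation nrel := (nrel es v).
Notation Env := (Env n es v).

Context (lab : nat -> nat) (Hlt : forall i, i < d -> lab i < d)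
  (Hlab : forall i j, i < d -> j < d -> (lab i = lab j <-> nrel i j)).

Notation star := (star es v lab).

Ltac safe := unfold esafe, lsafe, gsafe; simpl;
  rewrite ?andb_true_iff, ?negb_true_iff, ?orb_false_iff; simpl; tauto.

Lemma star_lt e k : In (e, k) star -> e < m /\ k < d.
Proof.
  intros H. apply (star_sound n es Hwf v lab Hlab) in H as (H1 & _ & i & H2 & <- & _).
  split; auto.
Qed.

Definition ssafe (c : cmd) : bool :=
  esafe c && negb (moda c aLB || modv c vI || modv c vQ).

Lemma wp_forS (Phi : st -> nat) b (I : list (nat * nat) -> st -> Prop) body Q s :
  ssafe body = true -> Env s -> sa s aLB = lab ->
  (forall x a s, sloop x -> Phi (setv s x a) = Phi s) ->
  (forall l s x a, sloop x -> I l s -> I l (setv s x a)) ->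
  I [] s ->
  (forall dn e k rest s1, star = dn ++ (e, k) :: rest ->
     sv s1 vE = e -> sv s1 vK = k -> Env s1 -> sa s1 aLB = lab -> I dn s1 ->
     wp body (fun t s2 => t + Phi s2 <= b + Phi s1 /\ I (dn ++ [(e, k)]) s2) s1) ->
  (forall T s1, fr (ForS body) s s1 -> Env s1 -> sa s1 aLB = lab -> I star s1 ->
     T + Phi s1 <= d * (D * (b + 10) + b + 8) + 4 + Phi s -> Q T s1) ->
  wp (ForS body) Q s.
Proof.
  intros Hb HE HLB HPhi HI H0 Hstep Hend.
  assert (Hn := d_le_n n es Hwf v). fold d in Hn.
  set (ev_ k := map (fun i => (ne i, lab i)) (seq 0 k)).
  set (g := fun t : nat * (nat * nat) => let '(i, (x, e)) := t in
     if is_sq x && negb (lab (opp i x) =? lab i) then [(e, lab (opp i x))] else []).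
  assert (ESL : star = ev_ d ++ flat_map g wedges) by reflexivity.
  assert (Hb' := Hb). unfold ssafe, esafe, lsafe, gsafe in Hb'.
  rewrite !andb_true_iff, !negb_true_iff, !orb_false_iff in Hb'.
  assert (Hbs : modv body vI = false /\ modv body vQ = false /\ modv body vD = false) by tauto.
  destruct Hbs as (HbI & HbQ & HbD).
  assert (Es : sv s vD = d) by apply HE.
  set (c1 := For vI vD (Seq (Assign vE (Rd aNE (Va vI))) (Seq (Assign vK (Rd aLB (Va vI))) body))).
  apply wp_fr. unfold ForS.
  match goal with |- wp (Seq _ ?c) _ _ => set (c2 := c) end.
  assert (EF : forall c s1 s2, esafe c = true /\ moda c aLB = false -> fr c s1 s2 ->
    Env s1 -> sa s1 aLB = lab -> Env s2 /\ sa s2 aLB = lab).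
  { intros c s1 s2 [X1 X2] Hf X3 X4. split; [eapply Env_fr; eauto|]. rewrite <- X4. apply Hf; auto. }
  assert (Sf1 : esafe c1 = true /\ moda c1 aLB = false) by safe.
  assert (Sf2 : esafe c2 = true /\ moda c2 aLB = false) by safe.
  w1. unfold c1.
  apply wp_for with (Phi := fun _ => Phi) (b := b + 2) (I := fun k => I (ev_ k)); auto.
  - apply HI; auto. left; left; auto.
  - intros k s1 Hk Hi Hy Hf I1. rewrite Es in *.
    destruct (EF _ _ _ Sf1 Hf HE HLB) as [E1 L1].
    assert (Hne : sa s1 aNE k = ne k) by (apply E1; auto).
    w1. w1. w1. w1. rewrite Hi, Hne, L1.
    assert (Hsplit : star = ev_ k ++ (ne k, lab k) ::
       map (fun i => (ne i, lab i)) (seq (S k) (d - S k)) ++ flat_map g wedges).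
    { rewrite ESL. unfold ev_. rewrite (seq_split k d Hk), map_app, <- app_assoc. reflexivity. }
    eapply wp_conseq.
    + eapply Hstep; [exact Hsplit| | | | | ]; sx; auto.
      apply HI; [right; right; auto|]. apply HI; [right; left; auto|]. auto.
    + intros t s2 Hf2 [Ht I2].
      rewrite !HPhi in Ht by (unfold sloop; auto).
      rewrite HPhi by (left; left; auto). split; [lia|].
      apply HI; [left; left; auto|].
      unfold ev_ in *. rewrite seq_S, map_app. exact I2.
  - intros T1 s1 Hi Hf I1 HT1. rewrite Es in *. rewrite HPhi in HT1 by (left; left; auto).
    destruct (EF _ _ _ Sf1 Hf HE HLB) as [E1 L1].
    (* Before the body come at most 7 ticks: three tests, two for [set_opp] and the assignments to
       [vK] and [vE]. *)
    apply wp_for2 with (n := n) (es := es) (D := D) (v := v) (Phi := Phi) (b := b + 7)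
      (I := fun dn s => I (ev_ d ++ flat_map g dn) s); auto.
    + safe.
    + simpl. rewrite HbI. reflexivity.
    + simpl. rewrite HbQ. reflexivity.
    + apply E1.
    + intros x a s0 Hx. apply HPhi. left; auto.
    + intros l s0 x a Hx. apply HI. left; auto.
    + simpl. rewrite app_nil_r. auto.
    + intros dn i x e rest s2 HP Hi2 Hx He HQ2 Hf2 HL2 I2.
      assert (Hin : In (i, (x, e)) wedges) by (rewrite HP; apply in_elt).
      assert (X := wedges_lt n es Hwf v _ _ _ Hin).
      assert (Y := wedges_adj n es Hwf v _ _ _ Hin). destruct Y as (Y1 & Y2 & Y3).
      destruct (EF _ _ _ Sf2 Hf2 E1 L1) as [E2 L2].
      assert (Hsq := is_sq_test _ _ _ _ _ _ _ E2 Hin).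
      assert (Skip_ok : is_sq x = false \/ lab (opp i x) = lab i -> 
        I (ev_ d ++ flat_map g (dn ++ [(i, (x, e))])) s2).
      { intros H. rewrite flat_map_app. unfold g at 2. cbn [flat_map].
        replace (is_sq x && negb (lab (opp i x) =? lab i)) with false; [rewrite !app_nil_r; auto|].
        destruct H as [->|H]; auto. apply Nat.eqb_eq in H. rewrite H, andb_false_r. reflexivity. }
      w1.
      * w1.
        -- rewrite ?Hx in *.
           assert (Sx : is_sq x = true) by (apply Hsq; auto).
           assert (HL3 : length (common x) = 2).
           { unfold is_sq, is_sq in Sx. apply andb_true_iff in Sx as [_ Sx].
             apply Nat.eqb_eq; auto. }
           destruct (opp_spec es v i x HL3 Y3) as (_ & Z & _).
           apply (in_common n es Hwf) in Z as [Z _].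
           fold d in Z.
           w1. apply (set_opp_ok n es Hwf IB B0 HIB v Hv i x e); auto.
           w1. w1. rewrite L2. w1.
           ++ w1. rewrite !HPhi by (unfold sloop; auto). split; [lia|].
              apply HI; [unfold sloop; auto|]. apply HI; [unfold sloop; auto|].
              apply Skip_ok. right. rewrite L2, Hi2 in *. auto.
           ++ rewrite Hi2, L2 in *. w1. w1. rewrite He.
              assert (Hsplit : star = (ev_ d ++ flat_map g dn) ++ (e, lab (opp i x)) ::
                  flat_map g rest).
              { rewrite ESL, HP, flat_map_app, app_assoc. cbn [flat_map]. unfold g at 2.
                rewrite Sx. apply Nat.eqb_neq in H2. rewrite H2. reflexivity. }
              eapply wp_conseq.
              ** eapply Hstep; [exact Hsplit| | | | | ]; sx; auto.
                 repeat (apply HI; [unfold sloop; auto|]). auto.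
              ** intros t s3 Hf3 [Ht I3].
                 rewrite !HPhi in Ht by (unfold sloop; auto).
                 split; [lia|]. rewrite flat_map_app. cbn [flat_map]. unfold g at 2.
                 rewrite Sx. apply Nat.eqb_neq in H2. rewrite H2. cbn [negb andb app].
                 rewrite app_assoc. exact I3.
        -- w1. split; [lia|]. apply Skip_ok. left. rewrite Hx in *.
           apply not_true_iff_false. intros Sx. apply H1. apply Hsq. auto.
      * w1. split; [lia|]. apply Skip_ok. left. rewrite Hx in *.
        apply not_true_iff_false. intros Sx. apply H. apply Hsq. auto.
    + intros T2 s2 Hf2 HL2 I2 HT2. fold d in HT2.
      destruct (EF _ _ _ Sf2 Hf2 E1 L1) as [E2 L2]. intros Hf'. apply Hend; auto.
      enough (d * (b + 2 + 2) + 2 + (d * (D * (b + 7 + 3) + 4) + 2) <=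
         d * (D * (b + 10) + b + 8) + 4) by lia.
      replace (b + 7 + 3) with (b + 10) by lia. nia.
Qed.

Context (P : list nat).
Let Rt := Col es (P ++ [v]).

Lemma star_Rt e f k : In (e, k) star -> In (f, k) star -> Rt (edge es e) (edge es f).
Proof.
  intros He Hf. apply t_step. exists v. split; [apply in_or_app; right; left; auto|].
  apply (star_dS n es Hwf v lab Hlab e f k k He Hf). auto.
Qed.

Section Colours.

Context (col0 : nat -> nat) (H0 : ColOK es P col0).

(** Here [l] is the part of the star already scanned. The colouring stays sound for [Rt] and only
    coarsens [col0], and uncoloured edges stay uncoloured until the painting. A colour held by a
    class is witnessed by an edge tied to that class, so passing the colour on is sound. *)
Definition Absorbed (l : list (nat * nat)) (col gc : nat -> nat) (nc : nat) : Prop :=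
  (forall e f, e < m -> f < m -> col e = col f -> col e <> 0 -> Rt (edge es e) (edge es f)) /\
  (forall e f, e < m -> f < m -> col0 e = col0 f -> col e = col f) /\
  (forall e, e < m -> (col e = 0 <-> col0 e = 0)) /\
  (forall k, k < d -> gc k <> 0 -> exists e f, e < m /\ f < m /\ In (f, k) star /\
     col e = gc k /\ Rt (edge es e) (edge es f)) /\
  (forall e k, In (e, k) l -> col0 e <> 0 -> gc k = col e) /\
  (forall e, e < m -> col e <= nc).

Lemma Absorbed_ext l col gc col' gc' nc : (forall e, e < m -> col' e = col e) ->
  (forall k, k < d -> gc' k = gc k) -> incl l star ->
  Absorbed l col gc nc -> Absorbed l col' gc' nc.
Proof.
  intros H1 H2 Hl (A1 & A2 & A3 & A4 & A5 & A6).
  split; [|split; [|split; [|split; [|split]]]].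
  - intros e f He Hf. rewrite !H1 by auto. auto.
  - intros e f He Hf. rewrite !H1 by auto. auto.
  - intros e He. rewrite !H1 by auto. auto.
  - intros k Hk. rewrite H2 by auto. intros Hg. destruct (A4 k Hk Hg) as (e & f & B1 & B2 & B3 & B4 & B5).
    exists e, f. rewrite H1 by auto. auto.
  - intros e k Hin. assert (X := star_lt _ _ (Hl _ Hin)). rewrite H1, H2 by apply X. apply A5; auto.
  - intros e He. rewrite H1 by auto. auto.
Qed.

(* The number of colours in use; merging two of them pays for the scan of [aCOL]. *)
Definition dcc (col : nat -> nat) : nat := dcount (fun c => negb (c =? 0)) col m.
(** Two scans at four ticks a cell, one over the m cells of [aCOL] and one over the at most n cells
    of [aGC] in use, with constant overhead. *)
Definition KC : nat := 4 * m + 4 * n + 8.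
Definition PhiC (s : st) : nat := KC * dcc (sa s aCOL).

Lemma absorb_ok l e k Q s : Env s -> In (e, k) star -> incl l star ->
  sv s vE = e -> sv s vK = k ->
  Absorbed l (sa s aCOL) (sa s aGC) (sv s vNC) ->
  (forall T s', fr absorb s s' ->
     Absorbed (l ++ [(e, k)]) (sa s' aCOL) (sa s' aGC) (sv s' vNC) ->
     T + PhiC s' <= 5 + PhiC s -> Q T s') -> wp absorb Q s.
Proof.
  intros HE Hin Hl Ee Ek HA HQ.
  assert (Hlt' := star_lt _ _ Hin). destruct Hlt' as [He Hk].
  assert (Hn := d_le_n n es Hwf v). fold d in Hn.
  set (col := sa s aCOL) in *. set (gc := sa s aGC) in *.
  assert (HA' := HA). destruct HA as (A1 & A2 & A3 & A4 & A5 & A6).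
  apply wp_fr.
  assert (Keep : (col0 e <> 0 -> gc k = col e) -> Absorbed (l ++ [(e, k)]) col gc (sv s vNC)).
  { intros X. repeat (split; auto). intros e' k' Hi'. apply in_app_iff in Hi'.
    destruct Hi' as [Hi'|[Hi'|[]]]; auto. injection Hi' as <- <-. auto. }
  unfold absorb. w1; rewrite Ee in *; fold col in H; fold col.
  - w1. intros Hf. apply HQ; [exact Hf|apply Keep|unfold PhiC; lia]. intros X. exfalso. apply X. apply A3; auto.
  - w1; rewrite Ek in *; fold gc in H1; fold gc.
    + w1. fold col gc. rewrite Ek, Ee. intros Hf.
      apply HQ; [exact Hf|sx; fold gc col|unfold PhiC; sx; lia].
      split; [|split; [|split; [|split; [|split]]]]; auto.
      * intros k' Hk'. unfold upd. destruct (Nat.eqb_spec k' k) as [->|]; [|apply A4; auto].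
        intros _. exists e, e. repeat (split; auto).
      * intros e' k' Hi' Hc. unfold upd. apply in_app_iff in Hi'.
        destruct Hi' as [Hi'|[Hi'|[]]].
        -- destruct (Nat.eqb_spec k' k) as [->|]; [|apply A5; auto].
           exfalso. assert (X := A5 e' k Hi' Hc). rewrite H1 in X.
           apply Hc. apply A3; [apply (star_lt _ _ (Hl _ Hi'))|]. auto.
        -- injection Hi' as <- <-. rewrite Nat.eqb_refl. auto.
    + w1. w1. w1. w1. fold col gc. rewrite Ek, Ee. w1.
      * w1. intros Hf. apply HQ; [exact Hf|apply Keep; auto|unfold PhiC; sx; lia].
      * assert (EM : sv s vM = m) by apply HE. assert (ED : sv s vD = d) by apply HE.
        assert (NM : 2 * m + n + 2 <= IB) by (fold m in HIB; lia).
        w1. apply (relab_ok n es IB B0 HIB); try discriminate; try reflexivity; sx; [lia|].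
        intros T1 s1 Hf1 R1 HT1. sxin R1. fold col in R1. rewrite EM in *.
        assert (M1 : sv s1 vA1 = gc k) by (rewrite (proj1 Hf1) by reflexivity; reflexivity).
        assert (M2 : sv s1 vB1 = col e) by (rewrite (proj1 Hf1) by reflexivity; reflexivity).
        assert (M3 : sv s1 vD = d) by (rewrite (proj1 Hf1) by reflexivity; exact ED).
        assert (M4 : sa s1 aGC = gc) by (rewrite (proj2 Hf1) by reflexivity; reflexivity).
        apply (relab_ok n es IB B0 HIB); try discriminate; try reflexivity; [lia|].
        intros T2 s2 Hf2 R2 HT2. rewrite M1, M2, M3, M4 in *.
        assert (M5 : sa s2 aCOL = sa s1 aCOL) by (rewrite (proj2 Hf2) by reflexivity; reflexivity).
        assert (M6 : sv s2 vNC = sv s vNC).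
        { rewrite (proj1 Hf2) by reflexivity. rewrite (proj1 Hf1) by reflexivity. reflexivity. }
        set (r := fun x => if x =? gc k then col e else x).
        destruct (A4 k Hk H1) as (e3 & f3 & B1 & B2 & B3 & B4 & B5).
        (* Soundness of the merge. An edge of colour [gc k] is tied to the star edges of class k by
           the witness of the invariant, hence to the current edge e, whose colour is the one that
           survives. *)
        assert (W : forall e1, e1 < m -> col e1 <> 0 ->
          exists e2, e2 < m /\ Rt (edge es e1) (edge es e2) /\ col e2 = r (col e1)).
        { intros e1 He1 Hc. unfold r. destruct (Nat.eqb_spec (col e1) (gc k)) as [Eq1|Ne1].
          - exists e. split; auto. split; auto.
            apply Col_trans with (edge es e3); [apply A1; auto; congruence|].
            apply Col_trans with (edge es f3); auto. apply (star_Rt _ _ k); auto.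
          - exists e1. split; auto. }
        assert (r0 : forall x, r x = 0 <-> x = 0).
        { intros x. unfold r. destruct (Nat.eqb_spec x (gc k)); intuition congruence. }
        intros Hf. apply HQ; [exact Hf| |]; rewrite ?M5, ?M6.
        -- apply Absorbed_ext with (col := fun x => r (col x)) (gc := fun x => r (gc x));
             [exact R1|exact R2| |].
           { intros t Ht. apply in_app_iff in Ht. destruct Ht as [Ht|[<-|[]]]; auto. }
           split; [|split; [|split; [|split; [|split]]]].
           ++ intros e1 f1 He1 Hf1' Ec Hc.
              assert (C1 : col e1 <> 0) by (intros X; apply Hc; apply r0; auto).
              assert (C2 : col f1 <> 0) by (intros X; apply Hc; rewrite Ec; apply r0; auto).
              destruct (W e1 He1 C1) as (e2 & X1 & X2 & X3).
              destruct (W f1 Hf1' C2) as (f2 & Y1 & Y2 & Y3).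
              apply Col_trans with (edge es e2); auto.
              apply Col_trans with (edge es f2); [|apply Col_sym; auto].
              apply A1; auto; rewrite X3; [congruence|]. intros X. apply C1. apply r0; auto.
           ++ intros e1 f1 He1 Hf1' Ec. f_equal. auto.
           ++ intros e1 He1. rewrite r0. auto.
           ++ intros k' Hk' Hg. assert (Hg' : gc k' <> 0) by (rewrite <- r0; auto).
              destruct (A4 k' Hk' Hg') as (e1 & f1 & X1 & X2 & X3 & X4 & X5).
              exists e1, f1. rewrite X4. auto.
           ++ intros e' k' Hi' Hc. apply in_app_iff in Hi'. destruct Hi' as [Hi'|[Hi'|[]]].
              ** f_equal. apply A5; auto.
              ** injection Hi' as <- <-. unfold r. rewrite Nat.eqb_refl.
                 destruct (_ =? _); auto.
           ++ intros e' He'. unfold r. destruct (_ =? _); auto.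
        -- assert (DC : dcc (sa s1 aCOL) + 1 <= dcc col).
           { apply dcount_merge with (gc k) (col e); eauto.
             apply negb_true_iff, Nat.eqb_neq. auto. }
           unfold PhiC. rewrite M5. fold col. unfold KC.
           assert (KCe : KC * dcc (sa s1 aCOL) + KC <= KC * dcc col) by nia.
           unfold KC in KCe. lia.
Qed.

(* [gcO] is the class colouring after absorption, [gc] the one after fresh colours,
   all above [nc0], have been given to the classes still without one. *)
Definition Fresh (K : nat) (gcO : nat -> nat) (nc0 : nat) (gc : nat -> nat) (nc : nat) : Prop :=
  nc0 <= nc /\
  (forall i, i < d -> gcO i <> 0 -> gc i = gcO i) /\
  (forall i, i < d -> K <= i -> gc i = gcO i) /\
  (forall i, i < d -> i < K -> gcO i = 0 -> nc0 < gc i <= nc) /\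
  (forall i j, i < d -> j < d -> i < K -> j < K -> gcO i = 0 -> gcO j = 0 ->
     gc i = gc j -> i = j).

Lemma freshen_ok Q s : Env s ->
  (forall T s', fr freshen s s' ->
     Fresh d (sa s aGC) (sv s vNC) (sa s' aGC) (sv s' vNC) -> T <= d * 5 + 2 -> Q T s') ->
  wp freshen Q s.
Proof.
  intros HE HQ. assert (Hn := d_le_n n es Hwf v). fold d in Hn.
  assert (Es : sv s vD = d) by apply HE.
  unfold freshen.
  apply wp_for with (Phi := fun _ _ => 0) (b := 3)
    (I := fun k s' => Fresh k (sa s aGC) (sv s vNC) (sa s' aGC) (sv s' vNC)); auto.
  - repeat split; sx; auto; lia.
  - intros k s1 Hk Hi Hy Hf (F0 & F1 & F2 & F3 & F4). rewrite Es in *.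
    assert (Ek := F2 k Hk (le_n k)).
    w1; rewrite Hi in *.
    + w1. w1. w1. rewrite Hi. split; [lia|].
      split; [sx; lia|]. sx.
      split; [|split; [|split]].
      * intros i Hi' Hg. unfold upd. destruct (Nat.eqb_spec i k) as [->|]; [congruence|auto].
      * intros i Hi' Hki. unfold upd. destruct (Nat.eqb_spec i k) as [->|]; [lia|apply F2; lia].
      * intros i Hi' Hik Hg. unfold upd. destruct (Nat.eqb_spec i k) as [->|]; [lia|].
        assert (X := F3 i Hi' ltac:(lia) Hg). lia.
      * intros i j Hi' Hj Hik Hjk Gi Gj. unfold upd.
        destruct (Nat.eqb_spec i k) as [->|], (Nat.eqb_spec j k) as [->|]; auto.
        -- assert (X := F3 j Hj ltac:(lia) Gj). lia.
        -- assert (X := F3 i Hi' ltac:(lia) Gi). lia.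
        -- apply F4; auto; lia.
    + w1. split; [lia|]. split; [sx; lia|]. sx.
      split; [|split; [|split]]; auto.
      * intros i Hi' Hki. apply F2; lia.
      * intros i Hi' Hik Hg. apply F3; auto. assert (i <> k) by congruence. lia.
      * intros i j Hi' Hj Hik Hjk Gi Gj. apply F4; auto.
        -- assert (i <> k) by congruence. lia.
        -- assert (j <> k) by congruence. lia.
  - intros T s1 Hi Hf HF HT. rewrite Es in *. apply HQ; auto. lia.
Qed.

(** Colours up to [nc0] are old and those above are fresh, so two edges of equal colour are of the
    same kind. Old ones are compared through edges that had the colour before painting; fresh ones
    lie in a single class. Conversely, pairs generated by P keep their common colour because
    painting leaves coloured edges unchanged, and pairs generated by v lie in one class. *)
Lemma ColOK_step col1 gcO nc0 gc nc col2 :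
  Absorbed star col1 gcO nc0 -> Fresh d gcO nc0 gc nc ->
  (forall e k, In (e, k) star -> col2 e = gc k) ->
  (forall e, e < m -> (forall k, ~ In (e, k) star) -> col2 e = col1 e) ->
  ColOK es (P ++ [v]) col2 /\ (forall e, e < m -> col2 e <= nc) /\
  (forall e, e < m -> col0 e <> 0 -> col2 e = col1 e).
Proof.
  intros (A1 & A2 & A3 & A4 & A5 & A6) (F0 & F1 & F2 & F3 & F4) C1 C2.
  assert (Dec : forall e, e < m -> (exists k, In (e, k) star) \/ (forall k, ~ In (e, k) star)).
  { intros e He. destruct (in_dec Nat.eq_dec e (map fst star)) as [H|H].
    - left. apply in_map_iff in H as ([e' k] & <- & H). exists k. auto.
    - right. intros k Hk. apply H. apply in_map_iff. exists (e, k). auto. }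
  assert (Old : forall e, e < m -> col0 e <> 0 -> col2 e = col1 e).
  { intros e He Hc. destruct (Dec e He) as [[k Hk]|H]; [|auto].
    rewrite (C1 e k Hk). assert (X := A5 e k Hk Hc). rewrite <- X.
    apply F1; [apply (star_lt _ _ Hk)|]. rewrite X. intros Y. apply Hc. apply A3; auto. }
  assert (Gpos : forall k, k < d -> gc k <> 0).
  { intros k Hk. destruct (Nat.eq_dec (gcO k) 0) as [Z|Z].
    - assert (X := F3 k Hk Hk Z). lia.
    - rewrite F1; auto. }
  assert (Gle : forall k, k < d -> gcO k <> 0 -> gcO k <= nc0).
  { intros k Hk Hg. destruct (A4 k Hk Hg) as (e & f & B1 & _ & _ & B4 & _). rewrite <- B4. auto. }
  split; [|split; [|exact Old]].
  - intros e f He Hf. fold Rt. split.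
    + intros [Ec Hc].
      (* A representative carrying the same colour before painting, or a fresh class. *)
      assert (W : forall e, e < m -> col2 e <> 0 ->
        (exists e', e' < m /\ Rt (edge es e) (edge es e') /\ col1 e' = col2 e /\ col2 e <= nc0) \/
        (exists k, In (e, k) star /\ gcO k = 0 /\ col2 e = gc k /\ nc0 < col2 e)).
      { intros x Hx Hcx. destruct (Dec x Hx) as [[k Hk]|H].
        - assert (Hkd := proj2 (star_lt _ _ Hk)). rewrite (C1 x k Hk) in *.
          destruct (Nat.eq_dec (gcO k) 0) as [Z|Z].
          + right. exists k. repeat split; auto. apply F3; auto.
          + left. destruct (A4 k Hkd Z) as (e1 & f1 & B1 & B2 & B3 & B4 & B5).
            exists e1. split; auto. split.
            * apply Col_trans with (edge es f1); [apply (star_Rt _ _ k); auto|]. apply Col_sym; auto.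
            * rewrite F1 by auto. split; auto.
        - left. exists x. rewrite (C2 x Hx H) in *. split; auto. }
      destruct (W e He Hc) as [(e' & X1 & X2 & X3 & X4)|(k & X1 & X2 & X3 & X4)];
      destruct (W f Hf ltac:(congruence)) as [(f' & Y1 & Y2 & Y3 & Y4)|(l & Y1 & Y2 & Y3 & Y4)];
        try lia.
      * apply Col_trans with (edge es e'); auto. apply Col_trans with (edge es f'); [|apply Col_sym; auto].
        apply A1; auto; congruence.
      * assert (k = l).
        { apply F4; auto; try apply (star_lt _ _ X1); try apply (star_lt _ _ Y1). congruence. }
        subst l. apply (star_Rt _ _ k); auto.
    + intros H. revert He Hf. 
      assert (Main : forall x y, Rt x y -> forall e f, e < m -> f < m -> x = edge es e -> y = edge es f ->
        col2 e = col2 f /\ col2 e <> 0).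
      { clear e f H. intros x y H. induction H as [x y (u & Hu & HdS)|x y z _ IH1 H2 IH2].
        - intros e f He Hf -> ->. apply in_app_iff in Hu. destruct Hu as [Hu|[<-|[]]].
          + assert (X : col0 e = col0 f /\ col0 e <> 0).
            { apply H0; auto. apply t_step. exists u. auto. }
            destruct X as [X1 X2]. rewrite !Old by (auto; congruence).
            split; [apply A2; auto|]. rewrite A3; auto.
          + destruct HdS as (D1 & D2 & D3).
            destruct (star_complete n es Hwf v lab Hlab e He D2) as [k Hk].
            destruct (star_complete n es Hwf v lab Hlab f Hf D3) as [l Hl].
            assert (k = l).
            { apply (star_dS n es Hwf v lab Hlab e f k l Hk Hl). split; auto. }
            subst l. rewrite (C1 e k Hk), (C1 f k Hl). split; auto.
            apply Gpos. apply (star_lt _ _ Hk).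
        - intros e f He Hf -> ->.
          (* Generating pairs consist of edges of the graph, so the middle of the chain has an index
             at which colours can be read. *)
          assert (Hy : In y es).
          { clear - H2. induction H2 as [x y (u & _ & _ & (X & _) & _)|x y z _ IH1 _ IH2]; auto. }
          apply edge_surj in Hy as (g & Hg & <-).
          destruct (IH1 e g He Hg eq_refl eq_refl) as [X1 X2].
          destruct (IH2 g f Hg Hf eq_refl eq_refl) as [Y1 Y2]. split; congruence. }
      intros He Hf. apply (Main _ _ H); auto.
  - intros e He. destruct (Dec e He) as [[k Hk]|H].
    + rewrite (C1 e k Hk). assert (Hkd := proj2 (star_lt _ _ Hk)).
      destruct (Nat.eq_dec (gcO k) 0) as [Z|Z].
      * apply F3; auto.
      * rewrite F1 by auto. specialize (Gle k Hkd Z). lia.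
    + rewrite (C2 e He H). specialize (A6 e He). lia.
Qed.

End Colours.

Lemma merge_colours_ok Q s : Env s -> sa s aLB = lab -> ColOK es P (sa s aCOL) ->
  (forall e, e < m -> sa s aCOL e <= sv s vNC) ->
  (P = [] \/ exists p, In p P /\ adj es v p) ->
  (forall T s', fr merge_colours s s' -> Env s' -> ColOK es (P ++ [v]) (sa s' aCOL) ->
     (forall e, e < m -> sa s' aCOL e <= sv s' vNC) ->
     T + PhiC s' <= d * (D * 30 + 40) + 20 + PhiC s + (match P with [] => KC * D | _ => 0 end) ->
     Q T s') ->
  wp merge_colours Q s.
Proof.
  intros HE HL HC Hnc HP HQ. assert (Hn := d_le_n n es Hwf v). fold d in Hn.
  assert (HdD := d_le_D n es D HD v Hv). fold d in HdD.
  apply wp_fr. unfold merge_colours. assert (Es : sv s vD = d) by apply HE.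
  set (col0 := sa s aCOL) in *.
  w1. apply wp_for with (Phi := fun _ _ => 0) (b := 1)
    (I := fun k s => forall i, i < k -> sa s aGC i = 0); auto; [intros; lia| |].
  { intros k s1 Hk Hi Hy Hf I1. w1. split; [lia|]. rewrite Hi. intros i Hi'.
    unfold upd. destruct (Nat.eqb_spec i k); auto. apply I1; lia. }
  intros T1 s1 _ Hf1 I1 HT1. rewrite Es in *.
  assert (E1 : Env s1) by (eapply Env_fr; [|exact Hf1|]; auto).
  assert (L1 : sa s1 aLB = lab) by (rewrite <- HL; apply Hf1; reflexivity).
  assert (C1 : sa s1 aCOL = col0) by (apply Hf1; reflexivity).
  assert (N1 : sv s1 vNC = sv s vNC) by (apply Hf1; reflexivity).
  w1. apply wp_forS with (Phi := PhiC) (b := 5)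
    (I := fun dn s => Absorbed col0 dn (sa s aCOL) (sa s aGC) (sv s vNC)); auto.
  { intros l s0 x a Hx HA. sx. destruct x; auto.
    unfold sloop, loopvar in Hx. intuition discriminate. }
  { rewrite C1, N1. split; [|split; [|split; [|split; [|split]]]]; auto.
    - intros e f He Hf Ec Hc. apply Col_incl with P; [intros x Hx; apply in_or_app; auto|].
      apply HC; auto.
    - tauto.
    - intros k Hk Hg. exfalso. apply Hg. apply I1. auto.
    - intros e k []. }
  { intros dn e k rest s2 Hsp Ee Ek E2 L2 I2.
    assert (Hin : In (e, k) star) by (rewrite Hsp; apply in_elt).
    apply (absorb_ok col0 dn e k); auto.
    rewrite Hsp. intros t Ht. apply in_or_app. auto. }
  intros T2 s2 Hf2 E2 L2 I2 HT2.
  w1. apply freshen_ok; auto. intros T3 s3 Hf3 HF HT3.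
  assert (E3 : Env s3) by (eapply Env_fr; [|exact Hf3|]; auto).
  assert (L3 : sa s3 aLB = lab) by (rewrite <- L2; apply Hf3; reflexivity).
  assert (C3 : sa s3 aCOL = sa s2 aCOL) by (apply Hf3; reflexivity).
  apply wp_forS with (Phi := fun _ => 0) (b := 1)
    (I := fun dn s => sa s aGC = sa s3 aGC /\ sv s vNC = sv s3 vNC /\
       (forall e k, In (e, k) dn -> sa s aCOL e = sa s3 aGC k) /\
       (forall e, (forall k, ~ In (e, k) dn) -> sa s aCOL e = sa s2 aCOL e)); auto.
  { intros l s0 x a Hx (J1 & J2 & J3). sx. split; auto. split; auto.
    destruct x; auto.
    unfold sloop, loopvar in Hx. intuition discriminate. }
  { repeat split; auto; [intros ? ? []|]. intros; rewrite C3; auto. }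
  { intros dn e k rest s4 Hsp Ee Ek E4 L4 (J1 & J2 & J3 & J4).
    assert (Hin : In (e, k) star) by (rewrite Hsp; apply in_elt).
    assert (X := star_lt _ _ Hin). unfold paint. w1. split; [lia|]. split; auto. split; auto.
    rewrite Ee, Ek, J1. split.
    - intros e' k' Hi'. unfold upd. destruct (Nat.eqb_spec e' e) as [->|Hne].
      (* An edge listed twice would be painted twice alike: it is in relation with itself, and by
         [star_dS] its two classes then agree. *)
      + f_equal. assert (Hin' : In (e, k') star).
        { rewrite Hsp. apply in_app_iff in Hi'. apply in_or_app.
          destruct Hi' as [Hi'|[Hi'|[]]]; [auto|right; left; auto]. }
        apply (star_dS n es Hwf v lab Hlab e e k k' Hin Hin').
        apply (star_dS n es Hwf v lab Hlab e e k k Hin Hin). auto.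
      + apply J3. apply in_app_iff in Hi'. destruct Hi' as [Hi'|[Hi'|[]]]; auto. congruence.
    - intros e' Hno. unfold upd. destruct (Nat.eqb_spec e' e) as [->|Hne].
      + exfalso. apply (Hno k). apply in_or_app. right; left; auto.
      + apply J4. intros k' Hk'. apply (Hno k'). apply in_or_app. auto. }
  intros T4 s4 Hf4 E4 L4 (J1 & J2 & J3 & J4) HT4 Hf.
  destruct (ColOK_step col0 HC _ _ _ _ _ (sa s4 aCOL) I2 HF J3 ltac:(auto)) as (K1 & K2 & K3).
  apply HQ; auto; [rewrite J2; auto|].
  assert (Es1 : sv s1 vD = d) by apply E1. 
  destruct HF as (F0 & F1 & F2 & F3 & F4). destruct I2 as (A1 & A2 & A3 & A4 & A5 & A6).
  assert (PC0 : PhiC s1 = PhiC s) by (unfold PhiC; rewrite C1; reflexivity).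
  assert (DCC : dcc (sa s4 aCOL) <= dcc (sa s2 aCOL) + match P with [] => D | _ => 0 end).
  { destruct P as [|p0 P'] eqn:EP.
    - transitivity d; [|lia].
      transitivity (length (map (sa s3 aGC) (seq 0 d))); [|rewrite length_map, length_seq; auto].
      apply dcount_le. intros e He Hc. apply negb_true_iff, Nat.eqb_neq in Hc.
      (* With no vertex visited nothing is coloured, so every colour in use afterwards belongs to
         one of the at most d classes. *)
      assert (Z : col0 e = 0).
      { destruct (Nat.eq_dec (col0 e) 0); auto. exfalso.
        assert (X : Col es [] (edge es e) (edge es e)) by (apply HC; auto).
        clear - X. induction X as [x y (u & [] & _)|x y z _ IH _ _]. exact IH. }
      destruct (in_dec Nat.eq_dec e (map fst star)) as [H|H].
      + apply in_map_iff in H as ([e' k] & <- & H). simpl. rewrite (J3 e' k H). apply in_map.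
        apply in_seq. assert (X := star_lt _ _ H). lia.
      + exfalso. apply Hc. rewrite J4; [apply A3; auto|]. intros k Hk. apply H.
        apply in_map_iff. exists (e, k). auto.
    - rewrite Nat.add_0_r. apply dcount_incl. intros e He Hc. apply negb_true_iff, Nat.eqb_neq in Hc.
      destruct (in_dec Nat.eq_dec e (map fst star)) as [H|H].
      + apply in_map_iff in H as ([e' k] & <- & H). cbn [fst] in *.
        assert (X := star_lt _ _ H). destruct X as [X1 X2].
        destruct HP as [HP|(p & Hp & Ap)]; [discriminate|].
        destruct (star_sound n es Hwf v lab Hlab e' k H) as (_ & _ & i & Hi & Ei & _).
        destruct (star_parent n es Hwf v lab Hlab p i Ap Hi) as (g & G1 & G2 & G3).
        rewrite Ei in G1.
        (* The edge g lies at the visited vertex p, so it was coloured before; as it also carries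
           class k in the star of v, class k has an old colour. *)
        assert (Gc : col0 g <> 0).
        { apply (HC g g G2 G2). apply t_step. exists p. split; auto.
          assert (Ig : inSv es p (edge es g)) by (split; [apply edge_in; auto|left; auto]).
          split; auto. apply t_step. split; [|left; auto].
          split; [apply edge_in; auto|]. split; [apply edge_in; auto|]. auto. }
        exists g. split; auto. rewrite (J3 e' k H). rewrite <- (A5 g k G1 Gc). symmetry.
        apply F1; auto. rewrite (A5 g k G1 Gc). rewrite A3; auto.
      + exists e. split; auto. symmetry. apply J4. intros k Hk. apply H.
        apply in_map_iff. exists (e, k). auto. }
  assert (PC4 : PhiC s4 <= PhiC s2 + match P with [] => KC * D | _ => 0 end).
  { unfold PhiC. destruct P; nia. }
  rewrite PC0 in HT2.
  enough (T1 + (T2 + (T3 + T4)) <= T2 + (d * (D * 11 + 9) + 4 + d * 8 + 4)) by nia.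
  lia.
Qed.

End Process.

(** * The search over W *)

Definition enqueue_nbrs : cmd :=
  For vI vD
    (Seq (Assign vU (Rd aNB (Va vI)))
    (If (Eq (Rd aW (Va vU)) (Ct 0)) Skip
    (If (Eq (Rd aSEEN (Va vU)) (Ct 0))
      (Seq (Store aSEEN (Va vU) (Ct 1))
      (Seq (Store aQ (Va vTl) (Va vU)) (Assign vTl (Pl (Va vTl) 1)))) Skip))).

Definition process : cmd :=
  Seq load_nbrs (Seq mark_nbrs (Seq count_common (Seq local_classes (Seq merge_colours enqueue_nbrs)))).

Definition search : cmd :=
  For vH vN (If (Lt (Va vH) (Va vTl)) (Seq (Assign vV (Rd aQ (Va vH))) process) Skip).

Definition copy_input : cmd :=
  For vA vP (If (Lt (Va vA) (Ct KR)) Skip (Store aIN (Va vA) (Rd aLOW (Va vA)))).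

Definition add_arc (x y : var) : cmd :=
  Seq (Assign vC (Pl (Va vC) 1))
  (Seq (Store aTO (Va vC) (Va y))
  (Seq (Store aEI (Va vC) (Va vI))
  (Seq (Store aNX (Va vC) (Rd aHD (Va x)))
       (Store aHD (Va x) (Va vC))))).

Definition build : cmd :=
  Seq (Assign vA (Ct 2)) (Seq (Assign vC (Ct 0))
  (For vI vM
    (Seq (Assign vX (Rd aIN (Va vA)))
    (Seq (Assign vY (Rd aIN (Pl (Va vA) 1)))
    (Seq (Assign vA (Pl (Va vA) 2))
    (Seq (add_arc vX vY) (add_arc vY vX))))))).

(** [vR] ends as the last vertex of W met and becomes the root of the search. *)
Definition read_W : cmd :=
  For vI vN
    (Seq (If (Eq (Rd aIN (Va vA)) (Ct 0)) Skip
           (Seq (Store aW (Va vI) (Ct 1)) (Assign vR (Va vI))))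
         (Assign vA (Pl (Va vA) 1))).

Definition start : cmd :=
  Seq (Store aSEEN (Va vR) (Ct 1))
  (Seq (Store aQ (Ct 0) (Va vR))
  (Seq (Assign vTl (Ct 1)) (Assign vNC (Ct 0)))).

Definition output : cmd :=
  For vA vM (If (Lt (Va vA) (Ct KR)) Skip (Store aLOW (Va vA) (Rd aCOL (Va vA)))).

Definition main : cmd :=
  Seq copy_input (Seq build (Seq read_W (Seq start (Seq search output)))).

Lemma chain_ext B B' nx to ei nx' to' ei' p l : B <= B' ->
  (forall q, 0 < q <= B -> nx' q = nx q /\ to' q = to q /\ ei' q = ei q) ->
  chain B nx to ei p l -> chain B' nx' to' ei' p l.
Proof.
  intros HB H. revert p. induction l as [|[u e] l IH]; intros p; simpl; auto.
  intros (H1 & H2 & H3 & H4). destruct (H p H1) as (X1 & X2 & X3).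
  rewrite X1, X2, X3. repeat split; auto; lia.
Qed.

Section Main.

Context (n : nat) (es : list Edge) (W : nat -> bool) (Hwf : wf_graph n es).
Let m := length es.
Definition Wok (s : st) : Prop := forall u, u < n -> sa s aW u = if W u then 1 else 0.

(** The queue is never shortened: its first [vH] entries are the visited vertices in order of visit.
    The last clause provides the visited neighbour that [merge_colours_ok] asks for. *)
Definition Qinv (s : st) : Prop :=
  let q := sa s aQ in let tl := sv s vTl in
  (forall i, i < tl -> q i < n /\ W (q i) = true /\ sa s aSEEN (q i) <> 0) /\
  (forall i j, i < tl -> j < tl -> q i = q j -> i = j) /\
  (forall u, u < n -> sa s aSEEN u <> 0 -> exists i, i < tl /\ q i = u) /\
  (forall j, 0 < j < tl -> exists i, i < j /\ adj es (q j) (q i)).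

Lemma Qinv_NoDup s k : Qinv s -> k <= sv s vTl -> NoDup (map (sa s aQ) (seq 0 k)).
Proof.
  intros (_ & HI & _) Hk. induction k as [|k IH]; [constructor|].
  rewrite seq_S, map_app. simpl. apply NoDup_app; [apply IH; lia| |].
  - constructor; [simpl; tauto|constructor].
  - intros x Hx [<-|[]]. apply in_map_iff in Hx as (i & Hi & Hin). apply in_seq in Hin.
    apply HI in Hi; lia.
Qed.

Lemma Qinv_tl s : Qinv s -> sv s vTl <= n.
Proof.
  intros HQ. assert (ND := Qinv_NoDup s (sv s vTl) HQ (le_n _)).
  apply NoDup_incl_length with (l' := seq 0 n) in ND.
  - rewrite length_map, !length_seq in ND. exact ND.
  - intros x Hx. apply in_map_iff in Hx as (i & <- & Hin). apply in_seq in Hin.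
    apply in_seq. destruct HQ as (H & _). specialize (H i ltac:(lia)). lia.
Qed.

(** The search always makes n rounds, idle ones once the queue is exhausted; hence the minimum. *)
Definition visited (s : st) (k : nat) : list nat := map (sa s aQ) (seq 0 (Nat.min k (sv s vTl))).
Definition degsum (l : list nat) : nat := list_sum (map (fun u => length (arcs es u)) l).

Definition Sinv (h : nat) (s : st) : Prop :=
  Gr n es s /\ Wok s /\ Qinv s /\ 1 <= sv s vTl /\
  ColOK es (visited s h) (sa s aCOL) /\ (forall e, e < m -> sa s aCOL e <= sv s vNC) /\
  (forall j u, j < h -> j < sv s vTl -> adj es (sa s aQ j) u -> W u = true -> sa s aSEEN u <> 0).

Lemma visited_handshake s h : Qinv s -> degsum (visited s h) <= 2 * m.
Proof. intros HQ. apply handshake. apply Qinv_NoDup; auto. lia. Qed.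

(** After n rounds the queue is closed under neighbours in W, so a path in W from the root never
    leaves it. This is where connectedness of the subgraph induced by W enters. *)
Lemma visited_W s : induced_connected n es W -> Sinv n s ->
  forall u, In u (visited s n) <-> inW n W u.
Proof.
  intros [_ HIC] (G & HW & HQ & T1 & _ & _ & A1).
  assert (Htl := Qinv_tl s HQ). destruct HQ as (Q1 & Q2 & Q3 & Q4).
  unfold visited. rewrite Nat.min_r by lia.
  assert (In0 : forall u, In u (map (sa s aQ) (seq 0 (sv s vTl))) <->
      exists i, i < sv s vTl /\ sa s aQ i = u).
  { intros u. rewrite in_map_iff. split; intros (i & X & Y).
    - apply in_seq in Y. exists i. split; auto. lia.
    - exists i. split; auto. apply in_seq. lia. }
  intros u. rewrite In0. split.
  - intros (i & X & <-). destruct (Q1 i X) as (Y1 & Y2 & _). split; auto.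
  - intros Hu. destruct (Q1 0 ltac:(lia)) as (Y1 & Y2 & _).
    assert (HP : conn_in es (inW n W) (sa s aQ 0) u) by (apply HIC; auto; split; auto).
    apply clos_rt_rtn1 in HP. induction HP as [|y z (Py & Pz & Ayz) HP IH].
    + exists 0. split; auto.
    + destruct (IH Py) as (i & X1 & <-). apply Q3; [apply Pz|].
      destruct (Q1 i X1) as (Z1 & _). apply (A1 i); auto; [lia|apply Pz].
Qed.

Context (D : nat) (HD : forall u, u < n -> length (arcs es u) <= D).
Context (IB B0 : nat) (HIB : n + 2 * m + 2 <= IB).
Notation wp := (wp IB B0).

Section Process.

Context (v : nat) (Hv : v < n).
Let d := length (arcs es v).
Notation nb := (nb es v).
Notation Env := (Env n es v).

Lemma enqueue_nbrs_ok h Q s : Env s -> Wok s -> Qinv s -> h < sv s vTl -> sa s aQ h = v ->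
  (forall T s', fr enqueue_nbrs s s' -> Qinv s' -> sv s vTl <= sv s' vTl ->
     (forall i, i < sv s vTl -> sa s' aQ i = sa s aQ i) ->
     (forall u, adj es v u -> W u = true -> sa s' aSEEN u <> 0) ->
     (forall u, sa s aSEEN u <> 0 -> sa s' aSEEN u <> 0) ->
     T <= d * 8 + 2 -> Q T s') -> wp enqueue_nbrs Q s.
Proof.
  intros HE HW HQI Hh Hqv HQ. assert (Hn := d_le_n n es Hwf v). fold d in Hn.
  assert (Es : sv s vD = d) by apply HE.
  unfold enqueue_nbrs. apply wp_for with (Phi := fun _ _ => 0) (b := 6)
    (I := fun k s' => Qinv s' /\ sv s vTl <= sv s' vTl /\
       (forall i, i < sv s vTl -> sa s' aQ i = sa s aQ i) /\
       (forall i, i < k -> i < d -> W (nb i) = true -> sa s' aSEEN (nb i) <> 0) /\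
       (forall u, sa s aSEEN u <> 0 -> sa s' aSEEN u <> 0)); auto.
  - repeat (split; auto). intros; lia.
  - intros k s1 Hk Hi Hy Hf (I1 & I2 & I3 & I4 & I5). rewrite Es in *.
    assert (E1 : Env s1) by (eapply Env_fr; [|exact Hf|]; auto).
    assert (W1 : Wok s1) by (unfold Wok; rewrite (proj2 Hf) by reflexivity; exact HW).
    assert (ENB : sa s1 aNB k = nb k) by (apply E1; auto).
    assert (Hnb := nb_lt n es Hwf v k Hk).
    assert (Htl := Qinv_tl s1 I1).
    w1. w1. rewrite Hi, ENB. w1.
    + w1. split; [lia|]. split; auto. split; auto. split; auto. split; auto.
      intros i Hi' Hd' HWi. destruct (Nat.eq_dec i k) as [->|]; [|apply I4; auto; lia].
      exfalso. rewrite W1, HWi in H by auto. lia.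
    + w1.
      * rename H0 into HS. w1. w1. w1. w1. w1. split; [lia|]. 
        assert (HWk : W (nb k) = true).
        { destruct (W (nb k)) eqn:E; auto. exfalso. apply H. rewrite W1, E by auto. auto. }
        assert (SM : forall u, sa s1 aSEEN u <> 0 -> upd (sa s1 aSEEN) (nb k) 1 u <> 0).
        { intros u Hu. unfold upd. destruct (u =? nb k); auto. }
        destruct I1 as (Q1 & Q2 & Q3 & Q4).
        assert (Hnew : forall i, i < sv s1 vTl -> sa s1 aQ i <> nb k).
        { intros i Hi' E. destruct (Q1 i Hi') as (_ & _ & X). rewrite E in X. auto. }
        split; [|split; [|split; [|split]]]; sx.
        -- unfold Qinv. sx. split; [|split; [|split]].
           ++ intros i Hi'. unfold upd at 1 2 4. destruct (Nat.eqb_spec i (sv s1 vTl)) as [->|Hne].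
              ** rewrite upd_same. auto.
              ** destruct (Q1 i ltac:(lia)) as (X1 & X2 & X3). auto.
           ++ intros i j Hi' Hj'. unfold upd.
              destruct (Nat.eqb_spec i (sv s1 vTl)) as [->|], (Nat.eqb_spec j (sv s1 vTl)) as [->|]; auto.
              ** intros E. exfalso. apply (Hnew j); [lia|auto].
              ** intros E. exfalso. apply (Hnew i); [lia|auto].
              ** apply Q2; lia.
           ++ intros u Hu. unfold upd at 1. destruct (Nat.eqb_spec u (nb k)) as [->|].
              ** intros _. exists (sv s1 vTl). rewrite upd_same. split; auto. lia.
              ** intros HSu. destruct (Q3 u Hu HSu) as (i & X1 & X2). exists i.
                 rewrite upd_other by lia. split; auto. lia.
           ++ intros j Hj. unfold upd. destruct (Nat.eqb_spec j (sv s1 vTl)) as [->|].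
              ** exists h. split; [lia|]. destruct (Nat.eqb_spec h (sv s1 vTl)); [lia|].
                 rewrite I3, Hqv by auto. apply adj_sym. apply (nb_adj n es Hwf). auto.
              ** destruct (Q4 j ltac:(lia)) as (i & X1 & X2). exists i. split; auto.
                 destruct (Nat.eqb_spec i (sv s1 vTl)); [lia|]. auto.
        -- lia.
        -- intros i Hi'. rewrite upd_other by lia. auto.
        -- intros i Hi' Hd' HWi. destruct (Nat.eq_dec i k) as [->|].
           ++ rewrite upd_same. auto.
           ++ apply SM. apply I4; auto; lia.
        -- auto.
      * w1. split; [lia|]. split; auto. split; auto. split; auto. split; auto.
        intros i Hi' Hd' HWi. destruct (Nat.eq_dec i k) as [->|]; [|apply I4; auto; lia]. exact H0.
  - intros T s1 _ Hf (I1 & I2 & I3 & I4 & I5) HT. rewrite Es in *. apply HQ; auto; [|lia].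
    intros u Hu HWu. destruct (nb_surj n es Hwf v u Hu) as (i & Hi & <-). auto.
Qed.

Lemma process_ok P h Q s : Gr n es s -> sv s vV = v -> Wok s -> Qinv s ->
  h < sv s vTl -> sa s aQ h = v ->
  ColOK es P (sa s aCOL) -> (forall e, e < m -> sa s aCOL e <= sv s vNC) ->
  (P = [] \/ exists p, In p P /\ adj es v p) ->
  (forall T s', fr process s s' -> Gr n es s' -> Wok s' -> Qinv s' ->
     sv s vTl <= sv s' vTl ->
     (forall i, i < sv s vTl -> sa s' aQ i = sa s aQ i) ->
     (forall u, adj es v u -> W u = true -> sa s' aSEEN u <> 0) ->
     (forall u, sa s aSEEN u <> 0 -> sa s' aSEEN u <> 0) ->
     ColOK es (P ++ [v]) (sa s' aCOL) -> (forall e, e < m -> sa s' aCOL e <= sv s' vNC) ->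
     T + PhiC n es s' <= d * (D * 100 + 100) + 60 + PhiC n es s +
        (match P with [] => KC n es * D | _ => 0 end) -> Q T s') ->
  wp process Q s.
Proof.
  intros HG HV HW HQI Hh Hqv HC Hnc HP HQ.
  apply wp_fr. unfold process.
  w1. apply (load_nbrs_ok n es Hwf D HD IB B0 HIB v Hv); auto. intros T1 s1 F1 L1 HT1.
  w1. apply (mark_nbrs_ok n es Hwf D HD IB B0 HIB v Hv); auto. intros T2 s2 F2 L2 P2 K2 HT2.
  w1. apply (count_common_ok n es Hwf D HD IB B0 HIB v Hv); auto. intros T3 s3 F3 L3 O3 HT3.
  assert (E3 : Env s3).
  { split; auto. split; auto. unfold PSok. rewrite (proj2 F3) by reflexivity. exact P2. }
  w1. apply (local_classes_ok n es Hwf D HD IB B0 HIB v Hv); auto. intros T4 s4 F4 E4 [B4 B4'] HT4.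
  assert (C4 : sa s4 aCOL = sa s aCOL).
  { rewrite (proj2 F4), (proj2 F3), (proj2 F2), (proj2 F1) by reflexivity. reflexivity. }
  assert (N4 : sv s4 vNC = sv s vNC).
  { rewrite (proj1 F4), (proj1 F3), (proj1 F2), (proj1 F1) by reflexivity. reflexivity. }
  w1. apply (merge_colours_ok n es Hwf D HD IB B0 HIB v Hv (sa s4 aLB) B4 B4' P); auto.
  { rewrite C4. exact HC. }
  { rewrite C4, N4. exact Hnc. }
  intros T5 s5 F5 E5 C5 N5 HT5.
  (* [aSEEN] and [aQ] are modified by [process], but only in its last part, the enqueueing. *)
  assert (XA : forall j, moda process j = false \/ j = aSEEN \/ j = aQ -> sa s5 j = sa s j).
  { intros j Hj.
    rewrite (proj2 F5), (proj2 F4), (proj2 F3), (proj2 F2), (proj2 F1);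
      destruct j; auto; destruct Hj as [Hj|[Hj|Hj]]; discriminate. }
  assert (XT : sv s5 vTl = sv s vTl).
  { rewrite (proj1 F5), (proj1 F4), (proj1 F3), (proj1 F2), (proj1 F1) by reflexivity. reflexivity. }
  assert (EQ : sa s5 aQ = sa s aQ) by (apply XA; auto).
  assert (ESn : sa s5 aSEEN = sa s aSEEN) by (apply XA; auto).
  apply (enqueue_nbrs_ok h); auto.
  { unfold Wok. rewrite XA; auto. }
  { unfold Qinv. rewrite EQ, ESn, XT. exact HQI. }
  { rewrite XT. exact Hh. }
  { rewrite EQ. exact Hqv. }
  intros T6 s6 F6 Q6 M6 K6 A6 S6 HT6. rewrite EQ, ESn, XT in *.
  assert (C6 : sa s6 aCOL = sa s5 aCOL) by (apply F6; reflexivity).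
  assert (N6 : sv s6 vNC = sv s5 vNC) by (apply F6; reflexivity).
  intros Hf. apply HQ; auto;
    [eapply Gr_fr; [|exact F6|apply E5]; reflexivity
    |unfold Wok; rewrite (proj2 F6), XA by auto; exact HW|rewrite C6; auto|rewrite C6, N6; auto|].
  assert (PhiC n es s4 = PhiC n es s) by (unfold PhiC; rewrite C4; reflexivity).
  assert (PhiC n es s6 = PhiC n es s5) by (unfold PhiC; rewrite C6; reflexivity).
  fold d in HT1, HT2, HT3, HT4, HT5, HT6. nia.
Qed.

End Process.

(* The degrees not yet visited pay for the stars, and [KC * D] for the merges of the at most
   [D] colours that are created at the first vertex. *)
Definition PhiS (h : nat) (s : st) : nat :=
  (D * 100 + 100) * (2 * m - degsum (visited s h)) + PhiC n es s +
  (if h =? 0 then KC n es * D else 0).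

Lemma search_ok Q s : Sinv 0 s ->
  (forall T s', fr search s s' -> Gr n es s' -> (forall e f, e < m -> f < m ->
       (sa s' aCOL e = sa s' aCOL f /\ sa s' aCOL e <> 0 <->
        Col es (visited s' n) (edge es e) (edge es f))) ->
     Sinv n s' ->
     T <= n * 65 + 2 + PhiS 0 s -> Q T s') -> wp search Q s.
Proof.
  intros HS HQ. unfold search. assert (EN : sv s vN = n) by (destruct HS as ((EN & _) & _); exact EN).
  apply wp_for with (Phi := PhiS) (b := 63) (I := Sinv); auto.
  - intros h s1 Hk Hi Hy Hf HS1. assert (HS1' := HS1).
    destruct HS1 as (G1 & W1 & Q1 & T1 & C1 & N1 & A1). rewrite EN in *.
    assert (Htl := Qinv_tl s1 Q1).
    w1; rewrite Hi in *.
    + rename H into Hlt. assert (HQ1 := Q1). destruct HQ1 as (R1 & R2 & R3 & R4).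
      destruct (R1 h Hlt) as (V1 & V2 & V3). set (v := sa s1 aQ h) in *.
      w1. w1. rewrite Hi. fold v.
      assert (EO : visited s1 h = map (sa s1 aQ) (seq 0 h)) by (unfold visited; rewrite Nat.min_l by lia; auto).
      set (s2 := setv s1 vV v).
      apply (process_ok v V1 (visited s1 h) h); auto.
      * destruct h as [|h']; [left; reflexivity|right].
        destruct (R4 (S h') ltac:(lia)) as (i & X1 & X2). exists (sa s1 aQ i). split; auto.
        rewrite EO. apply in_map. apply in_seq. lia.
      * intros T3 s3 F3 G3 W3 Q3 M3 K3 A3 S3 C3 N3 HT3.
        unfold s2 in M3, K3, S3; sxin M3; sxin K3; sxin S3.
        assert (EO3 : visited s3 (S h) = visited s1 h ++ [v]).
        { rewrite EO. unfold visited. rewrite Nat.min_l by lia. rewrite seq_S, map_app. simpl.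
          f_equal.
          - apply map_ext_in. intros i Hi'. apply in_seq in Hi'. apply K3. lia.
          - rewrite K3 by lia. reflexivity. }
        assert (SI : Sinv (S h) (setv s3 vH (S h))).
        { split; [exact G3|]. split; [exact W3|]. split; [exact Q3|]. split; [sx; lia|].
          split; [change (visited (setv s3 vH (S h)) (S h)) with (visited s3 (S h));
            rewrite EO3; exact C3|]. split; [exact N3|]. sx.
          intros j u Hj Hj2 Hadj HWu. destruct (Nat.eq_dec j h) as [->|].
          - apply A3; auto. rewrite K3 in Hadj by lia. exact Hadj.
          - apply S3. rewrite K3 in Hadj by lia. apply (A1 j); auto; lia. }
        split; [|exact SI]. 
        assert (H3 := visited_handshake s3 (S h) Q3). rewrite EO3 in H3.
        unfold degsum in H3. rewrite map_app, list_sum_app in H3.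
        cbn [map list_sum fold_right] in H3. fold (degsum (visited s1 h)) in H3.
        unfold PhiS. change (visited (setv s3 vH (S h)) (S h)) with (visited s3 (S h)).
        change (PhiC n es (setv s3 vH (S h))) with (PhiC n es s3).
        change (PhiC n es s2) with (PhiC n es s1) in HT3.
        rewrite EO3. unfold degsum at 1. rewrite map_app, list_sum_app.
        cbn [map list_sum fold_right Nat.eqb]. fold (degsum (visited s1 h)).
        assert (HM : match visited s1 h with [] => KC n es * D | _ => 0 end =
                     if h =? 0 then KC n es * D else 0).
        { rewrite EO. destruct h; reflexivity. }
        rewrite HM in HT3. unfold list_sum in H3; cbn [fold_right] in H3.
        set (ds := degsum (visited s1 h)) in *. set (dl := length (arcs es v)) in *.
        (* The truncated subtraction is exact: by the handshake bound [H3] the degrees of the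
           visited vertices, v included, sum to at most 2m. *)
        assert (Z : (D * 100 + 100) * (2 * m - (ds + (dl + 0))) + dl * (D * 100 + 100) <=
                    (D * 100 + 100) * (2 * m - ds)).
        { replace (dl * (D * 100 + 100)) with ((D * 100 + 100) * dl) by lia.
          rewrite <- Nat.mul_add_distr_l. apply Nat.mul_le_mono_l. lia. }
        unfold list_sum. cbn [fold_right]. lia.
    + w1. assert (EO3 : visited (setv s1 vH (S h)) (S h) = visited s1 h).
      { unfold visited. sx. rewrite !Nat.min_r by lia. reflexivity. }
      split.
      * unfold PhiS. rewrite EO3. change (PhiC n es (setv s1 vH (S h))) with (PhiC n es s1).
        cbn [Nat.eqb]. lia.
      * unfold Sinv. rewrite EO3. repeat (split; auto). sx.
        intros j u Hj Hj2. apply A1; auto. lia.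
  - intros T s1 Hi Hf HS1 HT. rewrite EN in *. apply HQ; auto.
    + apply HS1.
    + destruct HS1 as (_ & _ & _ & _ & C1 & _). exact C1.
    + change (PhiS 0 (setv s vH 0)) with (PhiS 0 s) in HT. lia.
Qed.

End Main.

(** * Reading the encoded input *)

Section Encoding.

Context (n : nat) (es : list Edge) (W : nat -> bool).
Let m := length es.

Lemma encode_edge k : k < m ->
  encode n es W (2 + 2 * k) = fst (edge es k) /\ encode n es W (3 + 2 * k) = snd (edge es k).
Proof.
  intros Hk. unfold encode. fold m. split.
  - destruct (Nat.eqb_spec (2 + 2 * k) 0); [lia|]. destruct (Nat.eqb_spec (2 + 2 * k) 1); [lia|].
    destruct (Nat.ltb_spec (2 + 2 * k) (2 + 2 * m)); [|lia].
    replace (2 + 2 * k - 2) with (2 * k) by lia.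
    replace (Nat.even (2 * k)) with true by (symmetry; apply Nat.even_spec; exists k; lia).
    rewrite Nat.mul_comm, Nat.div_mul by lia. reflexivity.
  - destruct (Nat.eqb_spec (3 + 2 * k) 0); [lia|]. destruct (Nat.eqb_spec (3 + 2 * k) 1); [lia|].
    destruct (Nat.ltb_spec (3 + 2 * k) (2 + 2 * m)); [|lia].
    replace (3 + 2 * k - 2) with (1 + k * 2) by lia.
    rewrite Nat.div_add by lia.
    replace (Nat.even (1 + k * 2)) with false.
    + reflexivity.
    + symmetry. rewrite Nat.even_add_mul_2 || (rewrite Nat.mul_comm, Nat.even_add_mul_2). reflexivity.
Qed.

Lemma encode_W u : u < n -> encode n es W (2 + 2 * m + u) = if W u then 1 else 0.
Proof.
  intros Hu. unfold encode. fold m.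
  destruct (Nat.eqb_spec (2 + 2 * m + u) 0); [lia|].
  destruct (Nat.eqb_spec (2 + 2 * m + u) 1); [lia|].
  destruct (Nat.ltb_spec (2 + 2 * m + u) (2 + 2 * m)); [lia|].
  destruct (Nat.ltb_spec (2 + 2 * m + u) (2 + 2 * m + n)); [|lia].
  replace (2 + 2 * m + u - (2 + 2 * m)) with u by lia. reflexivity.
Qed.

Lemma encode_le : wf_graph n es -> forall a, encode n es W a <= n + m + 1.
Proof.
  intros Hwf a. unfold encode. fold m.
  destruct (a =? 0); [lia|]. destruct (a =? 1); [lia|].
  destruct (Nat.ltb_spec a (2 + 2 * m)).
  - destruct (Nat.lt_ge_cases (Nat.div (a - 2) 2) m) as [h|h].
    + assert (X := edge_lt n es Hwf _ h). unfold edge in X. destruct (Nat.even _); lia.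
    + rewrite nth_overflow by exact h. destruct (Nat.even _); simpl; lia.
  - destruct (_ <? _); [|lia]. destruct (W _); lia.
Qed.

End Encoding.

(** * The whole program and its running time *)

Section Main.

Context (n : nat) (es : list Edge) (W : nat -> bool) (Hwf : wf_graph n es).
Let m := length es.
Context (D : nat) (HD : forall u, u < n -> length (arcs es u) <= D) (HD1 : 1 <= D).
Let IB := n + 4 * m + KR.
Let B0 := n + 4 * m + KR.
Notation wp := (wp IB B0).
Context (Hn2 : 2 <= n) (Hnm : n <= 2 * m).

Definition IN_ok (s : st) : Prop :=
  forall a, 2 <= a < n + 4 * m -> sa s aIN a = encode n es W a.

Lemma copy_ok Q s : init_ok n es W s ->
  (forall T s', fr copy_input s s' -> IN_ok s' -> T <= (n + 4 * m) * 4 + 2 -> Q T s') ->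
  wp copy_input Q s.
Proof.
  intros (_ & _ & HP & HI & HL & _) HQ. fold m in HP, HI, HL. unfold copy_input.
  apply wp_for with (Phi := fun _ _ => 0) (b := 2)
    (I := fun k s' => forall a, 2 <= a < n + 4 * m -> a < KR \/ a < k ->
       sa s' aIN a = encode n es W a); auto.
  - intros a Ha Hak. sx. apply HI; lia.
  - intros k s1 Hk Hi Hy Hf I1. rewrite HP in *.
    assert (L1 : sa s1 aLOW = sa s aLOW) by (apply Hf; reflexivity).
    w1; rewrite Hi in *.
    + w1. split; [lia|]. intros a Ha Hak. apply I1; auto. lia.
    + apply wp_store; [ok|ok; unfold B0; lia|ok; unfold IB; lia|]. sx. rewrite Hi, L1.
      split; [lia|]. intros a Ha Hak. unfold upd. destruct (Nat.eqb_spec a k) as [->|].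
      * apply HL. lia.
      * apply I1; auto. lia.
  - intros T s1 Hi Hf I1 HT. rewrite HP in *. apply HQ; auto; [|lia].
    intros a Ha. apply I1; lia.
Qed.

Lemma build_ok Q s : IN_ok s -> sv s vN = n -> sv s vM = m -> (forall u, sa s aHD u = 0) ->
  (forall T s', fr build s s' -> Gr n es s' -> sv s' vA = 2 + 2 * m ->
     T <= m * 15 + 4 -> Q T s') -> wp build Q s.
Proof.
  intros HIN HN HM H0 HQ.
  apply wp_fr. unfold build. w1. w1. w1. w1.
  apply wp_for with (Phi := fun _ _ => 0) (b := 13)
    (I := fun k s' => sv s' vA = 2 + 2 * k /\ sv s' vC = 2 * k /\
      forall u, chain (2 * k) (sa s' aNX) (sa s' aTO) (sa s' aEI) (sa s' aHD u) (adjl (edge es) k u)); auto.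
  - sx. rewrite HM. intros k s1 Hk Hi Hy Hf (I1 & I2 & I3).
    assert (LIN : sa s1 aIN = sa s aIN) by (apply Hf; reflexivity).
    assert (Hab := edge_lt n es Hwf k Hk).
    destruct (encode_edge n es W k Hk) as [X1 X2].
    set (a := fst (edge es k)) in *. set (b := snd (edge es k)) in *.
    assert (R1 : sa s1 aIN (2 + 2 * k) = a) by (rewrite LIN, HIN by lia; auto).
    assert (R2 : sa s1 aIN (3 + 2 * k) = b) by (rewrite LIN, HIN by lia; auto).
    assert (HIB : n + 2 * m + 27 <= IB) by (unfold IB; lia).
    unfold add_arc. w1. w1. rewrite I1, R1. w1. w1. rewrite I1.
    replace (2 + 2 * k + 1) with (3 + 2 * k) by lia. rewrite R2.
    w1. w1. rewrite I1. w1. 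
    do 4 (w1; w1). w1. w1. w1. w1. w1. w1. w1. w1. w1. w1. rewrite I2, Hi. 
    split; [lia|]. split; [lia|]. split; [lia|].
    replace (2 * k + 1 + 1) with (2 * k + 2) by lia.
    set (c1 := 2 * k + 1). set (c2 := 2 * k + 2).
    assert (Hc : c1 <> c2) by lia. assert (Hab' : a <> b) by lia.
    (* The two new arcs have numbers above 2k, so the lists built so far do not see the updates. *)
    assert (Ext : forall u, chain (2 * S k)
       (upd (upd (sa s1 aNX) c1 (sa s1 aHD a)) c2 (upd (sa s1 aHD) a c1 b))
       (upd (upd (sa s1 aTO) c1 b) c2 a) (upd (upd (sa s1 aEI) c1 k) c2 k)
       (sa s1 aHD u) (adjl (edge es) k u)).
    { intros u. eapply chain_ext; [| |apply I3]; [lia|].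
      intros q Hq. rewrite !upd_other by lia. auto. }
    (* The eighth [upd] is the outer update of [aHD], the one at b, which decides whether the list
       of u starts with the last arc added. *)
    intros u. cbn [adjl]. fold a b. unfold upd at 8.
    destruct (Nat.eqb_spec u b) as [->|Hub].
    + destruct (Nat.eqb_spec a b); [lia|]. rewrite Nat.eqb_refl. cbn [chain].
      rewrite !upd_same. split; [lia|]. split; [reflexivity|]. split; [reflexivity|].
      rewrite (upd_other (sa s1 aHD)) by auto.
      specialize (Ext b). rewrite (upd_other (sa s1 aHD)) in Ext by auto. exact Ext.
    + rewrite (Nat.eqb_sym a u), (Nat.eqb_sym b u).
      destruct (Nat.eqb_spec u a) as [->|Hua].
      * rewrite upd_same. cbn [chain].
        rewrite !(upd_other _ c2 _ c1) by auto. rewrite !upd_same.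
        split; [lia|]. split; [reflexivity|]. split; [reflexivity|]. apply Ext.
      * destruct (Nat.eqb_spec u b); [contradiction|].
        rewrite (upd_other (sa s1 aHD) a _ u) by auto. apply Ext.
  - sx. rewrite HM. intros T s1 Hi Hf (I1 & I2 & I3) HT Hf'. apply HQ; [exact Hf'| |exact I1|lia].
    split; [rewrite (proj1 Hf') by reflexivity; auto|].
    split; [rewrite (proj1 Hf') by reflexivity; auto|]. intros u _. apply I3.
Qed.

Lemma read_W_ok Q s : IN_ok s -> sv s vN = n -> sv s vA = 2 + 2 * m -> (forall u, sa s aW u = 0) ->
  (exists w, inW n W w) ->
  (forall T s', fr read_W s s' -> Wok n W s' -> sv s' vR < n -> W (sv s' vR) = true ->
     T <= n * 6 + 2 -> Q T s') -> wp read_W Q s.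
Proof.
  intros HIN HN HA H0 [w [Hw1 Hw2]] HQ. unfold read_W.
  assert (HIB : n + 2 * m + 27 <= IB) by (unfold IB; lia).
  apply wp_for with (Phi := fun _ _ => 0) (b := 4)
    (I := fun k s' => sv s' vA = 2 + 2 * m + k /\
      (forall u, u < k -> sa s' aW u = if W u then 1 else 0) /\
      (forall u, k <= u -> sa s' aW u = 0) /\
      ((exists u, u < k /\ W u = true) -> sv s' vR < k /\ W (sv s' vR) = true)); auto.
  - sx. split; [lia|]. split; [intros; lia|]. split; auto. intros (u & Hu & _). lia.
  - rewrite HN. intros k s1 Hk Hi Hy Hf (I1 & I2 & I3 & I4).
    assert (LIN : sa s1 aIN = sa s aIN) by (apply Hf; reflexivity).
    assert (EW := encode_W n es W k Hk). fold m in EW.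
    assert (R1 : sa s1 aIN (2 + 2 * m + k) = if W k then 1 else 0)
      by (rewrite LIN, HIN by lia; auto).
    w1. w1; rewrite I1, R1 in *.
    + w1. w1. rewrite I1. destruct (W k) eqn:EK; [discriminate|]. 
      split; [lia|]. split; [lia|]. split; [|split].
      * intros u Hu. destruct (Nat.eq_dec u k) as [->|]; [rewrite EK; apply I3; auto|apply I2; lia].
      * intros u Hu. apply I3; lia.
      * intros (u & Hu & HWu). destruct (Nat.eq_dec u k) as [->|]; [congruence|].
        destruct I4 as [J1 J2]; [exists u; split; auto; lia|]. split; auto.
    + destruct (W k) eqn:EK; [|congruence].
      w1. w1. w1. w1. rewrite I1, Hi. split; [lia|]. split; [lia|]. split; [|split].
      * intros u Hu. unfold upd. destruct (Nat.eqb_spec u k) as [->|]; [rewrite EK; auto|apply I2; lia].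
      * intros u Hu. rewrite upd_other by lia. apply I3; lia.
      * intros _. auto.
  - rewrite HN. intros T s1 Hi Hf (I1 & I2 & I3 & I4) HT.
    destruct I4 as [J1 J2]; [eauto|]. apply HQ; auto. lia.
Qed.

(** The summands are the costs of copying, of building the lists, of reading W and the search rounds
    (71 = 6 + 65), and of the output, then those of the stars and of the merges paid for by the
    first vertex. *)
Definition bound : nat := (n + 4 * m) * 4 + m * 15 + n * 71 + m * 4 + 20 +
  (D * 100 + 100) * (2 * m) + KC n es * D.

Lemma main_ok s : init_ok n es W s -> induced_connected n es W ->
  wp main (fun T s' => T <= bound /\
    (forall i, KR <= i < m -> sa s' aLOW i = sa s' aCOL i) /\
    forall e f, e < m -> f < m ->
      (sa s' aCOL e = sa s' aCOL f /\ sa s' aCOL e <> 0 <->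
       global_coloring n es W (edge es e) (edge es f))) s.
Proof.
  intros HI HIC. assert (HI' := HI). destruct HI' as (HN & HM & HP & _ & _ & HZ). fold m in HM.
  assert (HIB : n + 2 * m + 27 <= IB) by (unfold IB; lia).
  assert (HIB2 : n + 2 * m + 2 <= IB) by lia.
  unfold main. w1. apply copy_ok; auto. intros T1 s1 F1 IN1 HT1.
  w1. apply build_ok; auto.
  { rewrite (proj1 F1) by reflexivity. auto. }
  { rewrite (proj1 F1) by reflexivity. auto. }
  { intros u. rewrite (proj2 F1) by reflexivity. apply HZ; discriminate. }
  intros T2 s2 F2 G2 A2 HT2.
  w1. apply read_W_ok; auto.
  { unfold IN_ok. rewrite (proj2 F2) by reflexivity. exact IN1. }
  { apply G2. }
  { intros u. rewrite (proj2 F2), (proj2 F1) by reflexivity. apply HZ; discriminate. }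
  { apply HIC. }
  intros T3 s3 F3 W3 R3 R3' HT3.
  assert (G3 : Gr n es s3) by (eapply Gr_fr; [|exact F3|exact G2]; reflexivity).
  assert (HSE : forall u, sa s3 aSEEN u = 0).
  { intros u. rewrite (proj2 F3), (proj2 F2), (proj2 F1) by reflexivity. apply HZ; discriminate. }
  assert (HCO : forall u, sa s3 aCOL u = 0).
  { intros u. rewrite (proj2 F3), (proj2 F2), (proj2 F1) by reflexivity. apply HZ; discriminate. }
  unfold start. w1. w1. w1. w1. w1. w1. w1. w1.
  set (r := sv s3 vR) in *.
  set (s4 := setv _ _ _).
  assert (S4 : Sinv n es W 0 s4).
  { unfold s4. split; [exact G3|]. split; [exact W3|]. split; [|split; [|split; [|split]]].
    - unfold Qinv. sx. fold r. split; [|split; [|split]].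
      + intros i Hi. replace i with 0 by lia. rewrite !upd_same. auto.
      + intros; lia.
      + intros u Hu. unfold upd. destruct (Nat.eqb_spec u r) as [->|]; [|rewrite HSE; lia].
        intros _. exists 0. auto.
      + intros; lia.
    - sx. lia.
    - unfold visited. simpl. intros e f He Hf. rewrite !HCO. split; [tauto|].
      intros X. exfalso. induction X as [x y (u & [] & _)|x y z _ IH _ _]. exact IH.
    - intros e He. sx. rewrite HCO. lia.
    - intros j u Hj. lia. }
  w1. apply (search_ok n es W Hwf D HD IB B0 HIB2); auto.
  intros T5 s5 F5 G5 C5 S5 HT5.
  assert (EP : PhiS n es D 0 s4 <= (D * 100 + 100) * (2 * m) + KC n es * D).
  { unfold PhiS. assert (PhiC n es s4 = 0).
    { unfold PhiC. replace (dcc es (sa s4 aCOL)) with 0; [lia|].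
      symmetry. apply Nat.le_0_r. apply (dcount_le _ _ _ []).
      intros i Hi. unfold s4. sx. rewrite HCO. discriminate. }
    rewrite H. cbn [Nat.eqb]. fold m.
    assert ((D * 100 + 100) * (2 * m - degsum es (visited s4 0)) <= (D * 100 + 100) * (2 * m))
      by (apply Nat.mul_le_mono_l; lia). lia. }
  unfold output. assert (EM : sv s5 vM = m) by apply G5.
  apply wp_for with (Phi := fun _ _ => 0) (b := 2)
    (I := fun k s' => sa s' aCOL = sa s5 aCOL /\
       forall i, KR <= i -> i < k -> sa s' aLOW i = sa s5 aCOL i); auto.
  - split; auto. intros; lia.
  - rewrite EM. intros k s6 Hk Hi Hy Hf [I1 I2]. w1; rewrite Hi in *.
    + w1. split; [lia|]. split; auto. intros i Hi1 Hi2. apply I2; auto. lia.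
    + apply wp_store; [ok|ok|ok; unfold B0; lia|]. sx. rewrite Hi, I1. split; [lia|]. split; auto.
      intros i Hi1 Hi2. unfold upd. destruct (Nat.eqb_spec i k) as [->|]; auto. apply I2; auto. lia.
  - rewrite EM. intros T6 s6 Hi Hf [I1 I2] HT6. split; [|split].
    + unfold bound. lia.
    + intros i Hi1. rewrite I1. apply I2; lia.
    + intros e f He Hf'. rewrite I1, (C5 e f He Hf').
      assert (OW := visited_W n es W s5 HIC S5).
      split; intros X; (induction X as [x y H|x y z _ IH1 _ IH2]; [apply t_step|eapply t_trans; eauto]);
        destruct H as (u & Hu & HdS); exists u; split; auto; apply OW; auto.
Qed.

End Main.

Theorem mainTheorem7 :
  exists (P : program) (c k : nat),
  forall (n : nat) (es : list Edge) (W : nat -> bool),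
    wf_graph n es ->
    connected_graph n es ->
    induced_connected n es W ->
    let m := length es in
    let Delta := maxdeg n es in
    exists T : nat,
      let cfg := run P (0, encode n es W) T in
      halted P cfg /\
      (* time O(|E| Delta) *)
      T <= c * (m * Delta + 1) /\
      (* space O(|E| + Delta^2): every accessed register address is below the bound *)
      (forall i, i < T ->
         forall a, In a (accessed P (run P (0, encode n es W) i)) ->
           a < c * (m + Delta * Delta + 1)) /\
      (* word size O(log(input size)) *)
      (forall i, i < T ->
         written P (run P (0, encode n es W) i) <= (n + m + 2) ^ k) /\
      (* correctness: the output encodes d_{|S_v}(W)^* *)
      output_represents (snd cfg) es (global_coloring n es W).
Proof.
  (* Kept as variables so that the arithmetic never unfolds the compiled program. *)
  remember (length prologue + length epilogue + 1) as k0 eqn:Hk0.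
  remember (cC main) as cc eqn:Hcc. remember (kC main) as kk eqn:Hkk.
  exists (ram main), (k0 + cc * 2000 + 1000), (20 + kk).
  intros n es W Hwf Hcon HW m Delta.
  destruct (Nat.eq_dec m 0) as [Hm|Hm].
  - exists 1.
    assert (Es : es = []) by (destruct es; [auto|discriminate]).
    destruct (reach_jz (ram main) 2 0 0 (encode n es W) 1 _ (ram_start main) ltac:(lia)) as [R1 R2].
    replace (encode n es W 1) with 0 in R1 by (symmetry; exact Hm). cbn [Nat.eqb] in R1.
    cbv zeta. rewrite R1. split; [|split; [|split; [|split]]].
    + right. cbn [fst]. apply nth_error_None. lia.
    + nia.
    + intros i Hi a Ha. assert (a < 2) by (apply (R2 i Hi); auto). nia.
    + intros i Hi. destruct (R2 i Hi) as [_ X]. lia.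
    + intros i j Hi. fold m in Hi. lia.
  - assert (Hn2 : 2 <= n).
    { destruct es as [|[a b] es']; [contradiction|]. assert (a < b < n) by (apply Hwf; left; auto). lia. }
    assert (Hnm := connected_size n es Hwf Hcon Hn2). fold m in Hnm.
    assert (HD : forall u, u < n -> length (arcs es u) <= Delta)
      by (intros; apply length_arcs_maxdeg; auto).
    assert (HD1 : 1 <= Delta).
    { destruct (connected_nbr n es 0 Hcon Hn2) as [u Hu]; [lia|].
      apply (in_nbrs n es Hwf) in Hu. etransitivity; [|apply (HD 0); lia].
      rewrite <- length_nbrs. destruct (nbrs es 0); [contradiction|simpl; lia]. }
    assert (HDm : Delta <= m) by apply maxdeg_le.
    destruct (ram_correct n es W Hn2 ltac:(fold m; lia) (encode_le n es W Hwf) main _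
      (fun s HI => main_ok n es W Hwf Delta HD HD1 Hn2 Hnm s HI HW))
      as (T & t & s' & m' & (B1 & B2 & B3) & [R1 R2] & B4 & B5 & B6).
    fold m in R1, R2, B4, B5, B6, B1, B2, B3. rewrite <- Hk0, <- Hcc in B4. rewrite <- Hkk in R2.
    clear Hk0 Hcc Hkk.
    exists T. cbv zeta. rewrite R1.
    (* The linear terms are absorbed using n at most 2m and Delta at least 1. *)
    assert (Hb : t <= 1000 * (m * Delta)).
    { unfold bound, KC in B1. fold m in B1. nia. }
    split; [|split; [|split; [|split]]].
    + right. cbn [fst]. apply nth_error_None. lia.
    + assert (cc * t <= cc * 1000 * (m * Delta)) by nia. nia.
    (* All arrays have size linear in n + 4m and the stride is constant, so the addresses used are
       in fact O(m). *)
    + intros i Hi a Ha. assert (X := proj1 (R2 i Hi) a Ha). unfold Amax in X. nia.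
    + intros i Hi. etransitivity; [apply (R2 i Hi)|].
      (* A base of at least 5 makes the fifth power exceed the constants of the layout and of the
         running time, which are thereby absorbed into the exponent. *)
      assert (Hx : 5 <= n + m + 2) by lia. set (x := n + m + 2) in *.
      assert (P5 : 3125 <= x ^ 5) by (change 3125 with (5 ^ 5); apply Nat.pow_le_mono_l; auto).
      assert (Pk : kk <= x ^ kk).
      { transitivity (2 ^ kk); [apply Nat.lt_le_incl, Nat.pow_gt_lin_r; lia|].
        apply Nat.pow_le_mono_l; lia. }
      assert (X1 : Amax (n + 4 * m + 27) (n + 4 * m + 27) <= x ^ 6).
      { change (x ^ 6) with (x * x ^ 5). unfold Amax. unfold x at 1. nia. }
      assert (X2 : kk * t <= x ^ (7 + kk)).
      { rewrite Nat.pow_add_r, Nat.mul_comm. apply Nat.mul_le_mono; auto.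
        change (x ^ 7) with (x * (x * x ^ 5)).
        assert (m * Delta <= x * x) by (apply Nat.mul_le_mono; lia). nia. }
      assert (X3 : x ^ 6 <= x ^ (7 + kk)) by (apply Nat.pow_le_mono_r; lia).
      assert (X4 : x ^ (8 + kk) <= x ^ (20 + kk)) by (apply Nat.pow_le_mono_r; lia).
      assert (X5 : 2 * x ^ (7 + kk) <= x ^ (8 + kk)).
      { change (8 + kk) with (S (7 + kk)). rewrite Nat.pow_succ_r'.
        apply Nat.mul_le_mono_r. lia. }
      lia.
    (* Labels of the first 27 edges come from the epilogue, the others from [output]. *)
    + cbn [snd]. assert (Hm' : forall i, i < m -> m' i = sa s' aCOL i).
      { intros i Hi. destruct (Nat.lt_ge_cases i 27); [auto|]. rewrite B6 by lia. apply B2. lia. }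
      intros i j Hi Hj. rewrite !Hm' by auto. apply B3; auto.
Qed.
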